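(* Let $\lambda:[0,1)\to[0,+\infty)$ be an increasing function with $\lambda(0)=0$ such that $\lambda(t)=o(t|\log t|^\omega)$ as $t\to 0$ for every $\omega>0$. Then: (i) $H_\lambda(D_+(f))=0$ for each zero-free function $f\in A^{-\infty}$; (ii) $H_\lambda(D_-(f))=0$ for each $f\in A^{-\infty}$.
   Context: $\mathbf D$ is the open unit disc and $\mathbf T$ the unit circle. $A^{-\infty}$ (the Korenblum space) is the set of analytic functions $f$ in $\mathbf D$ for which there exist constants $C,k$ with $|f(z)|\le C(1-|z|)^{-k}$ for all $z\in\mathbf D$. For $f\in A^{-\infty}$, $D_+(f)=\{\theta\in[0,2\pi):\ \liminf_{r\to1}\frac{\log|f(re^{i\theta})|}{|\log(1-r)|}>0\}$ and $D_-(f)=\{\theta\in[0,2\pi):\ \limsup_{r\to1}\frac{\log|f(re^{i\theta})|}{|\log(1-r)|}<0\}$ (sets of $\theta$ identified with points $e^{i\theta}\in\mathbf T$). For an increasing $\lambda:[0,1)\to[0,\infty)$ with $\lambda(0)=0$, the Hausdorff measure of $C\subset\mathbf T$ is $H_\lambda(C)=\lim_{\epsilon\to0}\inf\{\sum_s\lambda(|J_s|): C\subset\bigcup_s J_s,\ |J_s|<\epsilon\}$, where the $J_s$ are arcs of $\mathbf T$ and $|J|$ denotes arc length.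
   Formalization: In (ii) the function f is assumed not identically zero; for f = 0 the set D_-(f) is all of T, and with λ(t) = t one has H_λ(T) = 2π, so the claim as written fails there. *)

(* Defs.v *)
From Stdlib Require Import Reals ZArith ClassicalEpsilon.
From Coquelicot Require Import Coquelicot.
Open Scope R_scope.

Definition in_disc (z : C) : Prop := Cmod z < 1.

Definition analytic_on_disc (f : C -> C) : Prop :=
  forall z : C, in_disc z -> ex_derive f z.

Definition Korenblum (f : C -> C) : Prop :=
  analytic_on_disc f /\
  exists Cst k : R, forall z : C, in_disc z ->
    Cmod (f z) <= Cst * Rpower (1 - Cmod z) (- k).

Definition zero_free (f : C -> C) : Prop :=
  forall z : C, in_disc z -> f z <> 0%C.

Definition polar (r theta : R) : C := (r * cos theta, r * sin theta)%R.

Definition growth_ratio (f : C -> C) (theta r : R) : R :=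
  ln (Cmod (f (polar r theta))) / Rabs (ln (1 - r)).

(* liminf_{r->1^-} log|f(re^{iθ})|/|log(1-r)| > 0, written out:
   there is c > 0 such that for r close to 1 (r<1) the ratio exceeds c
   (points where f vanishes have log|f| = -oo and are excluded). *)
Definition D_plus (f : C -> C) (theta : R) : Prop :=
  0 <= theta < 2 * PI /\
  exists c : R, 0 < c /\ exists delta : R, 0 < delta /\
    forall r : R, 1 - delta < r < 1 ->
      f (polar r theta) <> 0%C /\ c < growth_ratio f theta r.

(* limsup_{r->1^-} log|f(re^{iθ})|/|log(1-r)| < 0, written out:
   there is c > 0 such that for r close to 1 the ratio is below -c
   (where f vanishes, log|f| = -oo, which is below -c). *)
Definition D_minus (f : C -> C) (theta : R) : Prop :=
  0 <= theta < 2 * PI /\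
  exists c : R, 0 < c /\ exists delta : R, 0 < delta /\
    forall r : R, 1 - delta < r < 1 ->
      f (polar r theta) = 0%C \/ growth_ratio f theta r < - c.

(* The closed arc {e^{it} : a <= t <= a + l} of T (length l), and membership
   of the angle theta (identified with e^{i theta}). *)
Definition in_arc (a l theta : R) : Prop :=
  exists k : Z, a <= theta + 2 * PI * IZR k <= a + l.

Definition nn_series_Rbar (u : nat -> R) : Rbar :=
  match excluded_middle_informative (ex_series u) with
  | left _ => Finite (Series u)
  | right _ => p_infty
  end.

Definition cover_values (lam : R -> R) (eps : R) (Cset : R -> Prop) (x : Rbar) : Prop :=
  exists a l : nat -> R,
    (forall n, 0 <= l n /\ l n < eps /\ l n <= 2 * PI) /\
    (forall theta, Cset theta -> exists n, in_arc (a n) (l n) theta) /\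
    x = nn_series_Rbar (fun n => lam (l n)).

Definition H_content (lam : R -> R) (eps : R) (Cset : R -> Prop) : Rbar :=
  Glb_Rbar (cover_values lam eps Cset).

(* H_lambda(C) = lim_{eps->0} H_content eps C; the content is nonincreasing
   in eps, so the limit is the supremum over 0 < eps <= 1. *)
Definition Hausdorff (lam : R -> R) (Cset : R -> Prop) : Rbar :=
  Lub_Rbar (fun x => exists eps : R, 0 < eps <= 1 /\ x = H_content lam eps Cset).

(* Main.v *)
(** Write r(s) = 1 - e^(-s), so that a point of D_- (resp. D_+) lies in one of countably many sets E on
    which |f(r(s) e^(i th))| <= e^(-cs) (resp. >= e^(cs)) for all s >= sigma. It suffices that the
    e^(-tau)-neighbourhoods of E have measure O(tau^(-w)) for some w > 0, along tau = tau0 A^k: then E is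
    covered by O(tau^(-w) e^tau) arcs of length about e^(-tau), and lambda(t) = o(t |log t|^w) concludes.

    Decay. Let v_s = K s - log |f(r(s) .)|, which is >= 0 by the growth bound. A Cauchy estimate shows
    v_s >= (K + c/2) s on the e^(-Ms)-neighbourhood of E, M = K + 3 + c. Since log |f| is subharmonic,
    the Poisson average of v_s' from the circle r(s') to the circle r(s) is at most v_s + K (s' - s).
    Hence, for a_k the integral of v_s / s over the neighbourhood at stage k and b_k the measure of
    that neighbourhood, a_(k+1) <= (1 + o(1)) (a_k / A + K (1 - 1/A) b_k) and (K + c/2) b_(k+1) <= a_k,
    which forces geometric decay. The cutoffs are much wider than the Poisson kernels, and v >= 0, so that
    leakage costs only a factor. Here log |f| is truncated to log max(|f|, e), the bounds being uniform in e.

    Growth. Now log |f| is harmonic. Its integral over the neighbourhood at scale T = e^(-tau) is at most about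
    6 K tau times the measure; on the far smaller neighbourhood at scale e^(-Ms), s = A1 tau, it is at
    least (c/2) s times the measure. The difference of the two neighbourhoods cannot compensate: by
    Harnack's inequality with a point of E at comparable distance, v_s has integral O(s) times the measure
    there. So the measure drops by a fixed factor whenever tau is multiplied by A.

    All harmonic analysis comes from Goursat's theorem on rectangles, through Cauchy's formula and the maximum
    principle applied to f exp(-H), H the Schwarz integral of a majorant of log |f| on a circle. *)
Require Import Defs.
From Stdlib Require Import Reals.
From Coquelicot Require Import Coquelicot.
From Stdlib Require Import Lra Lia Psatz ZArith ClassicalEpsilon Classical Cantor.
Open Scope R_scope.

(** * Complex differentiability *)

(** [E] may be a null set, so a radial bound on it says nothing to an integral until it is spread
    over a neighbourhood. Two scales then compete: the Cauchy estimate keeps the values on the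
    circle at [rad s] stable only within [exp (- (M * s))], while a Poisson average that lands on
    that circle blurs everything finer than [exp (- s)]. Every comparison thus multiplies [tau] by a
    fixed factor, and iteration gives a negative power of [tau]; this is the kind of decay that o(t
    |log t|^omega), for all omega, can absorb. For decay the balance is critical at c = 0: averaging
    refills the normalised deficit up to level K, and only the demand K + c/2 near [E] makes a
    combination of the two masses contract. The start of that iteration needs one point where [f]
    does not vanish; if [f] were identically 0, every angle would belong to [D_minus f]. Measures
    are replaced throughout by Riemann integrals of Lipschitz cutoffs, and arc length by chords, so
    that periodicity is automatic and the Poisson denominator is a polynomial in the distance. *)

Ltac rmins := repeat match goal with
  | H : context [Rmin ?a ?b] |- _ =>
    lazymatch goal with
    | _ : Rmin a b <= a |- _ => fail
    | _ => pose proof (Rmin_l a b); pose proof (Rmin_r a b)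
    end
  end.

(** The weak inequality makes [w = z] harmless, so no punctured neighbourhood is needed. *)
Definition cderiv (f : C -> C) (z l : C) : Prop :=
  forall eps : R, 0 < eps -> exists d : R, 0 < d /\
    forall w : C, Cmod (w - z) < d ->
      Cmod (f w - f z - l * (w - z)) <= eps * Cmod (w - z).

Definition cdiff (f : C -> C) (z : C) : Prop := exists l, cderiv f z l.

Definition ccont (f : C -> C) (z : C) : Prop :=
  forall eps : R, 0 < eps -> exists d : R, 0 < d /\
    forall w : C, Cmod (w - z) < d -> Cmod (f w - f z) < eps.

Lemma re_le_Cmod (z : C) : Rabs (fst z) <= Cmod z.
Proof.
  pose proof (Rmax_Cmod z). pose proof (Rmax_l (Rabs (fst z)) (Rabs (snd z))). lra.
Qed.

Lemma im_le_Cmod (z : C) : Rabs (snd z) <= Cmod z.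
Proof.
  pose proof (Rmax_Cmod z). pose proof (Rmax_r (Rabs (fst z)) (Rabs (snd z))). lra.
Qed.

Lemma Cmod_le_abs (z : C) : Cmod z <= Rabs (fst z) + Rabs (snd z).
Proof.
  destruct z as [x y]. unfold Cmod; simpl fst; simpl snd.
  pose proof (Rabs_pos x). pose proof (Rabs_pos y).
  rewrite <- (sqrt_pow2 (Rabs x + Rabs y)) by lra.
  apply sqrt_le_1_alt. rewrite <- (pow2_abs x), <- (pow2_abs y). nra.
Qed.

Lemma Cmod_sqr (z : C) : Cmod z ^ 2 = fst z ^ 2 + snd z ^ 2.
Proof. unfold Cmod. rewrite pow2_sqrt; nra. Qed.

Lemma Cmod_minus_sym (z w : C) : Cmod (z - w) = Cmod (w - z).
Proof. rewrite <- Cmod_opp. f_equal. ring. Qed.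

Lemma Cmod_triangle_minus (z w : C) : Cmod z - Cmod w <= Cmod (z - w).
Proof.
  pose proof (Cmod_triangle (z - w) w). replace (z - w + w)%C with z in H by ring. lra.
Qed.

Lemma ex_derive_cdiff (f : C -> C) (z : C) : ex_derive f z -> cdiff f z.
Proof.
  intros [l [_ H]]. exists l. intros eps Heps.
  specialize (H z (fun P HP => HP) (mkposreal eps Heps)).
  apply (locally_le_locally_norm (K := C_AbsRing) (V := AbsRing_NormedModule C_AbsRing)) in H.
  destruct H as [d Hd].
  exists d. split; [apply cond_pos|]. intros w Hw.
  specialize (Hd w). simpl in Hd.
  assert (Hb : ball_norm (K := C_AbsRing) (V := AbsRing_NormedModule C_AbsRing) z d w) by exact Hw.
  specialize (Hd Hb).
  replace (l * (w - z))%C with (mult (minus w z : C_AbsRing) l) by (unfold minus, plus, opp, mult; simpl; ring).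
  exact Hd.
Qed.

Lemma cderiv_ccont (f : C -> C) (z l : C) : cderiv f z l -> ccont f z.
Proof.
  intros H eps He. destruct (H 1 Rlt_0_1) as [d [Hd H1]].
  pose proof (Cmod_ge_0 l) as Hl.
  exists (Rmin d (eps / (2 + Cmod l))). split.
  { apply Rmin_glb_lt; auto. apply Rdiv_lt_0_compat; lra. }
  intros w Hw. rmins.
  assert (Hw1 : Cmod (w - z) < d) by lra.
  specialize (H1 w Hw1).
  replace (f w - f z)%C with ((f w - f z - l * (w - z)) + l * (w - z))%C by ring.
  eapply Rle_lt_trans; [apply Cmod_triangle|]. rewrite Cmod_mult.
  assert (Cmod (w - z) * (2 + Cmod l) < eps).
  { apply Rlt_div_r; [lra|]. lra. }
  pose proof (Cmod_ge_0 (w - z)). nra.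
Qed.

Lemma cdiff_ccont (f : C -> C) (z : C) : cdiff f z -> ccont f z.
Proof. intros [l Hl]. eapply cderiv_ccont; eauto. Qed.

Lemma cderiv_const (c z : C) : cderiv (fun _ => c) z 0.
Proof.
  intros eps He. exists 1. split; [lra|]. intros w _.
  replace (c - c - 0 * (w - z))%C with (RtoC 0) by ring. rewrite Cmod_0.
  pose proof (Cmod_ge_0 (w - z)). nra.
Qed.

Lemma cderiv_id (z : C) : cderiv (fun w => w) z 1.
Proof.
  intros eps He. exists 1. split; [lra|]. intros w _.
  replace (w - z - 1 * (w - z))%C with (RtoC 0) by ring. rewrite Cmod_0.
  pose proof (Cmod_ge_0 (w - z)). nra.
Qed.

Lemma cderiv_plus (f g : C -> C) (z l m : C) :
  cderiv f z l -> cderiv g z m -> cderiv (fun w => (f w + g w)%C) z (l + m).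
Proof.
  intros Hf Hg eps He.
  destruct (Hf (eps / 2)) as [d1 [Hd1 H1]]; [lra|].
  destruct (Hg (eps / 2)) as [d2 [Hd2 H2]]; [lra|].
  exists (Rmin d1 d2). split; [apply Rmin_glb_lt; auto|]. intros w Hw.
  rmins.
  specialize (H1 w ltac:(lra)). specialize (H2 w ltac:(lra)).
  replace (f w + g w - (f z + g z) - (l + m) * (w - z))%C
    with ((f w - f z - l * (w - z)) + (g w - g z - m * (w - z)))%C by ring.
  eapply Rle_trans; [apply Cmod_triangle|]. lra.
Qed.

Lemma cderiv_mult (f g : C -> C) (z l m : C) :
  cderiv f z l -> cderiv g z m -> cderiv (fun w => (f w * g w)%C) z (l * g z + f z * m).
Proof.
  intros Hf Hg eps He.
  pose proof (Cmod_ge_0 (g z)). pose proof (Cmod_ge_0 (f z)). pose proof (Cmod_ge_0 m).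
  (* [B] collects the factors of [e * h] in the four error terms below; the 1 bounds the increment
     of [f] in the third. *)
  set (B := 1 + Cmod (g z) + Cmod (f z) + Cmod m).
  assert (HB : 1 <= B) by (unfold B; lra).
  set (e := Rmin 1 (eps / (4 * B))).
  assert (He0 : 0 < e) by (apply Rmin_glb_lt; [lra|apply Rdiv_lt_0_compat; lra]).
  assert (He1 : e <= 1) by apply Rmin_l.
  assert (He2 : e * (4 * B) <= eps).
  { replace eps with (eps / (4 * B) * (4 * B)) by (field; lra).
    apply Rmult_le_compat_r; [lra|apply Rmin_r]. }
  destruct (cderiv_ccont _ _ _ Hf e He0) as [d4 [Hd4 HH4]].
  destruct (Hf e He0) as [d1 [Hd1 HH1]].
  destruct (Hg e He0) as [d2 [Hd2 HH2]].
  exists (Rmin (Rmin d1 d2) d4). split; [repeat apply Rmin_glb_lt; auto|]. intros w Hw.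
  rmins.
  specialize (HH1 w ltac:(lra)). specialize (HH2 w ltac:(lra)).
  specialize (HH4 w ltac:(lra)).
  replace (f w * g w - f z * g z - (l * g z + f z * m) * (w - z))%C
    with ((f w - f z - l * (w - z)) * g z + f z * (g w - g z - m * (w - z))
          + (f w - f z) * (g w - g z - m * (w - z)) + (f w - f z) * (m * (w - z)))%C by ring.
  set (h := Cmod (w - z)) in *. assert (Hh : 0 <= h) by apply Cmod_ge_0.
  eapply Rle_trans; [apply Cmod_triangle|].
  eapply Rle_trans; [apply Rplus_le_compat_r, Cmod_triangle|].
  eapply Rle_trans; [apply Rplus_le_compat_r, Rplus_le_compat_r, Cmod_triangle|].
  rewrite !Cmod_mult. fold h.
  assert (0 <= e * h) by nra.
  assert (T4 : Cmod (f w - f z) * (Cmod m * h) <= e * (Cmod m * h)).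
  { apply Rmult_le_compat_r; [nra|lra]. }
  assert (T1 : Cmod (f w - f z - l * (w - z)) * Cmod (g z) <= e * h * Cmod (g z)).
  { apply Rmult_le_compat_r; lra. }
  assert (T2 : Cmod (f z) * Cmod (g w - g z - m * (w - z)) <= Cmod (f z) * (e * h)).
  { apply Rmult_le_compat_l; lra. }
  assert (T3 : Cmod (f w - f z) * Cmod (g w - g z - m * (w - z)) <= 1 * (e * h)).
  { apply Rmult_le_compat; try lra; apply Cmod_ge_0. }
  assert (e * h * B * 4 <= eps * h) by nra. unfold B in *. nra.
Qed.

Lemma cderiv_inv (z : C) : z <> 0%C -> cderiv Cinv z (- / (z * z)).
Proof.
  intros Hz eps He. apply Cmod_gt_0 in Hz as Hm.
  set (m := Cmod z) in *.
  (* The error is exactly [h^2 / (w z^2)]. The first bound gives [|w| > m / 2], and the second then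
     makes [h / (|w| m^2)] at most [eps]. *)
  exists (Rmin (m / 2) (eps * m ^ 3 / 2)). split.
  { apply Rmin_glb_lt; [lra|]. assert (0 < m ^ 3) by (apply pow_lt; auto). nra. }
  intros w Hw. rmins.
  assert (Hw2 : m / 2 < Cmod w).
  { pose proof (Cmod_triangle_minus z w). rewrite Cmod_minus_sym in Hw. fold m in H1. lra. }
  assert (Hw0 : w <> 0%C) by (apply Cmod_gt_0; lra).
  replace (/ w - / z - - / (z * z) * (w - z))%C with ((w - z) * (w - z) * / (w * (z * z)))%C
    by (field; auto).
  rewrite !Cmod_mult, Cmod_inv, !Cmod_mult by (repeat apply Cmult_neq_0; auto). fold m.
  set (h := Cmod (w - z)) in *. assert (0 <= h) by apply Cmod_ge_0.
  replace (h * h * / (Cmod w * (m * m))) with ((h / (Cmod w * (m * m))) * h) by (field; split; lra).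
  apply Rmult_le_compat_r; auto.
  apply Rle_div_l; [apply Rmult_lt_0_compat; nra|].
  assert (eps * (m / 2 * (m * m)) <= eps * (Cmod w * (m * m))).
  { apply Rmult_le_compat_l; [lra|]. apply Rmult_le_compat_r; nra. }
  nra.
Qed.

Lemma cderiv_comp (f g : C -> C) (z l m : C) :
  cderiv g (f z) m -> cderiv f z l -> cderiv (fun w => g (f w)) z (m * l).
Proof.
  intros Hg Hf eps He.
  pose proof (Cmod_ge_0 m) as Hm. pose proof (Cmod_ge_0 l) as Hl.
  set (B := 2 + Cmod l + Cmod m).
  set (e := Rmin 1 (eps / B)).
  assert (He0 : 0 < e) by (apply Rmin_glb_lt; [lra|apply Rdiv_lt_0_compat; unfold B; lra]).
  assert (He1 : e <= 1) by apply Rmin_l.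
  assert (He2 : e * B <= eps).
  { replace eps with (eps / B * B) by (field; unfold B; lra).
    apply Rmult_le_compat_r; [unfold B; lra|apply Rmin_r]. }
  destruct (Hg e He0) as [d1 [Hd1 H1]].
  destruct (Hf e He0) as [d2 [Hd2 H2]].
  destruct (cderiv_ccont _ _ _ Hf d1 Hd1) as [d3 [Hd3 H3]].
  exists (Rmin d2 d3). split; [apply Rmin_glb_lt; auto|]. intros w Hw.
  rmins.
  specialize (H2 w ltac:(lra)). specialize (H3 w ltac:(lra)).
  specialize (H1 (f w) H3).
  replace (g (f w) - g (f z) - m * l * (w - z))%C
    with ((g (f w) - g (f z) - m * (f w - f z)) + m * (f w - f z - l * (w - z)))%C by ring.
  set (h := Cmod (w - z)) in *. assert (Hh : 0 <= h) by apply Cmod_ge_0.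
  assert (Hfw : Cmod (f w - f z) <= (1 + Cmod l) * h).
  { replace (f w - f z)%C with ((f w - f z - l * (w - z)) + l * (w - z))%C by ring.
    eapply Rle_trans; [apply Cmod_triangle|]. rewrite Cmod_mult. fold h. nra. }
  eapply Rle_trans; [apply Cmod_triangle|]. rewrite Cmod_mult.
  assert (Cmod m * Cmod (f w - f z - l * (w - z)) <= Cmod m * (e * h))
    by (apply Rmult_le_compat_l; lra).
  assert (e * Cmod (f w - f z) <= e * ((1 + Cmod l) * h)) by (apply Rmult_le_compat_l; lra).
  assert (0 <= e * h) by nra.
  assert (e * B * h <= eps * h) by (apply Rmult_le_compat_r; lra).
  unfold B in *. nra.
Qed.

Lemma cdiff_const (c z : C) : cdiff (fun _ => c) z.
Proof. eexists; apply cderiv_const. Qed.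

Lemma cdiff_id (z : C) : cdiff (fun w => w) z.
Proof. eexists; apply cderiv_id. Qed.

Lemma cdiff_plus (f g : C -> C) (z : C) :
  cdiff f z -> cdiff g z -> cdiff (fun w => (f w + g w)%C) z.
Proof. intros [l Hl] [m Hm]. eexists; apply cderiv_plus; eauto. Qed.

Lemma cdiff_mult (f g : C -> C) (z : C) :
  cdiff f z -> cdiff g z -> cdiff (fun w => (f w * g w)%C) z.
Proof. intros [l Hl] [m Hm]. eexists; apply cderiv_mult; eauto. Qed.

Lemma cdiff_comp (f g : C -> C) (z : C) :
  cdiff g (f z) -> cdiff f z -> cdiff (fun w => g (f w)) z.
Proof. intros [l Hl] [m Hm]. eexists; apply (cderiv_comp f g); eauto. Qed.

Lemma cdiff_opp (f : C -> C) (z : C) : cdiff f z -> cdiff (fun w => (- f w)%C) z.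
Proof.
  intros [l Hl]. exists ((0 * f z) + (- (1)) * l)%C.
  pose proof (cderiv_mult _ _ _ _ _ (cderiv_const (- (1))%C z) Hl) as H.
  intros eps He. destruct (H eps He) as [d [Hd H1]]. exists d; split; auto.
  intros w Hw. specialize (H1 w Hw). eapply Rle_trans; [|exact H1].
  right. f_equal. ring.
Qed.

Lemma cdiff_minus (f g : C -> C) (z : C) :
  cdiff f z -> cdiff g z -> cdiff (fun w => (f w - g w)%C) z.
Proof. intros Hf Hg. apply (cdiff_plus f (fun w => (- g w)%C)); auto. apply cdiff_opp; auto. Qed.

Lemma cdiff_shift (z w : C) : cdiff (fun w => (w - z)%C) w.
Proof. apply cdiff_minus; [apply cdiff_id|apply cdiff_const]. Qed.

Lemma cdiff_inv (f : C -> C) (z : C) : cdiff f z -> f z <> 0%C -> cdiff (fun w => (/ f w)%C) z.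
Proof. intros Hf H0. apply (cdiff_comp f Cinv); auto. eexists; apply cderiv_inv; auto. Qed.

Lemma cdiff_div (f g : C -> C) (z : C) :
  cdiff f z -> cdiff g z -> g z <> 0%C -> cdiff (fun w => (f w / g w)%C) z.
Proof. intros Hf Hg H0. apply (cdiff_mult f (fun w => (/ g w)%C)); auto. apply cdiff_inv; auto. Qed.

Lemma cdiff_kernel (z w : C) : Cmod w <> Cmod z -> cdiff (fun w => (w / (w - z))%C) w.
Proof.
  intros H. apply cdiff_div; [apply cdiff_id|apply cdiff_shift|].
  intros E. apply H. replace w with ((w - z) + z)%C by ring. rewrite E. f_equal. ring.
Qed.

Lemma cdiff_ext_loc (f g : C -> C) (z : C) (d : R) :
  0 < d -> (forall w, Cmod (w - z) < d -> f w = g w) -> cdiff f z -> cdiff g z.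
Proof.
  intros Hd E [l Hl]. exists l. intros eps He. destruct (Hl eps He) as [d1 [Hd1 H]].
  exists (Rmin d d1). split; [apply Rmin_glb_lt; auto|]. intros w Hw.
  rmins.
  rewrite <- !E.
  - apply H; lra.
  - replace (z - z)%C with (RtoC 0) by ring. rewrite Cmod_0; lra.
  - lra.
Qed.

(** * Goursat's theorem *)

Lemma continuous_eps (f : R -> R) (x : R) :
  continuous f x <-> forall eps, 0 < eps -> exists d, 0 < d /\
    forall y, Rabs (y - x) < d -> Rabs (f y - f x) < eps.
Proof.
  split.
  - intros H eps He. apply filterlim_locally with (eps := mkposreal eps He) in H.
    destruct H as [d Hd]. exists d. split; [apply cond_pos|]. intros y Hy. apply (Hd y Hy).
  - intros H. apply filterlim_locally. intros eps.
    destruct (H eps (cond_pos eps)) as [d [Hd H1]]. exists (mkposreal d Hd).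
    intros y Hy. apply (H1 y Hy).
Qed.

Lemma cont_plus (f g : R -> R) x : continuous f x -> continuous g x -> continuous (fun y => f y + g y) x.
Proof. exact (continuous_plus (V := R_NormedModule) f g x). Qed.

Lemma cont_minus (f g : R -> R) x : continuous f x -> continuous g x -> continuous (fun y => f y - g y) x.
Proof. exact (continuous_minus (V := R_NormedModule) f g x). Qed.

Lemma cont_mult (f g : R -> R) x : continuous f x -> continuous g x -> continuous (fun y => f y * g y) x.
Proof. exact (continuous_mult (K := R_AbsRing) f g x). Qed.

(** * Complex-valued functions of a real variable and contour integrals around rectangles *)

Definition contC (g : R -> C) (t : R) : Prop :=
  forall eps, 0 < eps -> exists d, 0 < d /\
    forall s, Rabs (s - t) < d -> Cmod (g s - g t) < eps.

Lemma contC_fst (g : R -> C) t : contC g t -> continuous (fun s => fst (g s)) t.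
Proof.
  intros H. apply continuous_eps. intros eps He. destruct (H eps He) as [d [Hd H1]].
  exists d; split; auto. intros y Hy. eapply Rle_lt_trans; [|apply (H1 y Hy)].
  apply (re_le_Cmod (g y - g t)).
Qed.

Lemma contC_snd (g : R -> C) t : contC g t -> continuous (fun s => snd (g s)) t.
Proof.
  intros H. apply continuous_eps. intros eps He. destruct (H eps He) as [d [Hd H1]].
  exists d; split; auto. intros y Hy. eapply Rle_lt_trans; [|apply (H1 y Hy)].
  apply (im_le_Cmod (g y - g t)).
Qed.

Lemma contC_pair (u v : R -> R) t :
  continuous u t -> continuous v t -> contC (fun s => (u s, v s)) t.
Proof.
  intros Hu Hv eps He.
  destruct (proj1 (continuous_eps u t) Hu (eps / 2)) as [d1 [Hd1 H1]]; [lra|].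
  destruct (proj1 (continuous_eps v t) Hv (eps / 2)) as [d2 [Hd2 H2]]; [lra|].
  exists (Rmin d1 d2). split; [apply Rmin_glb_lt; auto|]. intros s Hs.
  rmins.
  specialize (H1 s ltac:(lra)). specialize (H2 s ltac:(lra)).
  eapply Rle_lt_trans; [apply Cmod_le_abs|]. simpl. unfold Rminus in *. lra.
Qed.

Lemma contC_comp (f : C -> C) (g : R -> C) t : ccont f (g t) -> contC g t -> contC (fun s => f (g s)) t.
Proof.
  intros Hf Hg eps He. destruct (Hf eps He) as [d [Hd H1]]. destruct (Hg d Hd) as [d2 [Hd2 H2]].
  exists d2; split; auto.
Qed.

Lemma contC_mult (f g : R -> C) t : contC f t -> contC g t -> contC (fun s => (f s * g s)%C) t.
Proof.
  intros Hf Hg.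
  apply contC_pair; simpl.
  - apply cont_minus; apply cont_mult; auto using contC_fst, contC_snd.
  - apply cont_plus; apply cont_mult; auto using contC_fst, contC_snd.
Qed.

Lemma contC_minus (f g : R -> C) t : contC f t -> contC g t -> contC (fun s => (f s - g s)%C) t.
Proof.
  intros Hf Hg.
  apply contC_pair; simpl; apply cont_minus; auto using contC_fst, contC_snd.
Qed.

Lemma contC_const (c : C) t : contC (fun _ => c) t.
Proof.
  intros eps He. exists 1; split; [lra|]. intros. replace (c - c)%C with (RtoC 0) by ring.
  rewrite Cmod_0; auto.
Qed.

Definition cint (g : R -> C) (a b : R) : C :=
  (RInt (fun t => fst (g t)) a b, RInt (fun t => snd (g t)) a b).

Definition icont (g : R -> C) (a b : R) : Prop := forall t, a <= t <= b -> contC g t.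

Lemma ex_RInt_cont (f : R -> R) (a b : R) :
  a <= b -> (forall t, a <= t <= b -> continuous f t) -> ex_RInt f a b.
Proof.
  intros Hab H. apply (ex_RInt_continuous (V := R_CompleteNormedModule)).
  intros t. rewrite Rmin_left, Rmax_right by auto. apply H.
Qed.

Lemma icont_fst g a b : a <= b -> icont g a b -> ex_RInt (fun t => fst (g t)) a b.
Proof. intros. apply ex_RInt_cont; auto. intros; apply contC_fst; auto. Qed.

Lemma icont_snd g a b : a <= b -> icont g a b -> ex_RInt (fun t => snd (g t)) a b.
Proof. intros. apply ex_RInt_cont; auto. intros; apply contC_snd; auto. Qed.

Lemma cint_plus f g a b : a <= b -> icont f a b -> icont g a b ->
  cint (fun t => (f t + g t)%C) a b = (cint f a b + cint g a b)%C.
Proof.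
  intros Hab Hf Hg. unfold cint. apply injective_projections; simpl.
  - apply (RInt_plus (V := R_CompleteNormedModule)); apply icont_fst; auto.
  - apply (RInt_plus (V := R_CompleteNormedModule)); apply icont_snd; auto.
Qed.

Lemma cint_scal c g a b : a <= b -> icont g a b ->
  cint (fun t => (c * g t)%C) a b = (c * cint g a b)%C.
Proof.
  intros Hab Hg. unfold cint.
  assert (H1 := icont_fst _ _ _ Hab Hg). assert (H2 := icont_snd _ _ _ Hab Hg).
  apply injective_projections; simpl.
  - rewrite <- !(RInt_scal (V := R_CompleteNormedModule)) by auto.
    rewrite <- (RInt_minus (V := R_CompleteNormedModule)); auto;
      apply (ex_RInt_scal (V := R_NormedModule)); auto.
  - rewrite <- !(RInt_scal (V := R_CompleteNormedModule)) by auto.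
    rewrite <- (RInt_plus (V := R_CompleteNormedModule)); auto;
      apply (ex_RInt_scal (V := R_NormedModule)); auto.
Qed.

Lemma cint_ext f g a b : a <= b -> (forall t, a <= t <= b -> f t = g t) -> cint f a b = cint g a b.
Proof.
  intros Hab E. unfold cint. f_equal; apply RInt_ext; intros t;
  rewrite Rmin_left, Rmax_right by auto; intros; rewrite E; auto; lra.
Qed.

Lemma cint_minus f g a b : a <= b -> icont f a b -> icont g a b ->
  cint (fun t => (f t - g t)%C) a b = (cint f a b - cint g a b)%C.
Proof.
  intros Hab Hf Hg.
  rewrite (cint_ext _ (fun t => (f t + (- (1)) * g t)%C)) by (auto; intros; ring).
  rewrite cint_plus, cint_scal; auto; try ring.
  intros t Ht. apply contC_mult; auto. apply contC_const.
Qed.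

Lemma cint_Chasles g a m b : a <= m <= b -> icont g a b ->
  cint g a b = (cint g a m + cint g m b)%C.
Proof.
  intros [H1 H2] H. unfold cint.
  assert (icont g a m) by (intros t Ht; apply H; lra).
  assert (icont g m b) by (intros t Ht; apply H; lra).
  apply injective_projections; simpl; symmetry;
  apply (RInt_Chasles (V := R_CompleteNormedModule)); auto using icont_fst, icont_snd.
Qed.

Lemma cint_const c a b : cint (fun _ => c) a b = (RtoC (b - a) * c)%C.
Proof.
  unfold cint. rewrite !(RInt_const (V := R_CompleteNormedModule)).
  apply injective_projections; simpl; unfold scal; simpl; unfold mult; simpl; ring.
Qed.

Lemma RInt_abs_bound (f : R -> R) (a b M : R) : a <= b ->
  (forall t, a <= t <= b -> continuous f t) -> (forall t, a <= t <= b -> Rabs (f t) <= M) ->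
  Rabs (RInt f a b) <= (b - a) * M.
Proof.
  intros Hab Hc HM.
  apply (norm_RInt_le_const (V := R_NormedModule) f a b (RInt f a b) M Hab HM).
  apply (RInt_correct (V := R_CompleteNormedModule)), ex_RInt_cont; auto.
Qed.

(** The factor 2 comes from bounding real and imaginary parts separately. It survives into
    [cauchy_bound] and is removed in [max_modulus]. *)
Lemma cint_bound g a b M : a <= b -> icont g a b ->
  (forall t, a <= t <= b -> Cmod (g t) <= M) -> Cmod (cint g a b) <= 2 * (b - a) * M.
Proof.
  intros Hab Hg HM. eapply Rle_trans; [apply Cmod_le_abs|]. unfold cint; simpl.
  assert (H1 := RInt_abs_bound (fun t => fst (g t)) a b M Hab
    (fun t Ht => contC_fst _ _ (Hg t Ht)) (fun t Ht => Rle_trans _ _ _ (re_le_Cmod _) (HM t Ht))).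
  assert (H2 := RInt_abs_bound (fun t => snd (g t)) a b M Hab
    (fun t Ht => contC_snd _ _ (Hg t Ht)) (fun t Ht => Rle_trans _ _ _ (im_le_Cmod _) (HM t Ht))).
  lra.
Qed.

(** Counterclockwise contour integral: [dw] is [dx] on horizontal sides and [i dy] on vertical
    ones. *)
Definition rectint (F : C -> C) (a b c d : R) : C :=
  (cint (fun x => F (x, c)) a b - cint (fun x => F (x, d)) a b
   + Ci * (cint (fun y => F (b, y)) c d - cint (fun y => F (a, y)) c d))%C.

Definition in_rect (a b c d : R) (z : C) : Prop := a <= fst z <= b /\ c <= snd z <= d.

Lemma contC_horiz c t : contC (fun x => (x, c)) t.
Proof. apply contC_pair; [apply continuous_id|apply continuous_const]. Qed.

Lemma contC_vert c t : contC (fun y => (c, y)) t.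
Proof. apply contC_pair; [apply continuous_const|apply continuous_id]. Qed.

Section Rect.
Context (F : C -> C) (a b c d : R) (Hab : a <= b) (Hcd : c <= d).
Context (HF : forall z, in_rect a b c d z -> ccont F z).

Lemma icont_h y : c <= y <= d -> forall a' b', a <= a' -> b' <= b -> icont (fun x => F (x, y)) a' b'.
Proof.
  intros Hy a' b' Ha Hb t Ht. apply (contC_comp F); [|apply contC_horiz].
  apply HF. split; simpl; lra.
Qed.

Lemma icont_v x : a <= x <= b -> forall c' d', c <= c' -> d' <= d -> icont (fun y => F (x, y)) c' d'.
Proof.
  intros Hx c' d' Hc Hd t Ht. apply (contC_comp F); [|apply contC_vert].
  apply HF. split; simpl; lra.
Qed.

Lemma rectint_split m n : a <= m <= b -> c <= n <= d ->
  rectint F a b c d = (rectint F a m c n + rectint F m b c n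
                       + (rectint F a m n d + rectint F m b n d))%C.
Proof.
  intros Hm Hn. unfold rectint.
  rewrite (cint_Chasles (fun x => F (x, c)) a m b), (cint_Chasles (fun x => F (x, d)) a m b),
    (cint_Chasles (fun y => F (a, y)) c n d), (cint_Chasles (fun y => F (b, y)) c n d);
  try (apply icont_h; lra); try (apply icont_v; lra); try lra.
  ring.
Qed.

Lemma rectint_bound M : (forall z, in_rect a b c d z -> Cmod (F z) <= M) ->
  Cmod (rectint F a b c d) <= 4 * ((b - a) + (d - c)) * M.
Proof.
  intros HM. unfold rectint.
  assert (H1 : Cmod (cint (fun x => F (x, c)) a b) <= 2 * (b - a) * M).
  { apply cint_bound; auto. apply icont_h; lra. intros; apply HM; split; simpl; lra. }
  assert (H2 : Cmod (cint (fun x => F (x, d)) a b) <= 2 * (b - a) * M).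
  { apply cint_bound; auto. apply icont_h; lra. intros; apply HM; split; simpl; lra. }
  assert (H3 : Cmod (cint (fun y => F (b, y)) c d) <= 2 * (d - c) * M).
  { apply cint_bound; auto. apply icont_v; lra. intros; apply HM; split; simpl; lra. }
  assert (H4 : Cmod (cint (fun y => F (a, y)) c d) <= 2 * (d - c) * M).
  { apply cint_bound; auto. apply icont_v; lra. intros; apply HM; split; simpl; lra. }
  eapply Rle_trans; [apply Cmod_triangle|]. rewrite Cmod_mult, Cmod_Ci.
  assert (T1 : forall z w, Cmod (z - w) <= Cmod z + Cmod w).
  { intros. unfold Cminus. rewrite <- (Cmod_opp w). apply Cmod_triangle. }
  pose proof (T1 (cint (fun x => F (x, c)) a b) (cint (fun x => F (x, d)) a b)).
  pose proof (T1 (cint (fun y => F (b, y)) c d) (cint (fun y => F (a, y)) c d)).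
  lra.
Qed.
End Rect.

Lemma RInt_id a b : RInt (fun x => x) a b = (b ^ 2 - a ^ 2) / 2.
Proof.
  apply is_RInt_unique.
  replace ((b ^ 2 - a ^ 2) / 2) with (minus ((fun x => x ^ 2 / 2) b) ((fun x => x ^ 2 / 2) a))
    by (unfold minus, plus, opp; simpl; field).
  apply (is_RInt_derive (V := R_CompleteNormedModule) (fun x => x ^ 2 / 2) (fun x => x)).
  - intros x _. auto_derive; auto. field.
  - intros x _. apply continuous_id.
Qed.

Lemma rectint_affine (p q : C) a b c d : a <= b -> c <= d ->
  rectint (fun w => (p + q * w)%C) a b c d = 0%C.
Proof.
  intros Hab Hcd. unfold rectint.
  rewrite !cint_plus, !cint_scal, !cint_const; auto;
    try (intros t Ht; repeat first [apply contC_mult | apply contC_const | apply contC_horiz | apply contC_vert]).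
  unfold cint; simpl. rewrite !RInt_id, !(RInt_const (V := R_CompleteNormedModule)).
  unfold scal; simpl; unfold mult; simpl.
  apply injective_projections; simpl; field.
Qed.

Lemma rectint_minus (F G : C -> C) a b c d : a <= b -> c <= d ->
  (forall z, in_rect a b c d z -> ccont F z) -> (forall z, in_rect a b c d z -> ccont G z) ->
  rectint (fun w => (F w - G w)%C) a b c d = (rectint F a b c d - rectint G a b c d)%C.
Proof.
  intros Hab Hcd HF HG. unfold rectint. rewrite !cint_minus; auto;
    try (apply (icont_h F a b c d); auto; lra); try (apply (icont_v F a b c d); auto; lra);
    try (apply (icont_h G a b c d); auto; lra); try (apply (icont_v G a b c d); auto; lra).
  ring.
Qed.

Definition quad : Type := ((R * R) * (R * R))%type.

(** The threshold is quadratic in the half-perimeter, so halving the sides divides it by 4, which is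
    also the number of quarters: one of them inherits badness. *)
Definition bad_rect (F : C -> C) (eps : R) (q : quad) : Prop :=
  let '((a, b), (c, d)) := q in
  a <= b /\ c <= d /\ (forall z, in_rect a b c d z -> cdiff F z) /\
  eps * ((b - a) + (d - c)) ^ 2 < Cmod (rectint F a b c d).

Definition quarter (q q' : quad) : Prop :=
  let '((a, b), (c, d)) := q in let '((a', b'), (c', d')) := q' in
  a <= a' /\ b' <= b /\ c <= c' /\ d' <= d /\ b' - a' = (b - a) / 2 /\ d' - c' = (d - c) / 2.

Lemma bad_rect_split F eps q : bad_rect F eps q -> exists q', bad_rect F eps q' /\ quarter q q'.
Proof.
  destruct q as [[a b] [c d]]. intros (Hab & Hcd & HF & HI).
  set (m := (a + b) / 2). set (n := (c + d) / 2).
  assert (Hm : 2 * m = a + b) by (unfold m; field). assert (Hn : 2 * n = c + d) by (unfold n; field).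
  rewrite (rectint_split F a b c d Hab Hcd (fun z Hz => cdiff_ccont F z (HF z Hz)) m n) in HI by lra.
  assert (K : forall a' b' c' d', a <= a' -> b' <= b -> c <= c' -> d' <= d ->
    b' - a' = (b - a) / 2 -> d' - c' = (d - c) / 2 ->
    ~ (exists q', bad_rect F eps q' /\ quarter ((a, b), (c, d)) q') ->
    Cmod (rectint F a' b' c' d') <= eps * ((b - a) + (d - c)) ^ 2 / 4).
  { intros a' b' c' d' H1 H2 H3 H4 H5 H6 N. apply Rnot_lt_le. intros L. apply N.
    exists ((a', b'), (c', d')). split; [|simpl; auto 6].
    simpl. repeat split; try lra.
    - intros z [Z1 Z2]. apply HF. split; lra.
    - rewrite H5, H6. lra. }
  apply NNPP. intros N.
  pose proof (K a m c n ltac:(lra) ltac:(lra) ltac:(lra) ltac:(lra) ltac:(lra) ltac:(lra) N).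
  pose proof (K m b c n ltac:(lra) ltac:(lra) ltac:(lra) ltac:(lra) ltac:(lra) ltac:(lra) N).
  pose proof (K a m n d ltac:(lra) ltac:(lra) ltac:(lra) ltac:(lra) ltac:(lra) ltac:(lra) N).
  pose proof (K m b n d ltac:(lra) ltac:(lra) ltac:(lra) ltac:(lra) ltac:(lra) ltac:(lra) N).
  pose proof (Cmod_triangle (rectint F a m c n + rectint F m b c n) (rectint F a m n d + rectint F m b n d)).
  pose proof (Cmod_triangle (rectint F a m c n) (rectint F m b c n)).
  pose proof (Cmod_triangle (rectint F a m n d) (rectint F m b n d)). lra.
Qed.

Lemma nested_point (l r : nat -> R) : (forall n, l n <= l (S n)) -> (forall n, r (S n) <= r n) ->
  (forall n, l n <= r n) -> exists x, forall n, l n <= x <= r n.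
Proof.
  intros Hl Hr Hlr.
  assert (Mx : forall n k, l n <= r k).
  { intros n k. apply Rle_trans with (l (Nat.max n k)); [apply tech9; auto; lia|].
    eapply Rle_trans; [apply Hlr|]. apply decreasing_prop; auto; lia. }
  destruct (completeness (fun x => exists n, x = l n)) as [x [Hx1 Hx2]].
  - exists (r O). intros y [n ->]. apply Mx.
  - exists (l O); exists O; reflexivity.
  - exists x. intros n. split; [apply Hx1; eauto|]. apply Hx2. intros y [k ->]. apply Mx.
Qed.

Theorem goursat (F : C -> C) a b c d : a <= b -> c <= d ->
  (forall z, in_rect a b c d z -> cdiff F z) -> rectint F a b c d = 0%C.
Proof.
  intros Hab Hcd HF. apply NNPP. intros HI. apply Cmod_gt_0 in HI.
  set (S0 := (b - a) + (d - c)). assert (HS : 0 <= S0) by (unfold S0; lra).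
  (* The [+ 1] allows a degenerate rectangle and makes the initial inequality strict. *)
  set (eps := Cmod (rectint F a b c d) / (S0 ^ 2 + 1)).
  assert (Heps : 0 < eps) by (apply Rdiv_lt_0_compat; nra).
  assert (Bad0 : bad_rect F eps ((a, b), (c, d))).
  { repeat split; auto. fold S0.
    assert (E : Cmod (rectint F a b c d) = eps * (S0 ^ 2 + 1)) by (unfold eps; field; nra). lra. }
  (* Dependent choice: each iterate carries the proof of its badness, which is what the choice of
     the next one consumes. *)
  set (next := fun q : {q | bad_rect F eps q} =>
    constructive_indefinite_description _ (bad_rect_split F eps _ (proj2_sig q))).
  set (q := fix q n := match n with
    | O => exist _ _ Bad0
    | S n => exist _ _ (proj1 (proj2_sig (next (q n)))) end).
  set (qa := fun n => fst (fst (proj1_sig (q n)))). set (qb := fun n => snd (fst (proj1_sig (q n)))).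
  set (qc := fun n => fst (snd (proj1_sig (q n)))). set (qd := fun n => snd (snd (proj1_sig (q n)))).
  assert (Bad : forall n, bad_rect F eps ((qa n, qb n), (qc n, qd n))).
  { intros n. unfold qa, qb, qc, qd. rewrite <- !surjective_pairing. exact (proj2_sig (q n)). }
  assert (Next : forall n, quarter ((qa n, qb n), (qc n, qd n)) ((qa (S n), qb (S n)), (qc (S n), qd (S n)))).
  { intros n. unfold qa, qb, qc, qd. rewrite <- !surjective_pairing. exact (proj2 (proj2_sig (next (q n)))). }
  destruct (nested_point qa qb) as [x Hx]; try (intros n; apply Next || apply Bad).
  destruct (nested_point qc qd) as [y Hy]; try (intros n; apply Next || apply Bad).
  destruct (HF (x, y)) as [l Hl]; [exact (conj (Hx O) (Hy O))|].
  (* With [eps / 8] the affine approximation bounds the integral by [4 * Sn * (eps / 8 * Sn)], half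
     of the threshold that a bad rectangle exceeds. *)
  destruct (Hl (eps / 8)) as [dl [Hdl H1]]; [lra|].
  assert (Size : forall n, (qb n - qa n) + (qd n - qc n) = S0 / 2 ^ n).
  { induction n as [|n IH]; [unfold qa, qb, qc, qd, S0; simpl; field|].
    destruct (Next n) as (_ & _ & _ & _ & E1 & E2). rewrite E1, E2.
    assert (P2 : 0 < 2 ^ n) by (apply pow_lt; lra).
    replace (S0 / 2 ^ S n) with (S0 / 2 ^ n / 2) by (simpl; field; lra). lra. }
  assert (exists n, S0 / 2 ^ n < dl) as [n Hn].
  { destruct (Pow_x_infinity 2 ltac:(rewrite Rabs_right; lra) ((S0 + 1) / dl)) as [n Hn].
    exists n. specialize (Hn n (Nat.le_refl n)).
    assert (0 < 2 ^ n) by (apply pow_lt; lra). rewrite Rabs_right in Hn by lra.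
    apply Rlt_div_l; auto. apply Rge_le, Rle_div_l in Hn; auto. lra. }
  rewrite <- Size in Hn. destruct (Bad n) as (Hab' & Hcd' & HF' & HI').
  set (Sn := (qb n - qa n) + (qd n - qc n)) in *.
  set (aff := fun w : C => ((F (x, y) - l * (x, y)) + l * w)%C).
  assert (Ha : forall z, cdiff aff z).
  { intros z. apply cdiff_plus; [apply cdiff_const|].
    apply cdiff_mult; [apply cdiff_const|apply cdiff_id]. }
  assert (B : Cmod (rectint (fun w => (F w - aff w)%C) (qa n) (qb n) (qc n) (qd n)) <= 4 * Sn * (eps / 8 * Sn)).
  { apply rectint_bound; auto.
    - intros z Hz. apply cdiff_ccont, cdiff_minus; auto.
    - intros z [Z1 Z2]. unfold aff.
      assert (Hz : Cmod (z - (x, y)) <= Sn).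
      { eapply Rle_trans; [apply Cmod_le_abs|]. specialize (Hx n). specialize (Hy n).
        apply Rplus_le_compat; simpl; apply Rabs_le; lra. }
      replace (F z - (F (x, y) - l * (x, y) + l * z))%C with (F z - F (x, y) - l * (z - (x, y)))%C by ring.
      eapply Rle_trans; [apply H1; lra|]. apply Rmult_le_compat_l; lra. }
  rewrite rectint_minus in B; auto using cdiff_ccont.
  unfold aff in B. rewrite rectint_affine in B by auto.
  replace (rectint F (qa n) (qb n) (qc n) (qd n) - 0)%C with (rectint F (qa n) (qb n) (qc n) (qd n)) in B by ring.
  assert (0 <= eps * Sn ^ 2) by (apply Rmult_le_pos; [lra|apply pow2_ge_0]). lra.
Qed.

(** * Cauchy's formula and the maximum principle *)

Lemma exp_mono x y : x <= y -> exp x <= exp y.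
Proof. intros [H| ->]; [left; apply exp_increasing; auto|lra]. Qed.

Definition cexp (z : C) : C := (exp (fst z) * cos (snd z), exp (fst z) * sin (snd z)).

Lemma cexp_plus z w : cexp (z + w) = (cexp z * cexp w)%C.
Proof.
  unfold cexp. apply injective_projections; simpl; rewrite exp_plus.
  - rewrite cos_plus; ring.
  - rewrite sin_plus; ring.
Qed.

Lemma cexp_Cmod z : Cmod (cexp z) = exp (fst z).
Proof.
  unfold Cmod, cexp; simpl fst; simpl snd.
  replace ((exp (fst z) * cos (snd z)) ^ 2 + (exp (fst z) * sin (snd z)) ^ 2)
    with (exp (fst z) ^ 2 * ((sin (snd z))² + (cos (snd z))²)) by (unfold Rsqr; ring).
  rewrite sin2_cos2, Rmult_1_r. apply sqrt_pow2. left; apply exp_pos.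
Qed.

Lemma derive_eps (f : R -> R) (x l : R) : is_derive f x l ->
  forall eps, 0 < eps -> exists d, 0 < d /\
    forall h, Rabs h < d -> Rabs (f (x + h) - f x - l * h) <= eps * Rabs h.
Proof.
  intros H eps He. apply is_derive_Reals in H. destruct (H eps He) as [d Hd].
  exists d. split; [apply cond_pos|]. intros h Hh.
  destruct (Req_dec h 0) as [->|H0].
  - rewrite Rplus_0_r, Rabs_R0. replace (f x - f x - l * 0) with 0 by ring. rewrite Rabs_R0; lra.
  - specialize (Hd h H0 Hh). replace (f (x + h) - f x - l * h) with (((f (x + h) - f x) / h - l) * h) by (field; auto).
    rewrite Rabs_mult. apply Rmult_le_compat_r; [apply Rabs_pos|lra].
Qed.

Lemma cderiv_cexp0 : cderiv cexp 0 1.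
Proof.
  intros eps He.
  set (e := Rmin 1 (eps / 8)).
  assert (He0 : 0 < e) by (apply Rmin_glb_lt; lra).
  assert (He1 : e <= 1) by apply Rmin_l. assert (He2 : e <= eps / 8) by apply Rmin_r.
  destruct (derive_eps exp 0 1 ltac:(auto_derive; auto; rewrite exp_0; ring) e He0) as [d1 [Hd1 H1]].
  destruct (derive_eps sin 0 1 ltac:(auto_derive; auto; rewrite cos_0; ring) e He0) as [d2 [Hd2 H2]].
  destruct (derive_eps cos 0 0 ltac:(auto_derive; auto; rewrite sin_0; ring) e He0) as [d3 [Hd3 H3]].
  exists (Rmin (Rmin d1 d2) (Rmin d3 (e / 2))). split; [repeat apply Rmin_glb_lt; auto; lra|].
  intros w Hw. replace (w - 0)%C with w in * by ring.
  rmins.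
  pose proof (re_le_Cmod w). pose proof (im_le_Cmod w).
  destruct w as [x y]. simpl in *.
  specialize (H1 x ltac:(lra)). specialize (H2 y ltac:(lra)). specialize (H3 y ltac:(lra)).
  rewrite Rplus_0_l, exp_0 in H1. rewrite Rplus_0_l, sin_0 in H2. rewrite Rplus_0_l, cos_0 in H3.
  set (h := Cmod (x, y)) in *.
  assert (Ex : Rabs (exp x - 1) <= e).
  { replace (exp x - 1) with ((exp x - 1 - 1 * x) + x) by ring.
    eapply Rle_trans; [apply Rabs_triang|].
    assert (e * Rabs x <= 1 * Rabs x) by (apply Rmult_le_compat_r; auto using Rabs_pos). lra. }
  assert (Hey : e * Rabs y <= e * h) by (apply Rmult_le_compat_l; lra).
  assert (Hex : e * Rabs x <= e * h) by (apply Rmult_le_compat_l; lra).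
  assert (Cy : Rabs (cos y - 1) <= e * h) by (replace (cos y - 1) with (cos y - 1 - 0 * y) by ring; lra).
  assert (Sy : Rabs (sin y - y) <= e * h) by (replace (sin y - y) with (sin y - 0 - 1 * y) by ring; lra).
  assert (Hexp : Rabs (exp x) <= 2).
  { replace (exp x) with ((exp x - 1) + 1) by ring. eapply Rle_trans; [apply Rabs_triang|].
    rewrite Rabs_R1; lra. }
  assert (Hh : 0 <= e * h) by (apply Rmult_le_pos; [lra|apply Cmod_ge_0]).
  assert (G : e * h * 8 <= eps * h).
  { replace (e * h * 8) with (e * 8 * h) by ring. apply Rmult_le_compat_r; [apply Cmod_ge_0|lra]. }
  eapply Rle_trans; [apply Cmod_le_abs|]. unfold cexp; simpl. rewrite exp_0, cos_0, sin_0.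
  assert (A1 : Rabs (exp x * cos y + - (1 * 1) + - (1 * x - 0 * y)) <= 3 * (e * h)).
  { replace (exp x * cos y + - (1 * 1) + - (1 * x - 0 * y)) with (exp x * (cos y - 1) + (exp x - 1 - 1 * x)) by ring.
    eapply Rle_trans; [apply Rabs_triang|]. rewrite Rabs_mult.
    assert (Rabs (exp x) * Rabs (cos y - 1) <= 2 * (e * h)) by (apply Rmult_le_compat; auto using Rabs_pos).
    lra. }
  assert (A2 : Rabs (exp x * sin y + - (1 * 0) + - (1 * y + 0 * x)) <= 3 * (e * h)).
  { replace (exp x * sin y + - (1 * 0) + - (1 * y + 0 * x)) with (exp x * (sin y - y) + (exp x - 1) * y) by ring.
    eapply Rle_trans; [apply Rabs_triang|]. rewrite !Rabs_mult.
    assert (Rabs (exp x) * Rabs (sin y - y) <= 2 * (e * h)) by (apply Rmult_le_compat; auto using Rabs_pos).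
    assert (Rabs (exp x - 1) * Rabs y <= e * h) by (apply Rmult_le_compat; auto using Rabs_pos).
    lra. }
  lra.
Qed.

(** Only the derivative at 0 is computed by hand; the functional equation carries it to every
    point. *)
Lemma cdiff_cexp (z : C) : cdiff cexp z.
Proof.
  assert (H : cdiff (fun w => (cexp z * cexp (w - z))%C) z).
  { apply cdiff_mult; [apply cdiff_const|]. apply (cdiff_comp (fun w => (w - z)%C) cexp).
    - replace (z - z)%C with (RtoC 0) by ring. eexists; apply cderiv_cexp0.
    - apply cdiff_shift. }
  apply (cdiff_ext_loc _ cexp z 1 ltac:(lra)) in H; auto.
  intros w _. rewrite <- cexp_plus. f_equal. ring.
Qed.

Lemma polar_Cmod r t : Cmod (polar r t) = Rabs r.
Proof.
  unfold Cmod, polar; simpl fst; simpl snd.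
  replace ((r * cos t) ^ 2 + (r * sin t) ^ 2) with (r² * ((sin t)² + (cos t)²)) by (unfold Rsqr; ring).
  rewrite sin2_cos2, Rmult_1_r. apply sqrt_Rsqr_abs.
Qed.

Lemma polar_Cmod_pos r t : 0 <= r -> Cmod (polar r t) = r.
Proof. intros. rewrite polar_Cmod. apply Rabs_right; lra. Qed.

Lemma polar_cexp r t : 0 < r -> polar r t = cexp (ln r, t).
Proof. intros. unfold polar, cexp; simpl. rewrite exp_ln by auto. auto. Qed.

Lemma polar_periodic r t : polar r (t + 2 * PI) = polar r t.
Proof. unfold polar.
  replace (t + 2 * PI) with (t + 2 * INR 1 * PI) by (simpl; ring).
  rewrite cos_period, sin_period. auto. Qed.

Lemma contC_polar r t : contC (fun s => polar r s) t.
Proof.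
  unfold polar. apply contC_pair; apply cont_mult; try apply continuous_const;
  apply continuity_pt_filterlim; [apply continuity_cos | apply continuity_sin].
Qed.

Lemma circle_icont (g : C -> C) r a b : 0 <= r -> (forall w, Cmod w = r -> ccont g w) ->
  icont (fun t => g (polar r t)) a b.
Proof.
  intros Hr H t _. apply (contC_comp g); [|apply contC_polar]. apply H. apply polar_Cmod_pos; auto.
Qed.

Lemma two_PI_pos : 0 < 2 * PI. Proof. pose proof PI_RGT_0; lra. Qed.

(** Integration is against [dt = dw / (i w)], with no factor 1 / (2 pi); this is why the Cauchy
    kernel appears below as [w / (w - z)]. *)
Definition circint (g : C -> C) (r : R) : C := cint (fun t => g (polar r t)) 0 (2 * PI).

(* In the coordinates (ln |w|, arg w) an annulus becomes a rectangle whose horizontal sides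
   cancel by periodicity. *)
Lemma circint_const (g : C -> C) r1 r2 : 0 < r1 <= r2 ->
  (forall w, r1 <= Cmod w <= r2 -> cdiff g w) -> circint g r1 = circint g r2.
Proof.
  intros Hr Hg.
  assert (L : ln r1 <= ln r2) by (destruct (Req_dec r1 r2) as [->|]; [lra|left; apply ln_increasing; lra]).
  pose proof two_PI_pos as HPI.
  pose proof (goursat (fun w => g (cexp w)) (ln r1) (ln r2) 0 (2 * PI) L ltac:(lra)) as G.
  assert (E : rectint (fun w => g (cexp w)) (ln r1) (ln r2) 0 (2 * PI) = (Ci * (circint g r2 - circint g r1))%C).
  { unfold rectint.
    rewrite (cint_ext (fun x => g (cexp (x, 0))) (fun x => g (cexp (x, 2 * PI)))); auto.
    2: { intros x _. f_equal. unfold cexp; simpl. rewrite cos_0, sin_0, cos_2PI, sin_2PI. auto. }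
    unfold circint.
    rewrite (cint_ext (fun t => g (polar r2 t)) (fun y => g (cexp (ln r2, y)))) by
      (try lra; intros; rewrite polar_cexp by lra; auto).
    rewrite (cint_ext (fun t => g (polar r1 t)) (fun y => g (cexp (ln r1, y)))) by
      (try lra; intros; rewrite polar_cexp by lra; auto).
    ring. }
  rewrite E in G.
  assert (D : (circint g r2 - circint g r1)%C = 0%C).
  { transitivity (- Ci * (Ci * (circint g r2 - circint g r1)))%C; [apply injective_projections; simpl; ring|].
    rewrite G; [ring|]. intros z [[Z1 Z2] _]. apply (cdiff_comp cexp g); [|apply cdiff_cexp].
    apply Hg. rewrite cexp_Cmod, <- (exp_ln r1), <- (exp_ln r2) by lra. split; apply exp_mono; auto. }
  replace (circint g r2) with ((circint g r2 - circint g r1) + circint g r1)%C by ring.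
  rewrite D. ring.
Qed.

Lemma RInt_param_unif (f : R -> R -> R) a b c d : c <= d ->
  (forall x y, a <= x <= b -> c <= y <= d -> continuity_2d_pt f x y) ->
  forall eps, 0 < eps -> exists del, 0 < del /\ forall x u, a <= x <= b -> a <= u <= b ->
    Rabs (u - x) < del -> Rabs (RInt (f u) c d - RInt (f x) c d) <= eps.
Proof.
  intros Hcd Hc eps He.
  assert (He' : 0 < eps / (d - c + 1)) by (apply Rdiv_lt_0_compat; lra).
  destruct (uniform_continuity_2d f a b c d Hc (mkposreal _ He')) as [del Hdel].
  exists del. split; [apply cond_pos|]. intros x u Hx Hu Hxu.
  assert (Hcx : forall x, a <= x <= b -> forall y, c <= y <= d -> continuous (f x) y).
  { intros x' Hx' y Hy. apply continuous_eps. intros e0 He0.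
    destruct (Hc x' y Hx' Hy (mkposreal e0 He0)) as [d0 Hd0].
    exists d0. split; [apply cond_pos|]. intros y' Hy'. apply Hd0; auto.
    rewrite Rminus_diag, Rabs_R0. apply cond_pos. }
  rewrite <- (RInt_minus (V := R_CompleteNormedModule) (f u) (f x)) by (apply ex_RInt_cont; auto).
  eapply Rle_trans.
  - apply (RInt_abs_bound _ c d (eps / (d - c + 1)) Hcd).
    + intros y Hy. apply cont_minus; auto.
    + intros y Hy. left. apply (Hdel x y u y); auto. rewrite Rminus_diag, Rabs_R0. apply cond_pos.
  - apply Rle_trans with ((d - c + 1) * (eps / (d - c + 1))); [|right; field; lra].
    apply Rmult_le_compat_r; lra.
Qed.

Lemma ccont_2d (g : C -> C) (p q : R -> R -> R) x y : ccont g (p x y, q x y) ->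
  continuity_2d_pt p x y -> continuity_2d_pt q x y ->
  continuity_2d_pt (fun u v => fst (g (p u v, q u v))) x y /\
  continuity_2d_pt (fun u v => snd (g (p u v, q u v))) x y.
Proof.
  intros Hg Hp Hq.
  assert (K : forall eps, 0 < eps -> exists d : posreal, forall u v, Rabs (u - x) < d -> Rabs (v - y) < d ->
     Cmod (g (p u v, q u v) - g (p x y, q x y)) < eps).
  { intros eps He. destruct (Hg eps He) as [d [Hd H]].
    assert (Hd2 : 0 < d / 2) by lra.
    destruct (Hp (mkposreal _ Hd2)) as [d1 H1]. destruct (Hq (mkposreal _ Hd2)) as [d2 H2].
    exists (mkposreal (Rmin d1 d2) (Rmin_glb_lt _ _ _ (cond_pos d1) (cond_pos d2))). simpl.
    intros u v Hu Hv. rmins.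
    specialize (H1 u v ltac:(lra) ltac:(lra)). specialize (H2 u v ltac:(lra) ltac:(lra)). simpl in *.
    apply H. eapply Rle_lt_trans; [apply Cmod_le_abs|]. simpl. unfold Rminus in *. lra. }
  split; intros eps; destruct (K eps (cond_pos eps)) as [d Hd]; exists d; intros u v Hu Hv;
    (eapply Rle_lt_trans; [|apply (Hd u v Hu Hv)]).
  - apply (re_le_Cmod (g (p u v, q u v) - g (p x y, q x y))).
  - apply (im_le_Cmod (g (p u v, q u v) - g (p x y, q x y))).
Qed.

Lemma polar_2d (g : C -> C) x y : ccont g (polar x y) ->
  continuity_2d_pt (fun u v => fst (g (polar u v))) x y /\
  continuity_2d_pt (fun u v => snd (g (polar u v))) x y.
Proof.
  intros Hg. apply (ccont_2d g (fun u v => u * cos v) (fun u v => u * sin v)); auto;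
  apply continuity_2d_pt_mult; try apply continuity_2d_pt_id1;
  [apply (continuity_1d_2d_pt_comp cos (fun _ v => v)) | apply (continuity_1d_2d_pt_comp sin (fun _ v => v))];
  try apply continuity_2d_pt_id2; [apply continuity_cos|apply continuity_sin].
Qed.

(** Continuity in the radius holds down to the centre and across circles where [g] is merely
    continuous; [cauchy_formula] uses both. *)
Lemma circint_unif (g : C -> C) R0 : (forall w, Cmod w <= R0 -> ccont g w) ->
  forall eps, 0 < eps -> exists del, 0 < del /\ forall x u, 0 <= x <= R0 -> 0 <= u <= R0 ->
    Rabs (u - x) < del -> Cmod (circint g u - circint g x) <= eps.
Proof.
  intros Hg eps He. pose proof two_PI_pos as HPI.
  assert (Hc : forall x y, 0 <= x <= R0 -> 0 <= y <= 2 * PI -> ccont g (polar x y)).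
  { intros. apply Hg. rewrite polar_Cmod_pos; lra. }
  destruct (RInt_param_unif (fun u v => fst (g (polar u v))) 0 R0 0 (2 * PI) ltac:(lra)
     (fun x y Hx Hy => proj1 (polar_2d g x y (Hc x y Hx Hy))) (eps / 2)) as [d1 [Hd1 H1]]; [lra|].
  destruct (RInt_param_unif (fun u v => snd (g (polar u v))) 0 R0 0 (2 * PI) ltac:(lra)
     (fun x y Hx Hy => proj2 (polar_2d g x y (Hc x y Hx Hy))) (eps / 2)) as [d2 [Hd2 H2]]; [lra|].
  exists (Rmin d1 d2). split; [apply Rmin_glb_lt; auto|]. intros x u Hx Hu Hxu.
  rmins.
  specialize (H1 x u Hx Hu ltac:(lra)). specialize (H2 x u Hx Hu ltac:(lra)).
  eapply Rle_trans; [apply Cmod_le_abs|]. unfold circint, cint. simpl. unfold Rminus in *. lra.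
Qed.

Lemma Cminus_neq0 (w z : C) : w <> z -> (w - z)%C <> 0%C.
Proof. intros H E. apply H. replace w with ((w - z) + z)%C by ring. rewrite E. ring. Qed.

Lemma Cmod_neq (w z : C) : Cmod w <> Cmod z -> (w - z)%C <> 0%C.
Proof. intros H. apply Cminus_neq0. congruence. Qed.

(** After 1 is split off, the remainder [z / (w - z)] has an integral independent of the radius, and
    it tends to 0 as the radius grows. *)
Lemma circint_kernel z r : Cmod z < r -> circint (fun w => (w / (w - z))%C) r = RtoC (2 * PI).
Proof.
  intros Hz. pose proof (Cmod_ge_0 z) as Hz0. pose proof two_PI_pos as HPI.
  assert (Hd : forall w, r <= Cmod w -> cdiff (fun w => (z / (w - z))%C) w).
  { intros w Hw. apply cdiff_div; [apply cdiff_const| |].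
    - apply cdiff_shift.
    - apply Cmod_neq; lra. }
  assert (E : circint (fun w => (w / (w - z))%C) r = (RtoC (2 * PI) + circint (fun w => z / (w - z)) r)%C).
  { unfold circint.
    rewrite (cint_ext _ (fun t => (1 + z / (polar r t - z))%C)); try lra.
    - rewrite cint_plus; try lra.
      + rewrite cint_const. rewrite Rminus_0_r. ring.
      + intros t _; apply contC_const.
      + apply (circle_icont (fun w => (z / (w - z))%C)); [lra|]. intros w Hw. apply cdiff_ccont, Hd; lra.
    - intros t _. field. apply Cmod_neq. rewrite polar_Cmod_pos; lra. }
  rewrite E. replace (circint (fun w => (z / (w - z))%C) r) with (RtoC 0); [ring|].
  symmetry. apply Cmod_eq_0. apply Rle_antisym; [|apply Cmod_ge_0]. apply le_epsilon. intros e He.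
  (* Large enough that [|z| / (rho - |z|)] is at most [e / (4 * PI)], which [cint_bound] turns into
     [e]. *)
  set (rho := r + Cmod z + 4 * PI * Cmod z / e).
  assert (H4 : 0 <= 4 * PI * Cmod z / e) by (apply Rdiv_le_0_compat; nra).
  rewrite (circint_const _ r rho); [|unfold rho; lra|intros; apply Hd; lra].
  rewrite Rplus_0_l. unfold circint.
  eapply Rle_trans.
  - apply (cint_bound _ 0 (2 * PI) (e / (4 * PI))); [lra| |].
    + apply (circle_icont (fun w => (z / (w - z))%C)); [unfold rho; lra|].
      intros w Hw. apply cdiff_ccont, Hd. unfold rho in *; lra.
    + intros t _.
      assert (Hw : Cmod (polar rho t) = rho) by (apply polar_Cmod_pos; unfold rho; lra).
      assert (Hne : (polar rho t - z)%C <> 0%C) by (apply Cmod_neq; rewrite Hw; unfold rho; lra).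
      unfold Cdiv. rewrite Cmod_mult, Cmod_inv by auto.
      pose proof (Cmod_triangle_minus (polar rho t) z) as T. rewrite Hw in T.
      assert (Hp : 0 < Cmod (polar rho t - z)) by (apply Cmod_gt_0; auto).
      apply Rle_div_l; [auto|].
      apply Rle_trans with (e / (4 * PI) * (4 * PI * Cmod z / e)).
      * right; field. lra.
      * apply Rmult_le_compat_l; [left; apply Rdiv_lt_0_compat; lra|]. unfold rho in *; lra.
  - right; field. lra.
Qed.

(** The difference quotient times [w] extends continuously over [z] and vanishes at 0. Its circle
    integral is constant for radii between 0 and [|z|] and again between [|z|] and [r]; continuity
    in the radius joins the pieces, so it equals its value 0 on the degenerate circle. *)
Theorem cauchy_formula (f : C -> C) r z : (forall w, Cmod w <= r -> cdiff f w) -> Cmod z < r ->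
  circint (fun w => (f w * (w / (w - z)))%C) r = (RtoC (2 * PI) * f z)%C.
Proof.
  intros Hf Hz. pose proof (Cmod_ge_0 z) as Hz0. pose proof two_PI_pos as HPI.
  destruct (Hf z ltac:(lra)) as [l Hl].
  set (g := fun w => if excluded_middle_informative (w = z) then (z * l)%C
                     else (w * ((f w - f z) / (w - z)))%C).
  assert (Hgd : forall w, Cmod w <= r -> w <> z -> cdiff g w).
  { intros w Hw Hne.
    apply (cdiff_ext_loc (fun w => (w * ((f w - f z) / (w - z)))%C) g w (Cmod (w - z))).
    - apply Cmod_gt_0, Cminus_neq0; auto.
    - intros w' Hw'. unfold g. destruct excluded_middle_informative as [->|]; auto.
      rewrite Cmod_minus_sym in Hw'. lra.
    - apply cdiff_mult; [apply cdiff_id|]. apply cdiff_div.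
      + apply cdiff_minus; [auto|apply cdiff_const].
      + apply cdiff_shift.
      + apply Cminus_neq0; auto. }
  assert (Hgc : forall w, Cmod w <= r -> ccont g w).
  { intros w Hw. destruct (classic (w = z)) as [->|Hne]; [|apply cdiff_ccont; auto].
    intros eps He. pose proof (Cmod_ge_0 l).
    set (e := eps / (2 * (Cmod z + 1))).
    assert (He0 : 0 < e) by (apply Rdiv_lt_0_compat; lra).
    destruct (Hl e He0) as [d [Hd H1]].
    exists (Rmin (Rmin d 1) (eps / (2 * (Cmod l + 1)))). split.
    { repeat apply Rmin_glb_lt; auto; try lra. apply Rdiv_lt_0_compat; lra. }
    intros w' Hw'. rmins.
    unfold g. destruct (excluded_middle_informative (z = z)); [|congruence].
    destruct excluded_middle_informative as [->|Hne].
    { replace (z * l - z * l)%C with (RtoC 0) by ring. rewrite Cmod_0; auto. }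
    specialize (H1 w' ltac:(lra)).
    apply Cminus_neq0 in Hne.
    replace (w' * ((f w' - f z) / (w' - z)) - z * l)%C
      with ((w' - z) * l + w' * ((f w' - f z - l * (w' - z)) / (w' - z)))%C by (field; auto).
    eapply Rle_lt_trans; [apply Cmod_triangle|]. unfold Cdiv. rewrite !Cmod_mult, Cmod_inv by auto.
    assert (P : 0 < Cmod (w' - z)) by (apply Cmod_gt_0; auto).
    assert (A1 : Cmod (w' - z) * Cmod l < eps / 2).
    { apply Rle_lt_trans with (Cmod (w' - z) * (Cmod l + 1)); [nra|].
      apply Rlt_le_trans with (eps / (2 * (Cmod l + 1)) * (Cmod l + 1)); [apply Rmult_lt_compat_r; lra|].
      right; field; lra. }
    assert (A2 : Cmod w' <= Cmod z + 1).
    { replace w' with ((w' - z) + z)%C by ring. eapply Rle_trans; [apply Cmod_triangle|]. lra. }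
    assert (A3 : Cmod (f w' - f z - l * (w' - z)) * / Cmod (w' - z) <= e).
    { apply Rle_div_l; auto. }
    assert (A4 : Cmod w' * (Cmod (f w' - f z - l * (w' - z)) * / Cmod (w' - z)) <= (Cmod z + 1) * e).
    { apply Rmult_le_compat; auto; [apply Cmod_ge_0|].
      apply Rmult_le_pos; [apply Cmod_ge_0|]. left; apply Rinv_0_lt_compat; auto. }
    replace ((Cmod z + 1) * e) with (eps / 2) in A4 by (unfold e; field; lra). lra. }
  assert (M : circint g r = 0%C).
  { apply Cmod_eq_0. apply Rle_antisym; [|apply Cmod_ge_0]. apply le_epsilon. intros e He.
    destruct (circint_unif g r Hgc (e / 2)) as [del [Hdel Hu]]; [lra|].
    assert (Z0 : circint g 0 = 0%C).
    { unfold circint. rewrite (cint_ext _ (fun _ => RtoC 0)); [|lra|].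
      - rewrite cint_const. ring.
      - intros t _. unfold polar. rewrite !Rmult_0_l. change (0, 0) with (RtoC 0). unfold g.
        destruct excluded_middle_informative as [<-|]; ring. }
    (* [|z| + p] lies just outside the circle through [z]. For [z <> 0], the smaller [p'] serves
       both as a radius near 0 and as the offset inside that circle. *)
    set (p := Rmin del (r - Cmod z) / 2).
    assert (Hp : 0 < p) by (unfold p; assert (0 < Rmin del (r - Cmod z)) by (apply Rmin_glb_lt; lra); lra).
    assert (Hp1 : p <= del / 2) by (unfold p; pose proof (Rmin_l del (r - Cmod z)); lra).
    assert (Hp2 : p <= (r - Cmod z) / 2) by (unfold p; pose proof (Rmin_r del (r - Cmod z)); lra).
    rewrite Rplus_0_l, <- (circint_const g (Cmod z + p) r);
      [|lra|intros w Hw; apply Hgd; [lra|intros ->; lra]].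
    destruct (Req_dec (Cmod z) 0) as [E|E].
    - replace (circint g (Cmod z + p)) with (circint g (Cmod z + p) - circint g 0)%C by (rewrite Z0; ring).
      eapply Rle_trans; [apply Hu; try lra|lra]. rewrite Rabs_right; lra.
    - set (p' := Rmin p (Cmod z) / 2).
      assert (Hp' : 0 < p') by (unfold p'; assert (0 < Rmin p (Cmod z)) by (apply Rmin_glb_lt; lra); lra).
      assert (Hp1' : p' <= p / 2) by (unfold p'; pose proof (Rmin_l p (Cmod z)); lra).
      assert (Hp2' : p' <= Cmod z / 2) by (unfold p'; pose proof (Rmin_r p (Cmod z)); lra).
      assert (E2 : circint g p' = circint g (Cmod z - p')).
      { apply circint_const; [lra|]. intros w Hw; apply Hgd; [lra|intros ->; lra]. }
      replace (circint g (Cmod z + p)) with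
        ((circint g (Cmod z + p) - circint g (Cmod z - p')) + (circint g p' - circint g 0))%C
        by (rewrite Z0, E2; ring).
      eapply Rle_trans; [apply Cmod_triangle|].
      assert (B1 := Hu (Cmod z - p') (Cmod z + p) ltac:(lra) ltac:(lra) ltac:(rewrite Rabs_right; lra)).
      assert (B2 := Hu 0 p' ltac:(lra) ltac:(lra) ltac:(rewrite Rabs_right; lra)).
      lra. }
  assert (Hk : forall w, Cmod w = r -> ccont (fun w => (w / (w - z))%C) w).
  { intros w Hw. apply cdiff_ccont, cdiff_kernel; lra. }
  assert (Hfk : forall w, Cmod w = r -> ccont (fun w => (f w * (w / (w - z)))%C) w).
  { intros w Hw. apply cdiff_ccont, cdiff_mult; [apply Hf; lra|apply cdiff_kernel; lra]. }
  rewrite <- (circint_kernel z r Hz).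
  replace (circint (fun w => (f w * (w / (w - z)))%C) r) with
    (circint g r + circint (fun w => (w / (w - z))%C) r * f z)%C; [rewrite M; ring|].
  rewrite Cmult_comm. unfold circint.
  rewrite <- cint_scal, <- cint_plus; try lra.
  - apply cint_ext; [lra|]. intros t _.
    assert (Hw : Cmod (polar r t) = r) by (apply polar_Cmod_pos; lra).
    unfold g. destruct excluded_middle_informative as [E|E]; [rewrite E in Hw; lra|].
    field. apply Cminus_neq0; auto.
  - apply (circle_icont g); [lra|]. intros w Hw; apply Hgc; lra.
  - intros t _. apply contC_mult; [apply contC_const|].
    apply (contC_comp (fun w => (w / (w - z))%C)); [|apply contC_polar]. apply Hk, polar_Cmod_pos; lra.
  - apply (circle_icont (fun w => (w / (w - z))%C)); [lra|exact Hk].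
Qed.

Lemma cauchy_bound (f : C -> C) r z M : (forall w, Cmod w <= r -> cdiff f w) -> Cmod z < r ->
  (forall w, Cmod w = r -> Cmod (f w) <= M) -> Cmod (f z) <= 2 * M * r / (r - Cmod z).
Proof.
  intros Hf Hz HM. pose proof (Cmod_ge_0 z) as Hz0. pose proof two_PI_pos as HPI.
  pose proof (cauchy_formula f r z Hf Hz) as E.
  assert (B : Cmod (circint (fun w => (f w * (w / (w - z)))%C) r) <= 2 * (2 * PI - 0) * (M * r / (r - Cmod z))).
  { apply cint_bound; [lra| |].
    - apply (circle_icont (fun w => (f w * (w / (w - z)))%C)); [lra|]. intros w Hw.
      apply cdiff_ccont, cdiff_mult; [apply Hf; lra|apply cdiff_kernel; lra].
    - intros t _. assert (Hw : Cmod (polar r t) = r) by (apply polar_Cmod_pos; lra).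
      assert (Hne : (polar r t - z)%C <> 0%C) by (apply Cmod_neq; lra).
      unfold Cdiv. rewrite !Cmod_mult, Cmod_inv, Hw by auto.
      pose proof (Cmod_triangle_minus (polar r t) z) as T. rewrite Hw in T.
      unfold Rdiv. rewrite Rmult_assoc. apply Rmult_le_compat; try apply Cmod_ge_0; auto.
      + apply Rmult_le_pos; [lra|]. left; apply Rinv_0_lt_compat. lra.
      + apply Rmult_le_compat_l; [lra|]. apply Rinv_le_contravar; lra. }
  rewrite E, Cmod_mult, Cmod_R, Rabs_right in B by lra.
  apply Rmult_le_reg_l with (2 * PI); [lra|].
  eapply Rle_trans; [exact B|]. right; field; lra.
Qed.

Fixpoint cpow (z : C) (n : nat) : C := match n with O => 1%C | S n => (z * cpow z n)%C end.

Lemma cpow_Cmod z n : Cmod (cpow z n) = Cmod z ^ n.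
Proof. induction n; simpl; [apply Cmod_1|rewrite Cmod_mult, IHn; auto]. Qed.

(** Cauchy's estimate for the powers of [f] has a constant independent of the exponent, and a ratio
    above 1 would have unbounded powers. *)
Lemma max_modulus (f : C -> C) r z M : 0 < M -> (forall w, Cmod w <= r -> cdiff f w) -> Cmod z < r ->
  (forall w, Cmod w = r -> Cmod (f w) <= M) -> Cmod (f z) <= M.
Proof.
  intros HM0 Hf Hz HM. pose proof (Cmod_ge_0 z) as Hz0.
  destruct (Rle_lt_dec (Cmod (f z)) M) as [H|H]; auto. exfalso.
  assert (B : forall n, Cmod (f z) ^ n <= 2 * M ^ n * r / (r - Cmod z)).
  { intros n. rewrite <- cpow_Cmod.
    apply (cauchy_bound (fun w => cpow (f w) n)); auto.
    - intros w Hw. induction n; simpl; [apply cdiff_const|]. apply cdiff_mult; auto.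
    - intros w Hw. rewrite cpow_Cmod. apply pow_incr. split; [apply Cmod_ge_0|auto]. }
  set (q := Cmod (f z) / M).
  assert (Hq : 1 < q) by (apply Rlt_div_r; lra).
  destruct (Pow_x_infinity q ltac:(rewrite Rabs_right; lra) (2 * r / (r - Cmod z) + 1)) as [n Hn].
  specialize (Hn n (Nat.le_refl n)).
  assert (0 < q ^ n) by (apply pow_lt; lra). rewrite Rabs_right in Hn by lra.
  specialize (B n). assert (0 < M ^ n) by (apply pow_lt; lra).
  assert (q ^ n <= 2 * r / (r - Cmod z)); [|lra].
  unfold q. unfold Rdiv at 1. rewrite Rpow_mult_distr, pow_inv.
  apply Rle_div_l; auto. eapply Rle_trans; [exact B|]. right; field; lra.
Qed.

Lemma cauchy_lipschitz (f : C -> C) r r1 M z z' : (forall w, Cmod w <= r1 -> cdiff f w) -> r < r1 ->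
  (forall w, Cmod w = r1 -> Cmod (f w) <= M) -> Cmod z <= r -> Cmod z' <= r ->
  Cmod (f z - f z') <= 2 * M * r1 * Cmod (z - z') / (r1 - r) ^ 2.
Proof.
  intros Hf Hr HM Hz Hz'. pose proof (Cmod_ge_0 z) as Hz0. pose proof two_PI_pos as HPI.
  pose proof (cauchy_formula f r1 z Hf ltac:(lra)) as E.
  pose proof (cauchy_formula f r1 z' Hf ltac:(lra)) as E'.
  assert (Hc : forall z, Cmod z <= r -> icont (fun t => (f (polar r1 t) * (polar r1 t / (polar r1 t - z)))%C) 0 (2 * PI)).
  { intros z1 Hz1. apply (circle_icont (fun w => (f w * (w / (w - z1)))%C)); [lra|]. intros w Hw.
    apply cdiff_ccont, cdiff_mult; [apply Hf; lra|apply cdiff_kernel; lra]. }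
  assert (E2 : (RtoC (2 * PI) * (f z - f z'))%C =
    cint (fun t => (f (polar r1 t) * (polar r1 t / (polar r1 t - z)) - f (polar r1 t) * (polar r1 t / (polar r1 t - z')))%C) 0 (2 * PI)).
  { rewrite cint_minus; try lra; auto. unfold circint in *. rewrite E, E'. ring. }
  assert (B : Cmod (RtoC (2 * PI) * (f z - f z'))%C <= 2 * (2 * PI - 0) * (M * r1 * Cmod (z - z') / (r1 - r) ^ 2)).
  { rewrite E2. apply cint_bound; [lra| |].
    - intros t Ht. apply contC_minus; apply Hc; auto.
    - intros t _. assert (Hw : Cmod (polar r1 t) = r1) by (apply polar_Cmod_pos; lra).
      set (w := polar r1 t) in *.
      assert (Hne : (w - z)%C <> 0%C) by (apply Cmod_neq; lra).
      assert (Hne' : (w - z')%C <> 0%C) by (apply Cmod_neq; lra).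
      replace (f w * (w / (w - z)) - f w * (w / (w - z')))%C with (f w * (w * (z - z') * / ((w - z) * (w - z'))))%C
        by (field; auto).
      rewrite !Cmod_mult, Cmod_inv, Cmod_mult, Hw by (apply Cmult_neq_0; auto).
      pose proof (Cmod_triangle_minus w z) as T. pose proof (Cmod_triangle_minus w z') as T'.
      rewrite Hw in T, T'. unfold Rdiv. rewrite !(Rmult_assoc M).
      assert (0 < (r1 - r) ^ 2) by (apply pow_lt; lra).
      assert ((r1 - r) ^ 2 <= Cmod (w - z) * Cmod (w - z')) by (simpl; rewrite Rmult_1_r; apply Rmult_le_compat; lra).
      pose proof (Cmod_ge_0 (z - z')).
      apply Rmult_le_compat; try apply Cmod_ge_0; auto.
      + apply Rmult_le_pos; [apply Rmult_le_pos; lra|]. left; apply Rinv_0_lt_compat. lra.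
      + apply Rmult_le_compat_l; [apply Rmult_le_pos; lra|]. apply Rinv_le_contravar; lra. }
  rewrite Cmod_mult, Cmod_R, Rabs_right in B by lra.
  apply Rmult_le_reg_l with (2 * PI); [lra|].
  eapply Rle_trans; [exact B|]. right; field; lra.
Qed.

(** * Poisson kernel and Schwarz integral *)

Definition cont2 (f : R -> R -> R) : Prop := forall x y, continuity_2d_pt f x y.

Lemma cont2_swap f : cont2 f -> cont2 (fun x y => f y x).
Proof. intros H x y eps. destruct (H y x eps) as [d Hd]. exists d. intros u v Hu Hv. apply Hd; auto. Qed.

Lemma cont2_l f y x : cont2 f -> continuous (fun u => f u y) x.
Proof.
  intros H. apply continuous_eps. intros e He. destruct (H x y (mkposreal e He)) as [d Hd].
  exists d. split; [apply cond_pos|]. intros u Hu. apply Hd; auto.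
  rewrite Rminus_diag, Rabs_R0. apply cond_pos.
Qed.

Lemma cont2_r f x y : cont2 f -> continuous (f x) y.
Proof. intros H. apply (cont2_l (fun u v => f v u) x y). apply cont2_swap; auto. Qed.

Lemma ex_RInt_all (f : R -> R) a b : (forall x, continuous f x) -> ex_RInt f a b.
Proof. intros H. apply (ex_RInt_continuous (V := R_CompleteNormedModule)). intros; apply H. Qed.

Lemma RInt_param_cont f c d x : c <= d -> cont2 f -> continuous (fun u => RInt (f u) c d) x.
Proof.
  intros Hcd H. apply continuous_eps. intros e He.
  destruct (RInt_param_unif f (x - 1) (x + 1) c d Hcd (fun x y _ _ => H x y) (e / 2)) as [del [Hd Hu]]; [lra|].
  exists (Rmin del 1). split; [apply Rmin_glb_lt; lra|]. intros y Hy.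
  rmins.
  assert (Rabs (y - x) < 1) by lra. apply Rabs_def2 in H2.
  specialize (Hu x y ltac:(lra) ltac:(lra) ltac:(lra)). lra.
Qed.

(** As functions of the upper limit [b], both sides vanish at [a] and have the same derivative, by
    differentiation under the integral sign. *)
Lemma RInt_fubini f a b c d : a <= b -> c <= d -> cont2 f ->
  RInt (fun x => RInt (f x) c d) a b = RInt (fun y => RInt (fun x => f x y) a b) c d.
Proof.
  intros Hab Hcd H.
  set (F := fun x y => RInt (fun s => f s y) a x).
  assert (Hi : forall x y, is_derive (fun z => F z y) x (f x y)).
  { intros x y. apply (is_derive_RInt (V := R_NormedModule) (fun s => f s y) _ a x).
    - exists (mkposreal 1 Rlt_0_1). intros z _.
      apply (RInt_correct (V := R_CompleteNormedModule)), ex_RInt_all.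
      intros; apply cont2_l; auto.
    - apply cont2_l; auto. }
  assert (Hx : forall x, a <= x -> ex_RInt (F x) c d).
  { intros x Hx. apply ex_RInt_all. intros y.
    apply (RInt_param_cont (fun v u => f u v) a x y Hx). apply cont2_swap; auto. }
  (* Differentiation needs integrability at all nearby parameters, hence also left of [a], where the
     inner integral is reversed. *)
  assert (Hx' : forall x, ex_RInt (F x) c d).
  { intros x. destruct (Rle_lt_dec a x) as [|Hlt]; auto.
    apply ex_RInt_ext with (fun y => - RInt (fun s => f s y) x a).
    - intros y _. unfold F. exact (opp_RInt_swap (V := R_CompleteNormedModule) _ _ _
       (ex_RInt_all _ _ _ (fun z => cont2_l f y z H))).
    - apply (ex_RInt_opp (V := R_NormedModule)). apply ex_RInt_all. intros y.
      apply (RInt_param_cont (fun v u => f u v) x a y); [lra|]. apply cont2_swap; auto. }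
  assert (D : forall x, is_derive (fun x => RInt (F x) c d) x (RInt (f x) c d)).
  { intros x. replace (RInt (f x) c d) with (RInt (fun t => Derive (fun u => F u t) x) c d).
    - apply (is_derive_RInt_param F c d x).
      + exists (mkposreal 1 Rlt_0_1). intros z _ t _. eexists; apply Hi.
      + intros t _. apply continuity_2d_pt_ext with f; auto.
        intros u v. symmetry. apply is_derive_unique, Hi.
      + exists (mkposreal 1 Rlt_0_1). intros z _. apply Hx'.
    - apply RInt_ext. intros t _. apply is_derive_unique, Hi. }
  assert (I := is_RInt_derive (V := R_CompleteNormedModule) (fun x => RInt (F x) c d) (fun x => RInt (f x) c d) a b
    (fun x _ => D x) (fun x _ => RInt_param_cont f c d x Hcd H)).
  apply is_RInt_unique in I. rewrite I.
  replace (RInt (F a) c d) with 0.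
  - unfold minus, plus, opp; simpl. fold (F b). unfold F. ring.
  - symmetry. transitivity (RInt (fun _ => 0) c d).
    + apply RInt_ext. intros y _. exact (RInt_point (V := R_CompleteNormedModule) a (fun s => f s y)).
    + rewrite (RInt_const (V := R_CompleteNormedModule)). unfold scal; simpl; unfold mult; simpl; ring.
Qed.

(** Distance of boundary points rather than of angles: it ignores multiples of [2 * PI], and its
    square is the variable part of the Poisson denominator ([PK_den_chord]). *)
Definition chord (s t : R) : R := Cmod (polar 1 s - polar 1 t).

Lemma chord_sqr s t : chord s t ^ 2 = 2 - 2 * cos (s - t).
Proof.
  unfold chord. rewrite Cmod_sqr. unfold polar; simpl. rewrite cos_minus.
  pose proof (sin2_cos2 s). pose proof (sin2_cos2 t). unfold Rsqr in *. nra.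
Qed.

Lemma chord_pos s t : 0 <= chord s t. Proof. apply Cmod_ge_0. Qed.
Lemma chord_sym s t : chord s t = chord t s. Proof. apply Cmod_minus_sym. Qed.
Lemma chord_tri s t u : chord s u <= chord s t + chord t u.
Proof. unfold chord. replace (polar 1 s - polar 1 u)%C with ((polar 1 s - polar 1 t) + (polar 1 t - polar 1 u))%C by ring. apply Cmod_triangle. Qed.
Lemma chord_refl s : chord s s = 0.
Proof. unfold chord. replace (polar 1 s - polar 1 s)%C with (RtoC 0) by ring. apply Cmod_0. Qed.
Lemma chord_le_2 s t : chord s t <= 2.
Proof. pose proof (chord_sqr s t). pose proof (COS_bound (s - t)). pose proof (chord_pos s t). nra. Qed.

Lemma sin_abs_le x : Rabs (sin x) <= Rabs x.
Proof.
  assert (P : forall x, 0 <= x -> Rabs (sin x) <= x).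
  { intros y Hy. destruct (Rle_lt_dec y 1) as [H|H].
    - pose proof PI2_1. destruct (Req_dec y 0) as [->|]; [rewrite sin_0, Rabs_R0; lra|].
      rewrite Rabs_right; [left; apply sin_lt_x; lra|]. apply Rle_ge, sin_ge_0; lra.
    - apply Rabs_le. pose proof (SIN_bound y). lra. }
  destruct (Rle_lt_dec 0 x) as [H|H].
  - rewrite (Rabs_right x) by lra. auto.
  - rewrite (Rabs_left x) by auto. rewrite <- (Ropp_involutive x) at 1. rewrite sin_neg, Rabs_Ropp.
    apply P; lra.
Qed.

Lemma chord_le s t : chord s t <= Rabs (s - t).
Proof.
  pose proof (chord_sqr s t) as E. pose proof (chord_pos s t).
  assert (E2 : 2 - 2 * cos (s - t) = (2 * sin ((s - t) / 2)) ^ 2).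
  { replace (cos (s - t)) with (cos (2 * ((s - t) / 2))) by (f_equal; field). rewrite cos_2a_sin. ring. }
  rewrite E2 in E. pose proof (sin_abs_le ((s - t) / 2)) as B.
  unfold Rdiv in B. rewrite Rabs_mult, (Rabs_right (/ 2)) in B by lra.
  rewrite <- (pow2_abs (2 * _)), Rabs_mult, (Rabs_right 2) in E by lra.
  pose proof (Rabs_pos (sin ((s - t) * / 2))). pose proof (Rabs_pos (s - t)). nra.
Qed.

(** Measuring by the chord builds [2 * PI]-periodicity into the condition. *)
Definition chLip (L : R) (psi : R -> R) : Prop := forall s t, Rabs (psi s - psi t) <= L * chord s t.

Lemma chLip_cont L psi x : chLip L psi -> continuous psi x.
Proof.
  intros H. apply continuous_eps. intros e He.
  assert (0 < Rabs L + 1) by (pose proof (Rabs_pos L); lra).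
  exists (e / (Rabs L + 1)). split; [apply Rdiv_lt_0_compat; auto|]. intros y Hy.
  eapply Rle_lt_trans; [apply H|]. apply Rlt_div_r in Hy; auto.
  pose proof (chord_le y x). pose proof (chord_pos y x). pose proof (Rle_abs L). nra.
Qed.

(** The Poisson kernel; its normalisation 1 / (2 pi) is placed in [Pint]. *)
Definition PK (rho s : R) : R := (1 - rho ^ 2) / (1 - 2 * rho * cos s + rho ^ 2).

Lemma PK_den_chord rho s t : 1 - 2 * rho * cos (s - t) + rho ^ 2 = (1 - rho) ^ 2 + rho * chord s t ^ 2.
Proof. rewrite chord_sqr. ring. Qed.

Lemma PK_den_pos rho s : 0 <= rho < 1 -> 0 < 1 - 2 * rho * cos s + rho ^ 2.
Proof. intros H. pose proof (COS_bound s). assert (0 < (1 - rho) ^ 2) by (apply pow_lt; lra). nra. Qed.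

Lemma PK_pos rho s : 0 <= rho < 1 -> 0 < PK rho s.
Proof. intros H. apply Rdiv_lt_0_compat; [nra|apply PK_den_pos; auto]. Qed.

Lemma PK_sym rho s t : PK rho (s - t) = PK rho (t - s).
Proof. unfold PK. replace (t - s) with (- (s - t)) by ring. rewrite cos_neg. auto. Qed.

Lemma PK_chord rho s t : 0 < rho < 1 -> PK rho (s - t) * chord s t ^ 2 <= (1 - rho ^ 2) / rho.
Proof.
  intros H. unfold PK. pose proof (PK_den_pos rho (s - t) ltac:(lra)) as D.
  rewrite PK_den_chord in *. set (c := chord s t ^ 2) in *.
  unfold Rdiv. rewrite Rmult_assoc. apply Rmult_le_compat_l; [nra|].
  rewrite Rmult_comm. apply Rle_div_l; auto.
  apply Rmult_le_reg_l with rho; [lra|]. field_simplify; [|lra].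
  assert (0 <= (1 - rho) ^ 2) by apply pow2_ge_0. nra.
Qed.

Lemma PK_cont rho : 0 <= rho < 1 -> cont2 (fun s t => PK rho (s - t)).
Proof.
  intros H x y. unfold PK, Rdiv. apply continuity_2d_pt_mult; [apply continuity_2d_pt_const|].
  apply continuity_2d_pt_inv; [|apply Rgt_not_eq, PK_den_pos; auto].
  apply continuity_2d_pt_plus; [|apply continuity_2d_pt_const].
  apply continuity_2d_pt_minus; [apply continuity_2d_pt_const|].
  apply continuity_2d_pt_mult; [apply continuity_2d_pt_const|].
  apply (continuity_1d_2d_pt_comp cos (fun u v => u - v)); [apply continuity_cos|].
  apply continuity_2d_pt_minus; [apply continuity_2d_pt_id1|apply continuity_2d_pt_id2].
Qed.

Lemma cont2_const_l (f : R -> R) : (forall x, continuous f x) -> cont2 (fun x y => f x).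
Proof.
  intros H x y eps. destruct (proj1 (continuous_eps f x) (H x) eps (cond_pos eps)) as [d [Hd H1]].
  exists (mkposreal d Hd). intros u v Hu Hv. apply H1; auto.
Qed.

Lemma cont2_const_r (f : R -> R) : (forall x, continuous f x) -> cont2 (fun x y => f y).
Proof. intros H. apply cont2_swap, cont2_const_l; auto. Qed.

Lemma cont2_mult f g : cont2 f -> cont2 g -> cont2 (fun x y => f x y * g x y).
Proof. intros Hf Hg x y. apply continuity_2d_pt_mult; auto. Qed.

Lemma Cdiv_kernel_re rho s t : 0 <= rho < 1 ->
  fst ((polar 1 t + polar rho s) / (polar 1 t - polar rho s))%C = PK rho (s - t).
Proof.
  intros H. pose proof (PK_den_pos rho (s - t) H) as D. unfold PK.
  unfold polar, Cdiv, Cinv; simpl. rewrite cos_minus in *.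
  pose proof (sin2_cos2 s) as S1. pose proof (sin2_cos2 t) as S2. unfold Rsqr in *.
  set (cs := cos s) in *. set (ss := sin s) in *. set (ct := cos t) in *. set (st := sin t) in *.
  assert (E : (1 * ct + - (rho * cs)) * ((1 * ct + - (rho * cs)) * 1) +
     (1 * st + - (rho * ss)) * ((1 * st + - (rho * ss)) * 1)
     = 1 - 2 * rho * (cs * ct + ss * st) + rho ^ 2) by nra.
  rewrite !E. unfold Rdiv.
  replace (rho * (rho * 1)) with (rho ^ 2) by ring.
  assert (E2 : 1 - rho ^ 2 = (1 * ct + rho * cs) * (1 * ct + - (rho * cs))
      + (1 * st + rho * ss) * (1 * st + - (rho * ss))) by nra.
  rewrite E2. ring.
Qed.

Lemma polar_split rho t : polar rho t = (RtoC rho * polar 1 t)%C.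
Proof. unfold polar. apply injective_projections; simpl; ring. Qed.

Lemma polar_surj w : exists t, - PI <= t <= PI /\ w = polar (Cmod w) t.
Proof.
  destruct (Req_dec (Cmod w) 0) as [E|E].
  { exists 0. pose proof PI_RGT_0. split; [lra|]. apply Cmod_eq_0 in E. rewrite E, Cmod_0. unfold polar. rewrite !Rmult_0_l. auto. }
  pose proof (Cmod_ge_0 w). destruct w as [x y]. set (r := Cmod (x, y)) in *.
  assert (Hr : 0 < r) by lra.
  assert (Hs : r ^ 2 = x ^ 2 + y ^ 2) by (unfold r; rewrite Cmod_sqr; auto).
  assert (Hb : -1 <= x / r <= 1).
  { split; [apply Rle_div_r|apply Rle_div_l]; nra. }
  assert (Hc : cos (acos (x / r)) = x / r) by (apply cos_acos; auto).
  assert (Hq : sin (acos (x / r)) = Rabs y / r).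
  { rewrite sin_acos by auto. replace (1 - (x / r)²) with ((Rabs y / r) ^ 2).
    - apply sqrt_pow2. apply Rdiv_le_0_compat; auto using Rabs_pos.
    - unfold Rdiv. rewrite Rpow_mult_distr, pow2_abs. unfold Rsqr. field_simplify; try lra. rewrite Hs. field; nra. }
  destruct (Rle_lt_dec 0 y) as [Hy|Hy].
  - exists (acos (x / r)). split; [pose proof (acos_bound (x / r)); lra|]. unfold polar. rewrite Hc, Hq, Rabs_right by lra.
    f_equal; field; lra.
  - exists (- acos (x / r)). split; [pose proof (acos_bound (x / r)); lra|]. unfold polar. rewrite cos_neg, sin_neg, Hc, Hq, Rabs_left by lra.
    f_equal; field; lra.
Qed.

Definition schwarz_int (psi : R -> R) (z : C) : C :=
  cint (fun t => (RtoC (psi t) * ((polar 1 t + z) / (polar 1 t - z)))%C) 0 (2 * PI).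

Lemma contC_RtoC psi t : continuous psi t -> contC (fun s => RtoC (psi s)) t.
Proof. intros H. apply contC_pair; auto. apply continuous_const. Qed.

Lemma schwarz_icont psi k : (forall t, continuous psi t) -> (forall w, Cmod w = 1 -> ccont k w) ->
  icont (fun t => (RtoC (psi t) * k (polar 1 t))%C) 0 (2 * PI).
Proof.
  intros Hp Hk t _. apply contC_mult; [apply contC_RtoC; auto|].
  apply (contC_comp k); [|apply contC_polar]. apply Hk, polar_Cmod_pos; lra.
Qed.

(** Under the integral the error of the linear approximation is explicit: [psi] times
    [2 a (w - z)^2 / ((a - z)^2 (a - w))], where [|a - z| >= m] and [|a - w| >= m / 2]. *)
Lemma schwarz_cdiff psi B z : (forall t, continuous psi t) -> (forall t, Rabs (psi t) <= B) ->
  Cmod z < 1 -> cdiff (schwarz_int psi) z.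
Proof.
  intros Hc HB Hz. pose proof two_PI_pos as HPI.
  assert (HB0 : 0 <= B) by (pose proof (Rabs_pos (psi 0)); specialize (HB 0); lra).
  set (m := 1 - Cmod z). assert (Hm : 0 < m) by (unfold m; lra).
  assert (K1 : forall z w, Cmod z < 1 -> Cmod w = 1 -> (w - z)%C <> 0%C) by (intros; apply Cmod_neq; lra).
  set (G := fun z t => (RtoC (psi t) * ((polar 1 t + z) / (polar 1 t - z)))%C).
  set (D := fun t => (RtoC (psi t) * (2 * polar 1 t / ((polar 1 t - z) * (polar 1 t - z))))%C).
  assert (I1 : forall z, Cmod z < 1 -> icont (G z) 0 (2 * PI)).
  { intros z1 Hz1. apply (schwarz_icont psi (fun w => ((w + z1) / (w - z1))%C)); auto.
    intros w Hw. apply cdiff_ccont, cdiff_div; auto; [|apply cdiff_shift].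
    apply cdiff_plus; [apply cdiff_id|apply cdiff_const]. }
  assert (I2 : icont D 0 (2 * PI)).
  { apply (schwarz_icont psi (fun w => (2 * w / ((w - z) * (w - z)))%C)); auto.
    intros w Hw. apply cdiff_ccont, cdiff_div.
    - apply cdiff_mult; [apply cdiff_const|apply cdiff_id].
    - apply cdiff_mult; apply cdiff_shift.
    - apply Cmult_neq_0; auto. }
  exists (cint D 0 (2 * PI)).
  intros eps He.
  set (Q := 16 * PI * B / (m ^ 3) + 1).
  assert (Hm3 : 0 < m ^ 3) by (apply pow_lt; auto).
  assert (HQ0 : 0 <= 16 * PI * B / m ^ 3) by (apply Rdiv_le_0_compat; auto; nra).
  assert (HQ : 0 < Q) by (unfold Q; lra).
  exists (Rmin (m / 2) (eps / Q)). split; [apply Rmin_glb_lt; [lra|apply Rdiv_lt_0_compat; auto]|].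
  intros w Hw. rmins.
  assert (Hw1 : Cmod w < 1 - m / 2).
  { replace w with ((w - z) + z)%C by ring. eapply Rle_lt_trans; [apply Cmod_triangle|]. unfold m in *; lra. }
  set (h := Cmod (w - z)) in *. assert (Hh : 0 <= h) by apply Cmod_ge_0.
  assert (I1w := I1 w ltac:(lra)). assert (I1z := I1 z Hz).
  assert (I3 : icont (fun t => ((w - z) * D t)%C) 0 (2 * PI)).
  { intros t Ht. apply contC_mult; [apply contC_const|apply I2; auto]. }
  assert (I4 : icont (fun t => (G w t - G z t)%C) 0 (2 * PI)).
  { intros t Ht. apply contC_minus; [apply I1w|apply I1z]; auto. }
  assert (E : (schwarz_int psi w - schwarz_int psi z - cint D 0 (2 * PI) * (w - z))%C =
    cint (fun t => ((G w t - G z t) - (w - z) * D t)%C) 0 (2 * PI)).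
  { change (schwarz_int psi w) with (cint (G w) 0 (2 * PI)).
    change (schwarz_int psi z) with (cint (G z) 0 (2 * PI)).
    rewrite (cint_minus (fun t => (G w t - G z t)%C)), (cint_minus (G w) (G z)), (cint_scal (w - z) D); auto; try lra.
    ring. }
  rewrite E.
  assert (Bd : Cmod (cint (fun t => ((G w t - G z t) - (w - z) * D t)%C) 0 (2 * PI))
     <= 2 * (2 * PI - 0) * (4 * B * h ^ 2 / m ^ 3)).
  { apply cint_bound; [lra|intros t Ht; apply contC_minus; auto|].
    intros t _. unfold G, D. assert (Ha : Cmod (polar 1 t) = 1) by (apply polar_Cmod_pos; lra).
    set (a := polar 1 t) in *.
    assert (N1 := K1 z a Hz Ha). assert (N2 := K1 w a ltac:(lra) Ha).
    replace (RtoC (psi t) * ((a + w) / (a - w)) - RtoC (psi t) * ((a + z) / (a - z))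
      - (w - z) * (RtoC (psi t) * (2 * a / ((a - z) * (a - z)))))%C
    with (RtoC (psi t) * (2 * a * ((w - z) * (w - z)) * / ((a - z) * (a - z) * (a - w))))%C
    by (field; auto).
    rewrite !Cmod_mult, Cmod_inv, !Cmod_mult, Ha, !Cmod_R by (repeat apply Cmult_neq_0; auto).
    fold h. rewrite (Rabs_right 2) by lra.
    pose proof (Cmod_triangle_minus a z) as T1. pose proof (Cmod_triangle_minus a w) as T2.
    rewrite Ha in T1, T2. fold m in T1.
    assert (Dn : m * m * (m / 2) <= Cmod (a - z) * Cmod (a - z) * Cmod (a - w)).
    { apply Rmult_le_compat; try nra. }
    apply Rle_trans with (B * (2 * 1 * (h * h) * / (m * m * (m / 2)))).
    - apply Rmult_le_compat; auto using Rabs_pos.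
      + apply Rmult_le_pos; [nra|]. left; apply Rinv_0_lt_compat. nra.
      + apply Rmult_le_compat_l; [nra|]. apply Rinv_le_contravar; auto. nra.
    - right. field. lra. }
  eapply Rle_trans; [exact Bd|].
  replace (2 * (2 * PI - 0) * (4 * B * h ^ 2 / m ^ 3)) with ((16 * PI * B / m ^ 3) * h * h) by (field; lra).
  apply Rmult_le_compat_r; auto.
  apply Rle_trans with (Q * (eps / Q)); [|right; field; lra].
  apply Rmult_le_compat; try lra. unfold Q; lra.
Qed.

Definition Pint (rho : R) (psi : R -> R) (s : R) : R :=
  RInt (fun t => PK rho (s - t) * psi t) 0 (2 * PI) / (2 * PI).

Lemma PK_cont1 rho s t : 0 <= rho < 1 -> continuous (fun t => PK rho (s - t)) t.
Proof. intros. apply (cont2_r (fun s t => PK rho (s - t))). apply PK_cont; auto. Qed.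

Lemma schwarz_re psi rho s : (forall t, continuous psi t) -> 0 <= rho < 1 ->
  fst (schwarz_int psi (polar rho s)) = 2 * PI * Pint rho psi s.
Proof.
  intros Hc Hr. unfold schwarz_int, cint, Pint; simpl fst. pose proof two_PI_pos.
  assert (A : forall x : R, 2 * PI * (x / (2 * PI)) = x) by (intros; field; lra). rewrite A.
  apply RInt_ext. intros t _. rewrite <- (Cdiv_kernel_re rho s t Hr). simpl. ring.
Qed.

(** Real part of [circint_kernel], since [(w + z) / (w - z) = 2 w / (w - z) - 1]. *)
Lemma PK_int rho s : 0 <= rho < 1 -> RInt (fun t => PK rho (s - t)) 0 (2 * PI) = 2 * PI.
Proof.
  intros H. pose proof two_PI_pos.
  assert (Hz : Cmod (polar rho s) < 1) by (rewrite polar_Cmod_pos; lra).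
  pose proof (circint_kernel (polar rho s) 1 Hz) as E. apply (f_equal fst) in E.
  set (k := fun t => fst (polar 1 t / (polar 1 t - polar rho s))%C).
  change (RInt k 0 (2 * PI) = 2 * PI) in E.
  assert (Hk : forall t, continuous k t).
  { intros t. apply contC_fst.
    apply (circle_icont (fun w => (w / (w - polar rho s))%C) 1 t t); try lra.
    intros w Hw. apply cdiff_ccont, cdiff_kernel; lra. }
  assert (X : RInt (fun t => 2 * k t - 1) 0 (2 * PI) = 2 * PI).
  { rewrite (RInt_minus (V := R_CompleteNormedModule) (fun t => 2 * k t) (fun _ => 1)).
    - rewrite (RInt_scal (V := R_CompleteNormedModule) k), (RInt_const (V := R_CompleteNormedModule)).
      + rewrite E. unfold minus, plus, opp, scal; simpl; unfold mult; simpl. ring.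
      + apply ex_RInt_all; auto.
    - apply (ex_RInt_scal (V := R_NormedModule)), ex_RInt_all; auto.
    - apply ex_RInt_all. intros; apply continuous_const. }
  rewrite <- X at 2. apply RInt_ext. intros t _. unfold k. rewrite <- (Cdiv_kernel_re rho s t H).
  assert (N : (polar 1 t - polar rho s)%C <> 0%C) by (apply Cmod_neq; rewrite !polar_Cmod_pos; lra).
  replace ((polar 1 t + polar rho s) / (polar 1 t - polar rho s))%C
    with (2 * (polar 1 t / (polar 1 t - polar rho s)) - 1)%C by (field; auto).
  simpl. ring.
Qed.

(** * Poisson-Jensen inequality *)

Definition contR (f : R -> R) : Prop := forall x, continuous f x.

Lemma contR_plus f g : contR f -> contR g -> contR (fun x => f x + g x).
Proof. intros Hf Hg x. apply cont_plus; auto. Qed.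
Lemma contR_minus f g : contR f -> contR g -> contR (fun x => f x - g x).
Proof. intros Hf Hg x. apply cont_minus; auto. Qed.
Lemma contR_mult f g : contR f -> contR g -> contR (fun x => f x * g x).
Proof. intros Hf Hg x. apply cont_mult; auto. Qed.
Lemma contR_const c : contR (fun _ => c).
Proof. intros x. apply continuous_const. Qed.

Lemma contR_PK rho s : 0 <= rho < 1 -> contR (fun t => PK rho (s - t)).
Proof. intros H t. apply PK_cont1; auto. Qed.

Lemma RI_le f g a b : a <= b -> contR f -> contR g -> (forall x, f x <= g x) -> RInt f a b <= RInt g a b.
Proof. intros Hab Hf Hg H. apply RInt_le; auto using ex_RInt_all. Qed.

Lemma RI_plus f g a b : contR f -> contR g -> RInt (fun x => f x + g x) a b = RInt f a b + RInt g a b.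
Proof. intros Hf Hg. exact (RInt_plus (V := R_CompleteNormedModule) f g a b (ex_RInt_all _ _ _ Hf) (ex_RInt_all _ _ _ Hg)). Qed.

Lemma RI_minus f g a b : contR f -> contR g -> RInt (fun x => f x - g x) a b = RInt f a b - RInt g a b.
Proof. intros Hf Hg. exact (RInt_minus (V := R_CompleteNormedModule) f g a b (ex_RInt_all _ _ _ Hf) (ex_RInt_all _ _ _ Hg)). Qed.

Lemma RI_scal c f a b : contR f -> RInt (fun x => c * f x) a b = c * RInt f a b.
Proof. intros Hf. exact (RInt_scal (V := R_CompleteNormedModule) f a b c (ex_RInt_all _ _ _ Hf)). Qed.

Lemma RI_const (c a b : R) : RInt (fun _ : R => c) a b = (b - a) * c.
Proof. exact (RInt_const (V := R_CompleteNormedModule) a b c). Qed.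

Lemma RI_ext (f g : R -> R) a b : (forall x, f x = g x) -> RInt f a b = RInt g a b.
Proof. intros H. apply RInt_ext. intros; auto. Qed.

Lemma RI_nonneg f a b : a <= b -> contR f -> (forall x, 0 <= f x) -> 0 <= RInt f a b.
Proof. intros. apply RInt_ge_0; auto using ex_RInt_all. Qed.

Lemma Pint_le rho f g s : 0 <= rho < 1 -> contR f -> contR g -> (forall t, f t <= g t) ->
  Pint rho f s <= Pint rho g s.
Proof.
  intros Hr Hf Hg H. pose proof two_PI_pos. unfold Pint. apply Rmult_le_compat_r.
  - left; apply Rinv_0_lt_compat; auto.
  - apply RI_le; try lra; try (apply contR_mult; auto; apply contR_PK; auto).
    intros t. apply Rmult_le_compat_l; auto. left; apply PK_pos; auto.
Qed.

Lemma Pint_const rho c s : 0 <= rho < 1 -> Pint rho (fun _ => c) s = c.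
Proof.
  intros Hr. pose proof two_PI_pos. unfold Pint.
  rewrite (RI_ext _ (fun t => c * PK rho (s - t))) by (intros; ring).
  rewrite RI_scal by (apply contR_PK; auto). rewrite PK_int by auto. field; lra.
Qed.

Lemma Pint_minus rho f g s : 0 <= rho < 1 -> contR f -> contR g ->
  Pint rho (fun t => f t - g t) s = Pint rho f s - Pint rho g s.
Proof.
  intros Hr Hf Hg. pose proof two_PI_pos. unfold Pint.
  rewrite (RI_ext _ (fun t => PK rho (s - t) * f t - PK rho (s - t) * g t)) by (intros; ring).
  rewrite RI_minus by (apply contR_mult; auto; apply contR_PK; auto). field; lra.
Qed.

Lemma Pint_scal rho c f s : 0 <= rho < 1 -> contR f -> Pint rho (fun t => c * f t) s = c * Pint rho f s.
Proof.
  intros Hr Hf. pose proof two_PI_pos. unfold Pint.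
  rewrite (RI_ext _ (fun t => c * (PK rho (s - t) * f t))) by (intros; ring).
  rewrite RI_scal by (apply contR_mult; auto; apply contR_PK; auto). field; lra.
Qed.

(* The kernel decays like the square of the chord, so a quadratic modulus of continuity at s
   bounds the Poisson average of h without splitting the circle. *)
Lemma Pint_quad_bound rho h s eta B : 0 < rho < 1 -> 0 <= B -> contR h ->
  (forall t, h t <= eta + B * chord s t ^ 2) -> Pint rho h s <= eta + B * ((1 - rho ^ 2) / rho).
Proof.
  intros Hr HB Hc H. pose proof two_PI_pos. unfold Pint. apply Rle_div_l; auto.
  apply Rle_trans with (RInt (fun t => eta * PK rho (s - t) + B * ((1 - rho ^ 2) / rho)) 0 (2 * PI)).
  - apply RI_le; try lra.
    + apply contR_mult; auto. apply contR_PK; lra.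
    + apply contR_plus; [apply contR_mult|]; auto using contR_const. apply contR_PK; lra.
    + intros t. pose proof (PK_pos rho (s - t) ltac:(lra)). pose proof (PK_chord rho s t Hr).
      specialize (H t). apply Rle_trans with (PK rho (s - t) * (eta + B * chord s t ^ 2)).
      * apply Rmult_le_compat_l; lra.
      * rewrite Rmult_plus_distr_l.
        replace (PK rho (s - t) * (B * chord s t ^ 2)) with (B * (PK rho (s - t) * chord s t ^ 2)) by ring.
        assert (B * (PK rho (s - t) * chord s t ^ 2) <= B * ((1 - rho ^ 2) / rho)) by (apply Rmult_le_compat_l; auto).
        lra.
  - rewrite RI_plus, RI_scal, RI_const, PK_int; try lra; auto using contR_const.
    + apply contR_PK; lra.
    + apply contR_mult; auto using contR_const. apply contR_PK; lra.
Qed.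

(** Completing the square trades a linear modulus for a constant plus a quadratic one, the form that
    [Pint_quad_bound] accepts. *)
Lemma lip_quad L c eta : 0 < eta -> L * c <= eta + L ^ 2 / (4 * eta) * c ^ 2.
Proof.
  intros H. assert (0 <= (L * c - 2 * eta) ^ 2) by apply pow2_ge_0.
  apply Rmult_le_reg_l with (4 * eta); [lra|]. field_simplify; [|lra].
  apply Rmult_le_reg_r with 1; [lra|]. field_simplify. nra.
Qed.

Lemma Pint_chLip_upper rho L psi s eta : 0 < rho < 1 -> 0 < eta -> chLip L psi ->
  Rabs (Pint rho psi s - psi s) <= eta + L ^ 2 / (4 * eta) * ((1 - rho ^ 2) / rho).
Proof.
  intros Hr He HL.
  assert (Hc : contR psi) by (intros x; eapply chLip_cont; eauto).
  assert (B0 : 0 <= L ^ 2 / (4 * eta)) by (apply Rdiv_le_0_compat; [apply pow2_ge_0|lra]).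
  assert (E1 : Pint rho (fun t => psi t - psi s) s = Pint rho psi s - psi s).
  { rewrite Pint_minus, Pint_const; auto using contR_const; lra. }
  assert (E2 : Pint rho (fun t => psi s - psi t) s = psi s - Pint rho psi s).
  { rewrite Pint_minus, Pint_const; auto using contR_const; lra. }
  assert (Hb : forall t, Rabs (psi s - psi t) <= eta + L ^ 2 / (4 * eta) * chord s t ^ 2).
  { intros t. eapply Rle_trans; [apply HL|]. apply lip_quad; auto. }
  apply Rabs_le. split.
  - apply Ropp_le_cancel. rewrite Ropp_involutive, Ropp_minus_distr, <- E2.
    apply Pint_quad_bound; auto using contR_minus, contR_const.
    intros t. pose proof (Rle_abs (psi s - psi t)). specialize (Hb t). lra.
  - rewrite <- E1. apply Pint_quad_bound; auto using contR_minus, contR_const.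
    intros t. pose proof (Rle_abs (psi t - psi s)). specialize (Hb t).
    rewrite Rabs_minus_sym in Hb. lra.
Qed.

Lemma polar_scal c r s : (RtoC c * polar r s)%C = polar (c * r) s.
Proof. unfold polar. apply injective_projections; simpl; ring. Qed.

(* The analytic function f * cexp (- schwarz_int psi / 2pi), dilated slightly, is at most about 1 on
   the circle, hence inside by the maximum modulus principle. *)
Theorem poisson_jensen (f : C -> C) psi L r rho s : 0 < r -> (forall w, Cmod w <= r -> cdiff f w) ->
  chLip L psi -> (forall t, Cmod (f (polar r t)) <= exp (psi t)) -> 0 <= rho < 1 ->
  Cmod (f (polar (r * rho) s)) <= exp (Pint rho psi s).
Proof.
  intros Hr Hf HL Hb Hrho. pose proof two_PI_pos as HPI.
  assert (Hc : contR psi) by (intros x; eapply chLip_cont; eauto).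
  set (P := Pint rho psi s).
  destruct (Rle_lt_dec (Cmod (f (polar (r * rho) s))) (exp P)) as [H|H]; auto. exfalso.
  assert (F0 : 0 < Cmod (f (polar (r * rho) s))) by (pose proof (exp_pos P); lra).
  set (eta := (ln (Cmod (f (polar (r * rho) s))) - P) / 4).
  assert (He : 0 < eta).
  { unfold eta. assert (P < ln (Cmod (f (polar (r * rho) s)))); [|lra].
    rewrite <- (ln_exp P). apply ln_increasing; auto. apply exp_pos. }
  assert (G0 : exp (P + 2 * eta) < Cmod (f (polar (r * rho) s))).
  { rewrite <- (exp_ln (Cmod (f (polar (r * rho) s)))) by auto. apply exp_increasing. unfold eta in *. lra. }
  assert (Hz0 : Cmod (polar (r * rho) s) <= r) by (rewrite polar_Cmod_pos; nra).
  destruct (cdiff_ccont _ _ (Hf _ Hz0) (Cmod (f (polar (r * rho) s)) - exp (P + 2 * eta)) ltac:(lra)) as [d [Hd Hd1]].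
  (* The dilation is by [x = 1 - y]. The four bounds give, in order: [x >= 1 / 2]; [rho < x]; [psi]
     within [eta] of its Poisson average at radius [x]; a displacement of the evaluation point below
     [d]. *)
  set (y := Rmin (Rmin (1 / 2) ((1 - rho) / 2)) (Rmin (eta ^ 2 / (4 * (L ^ 2 + 1))) (d / (4 * (r + 1))))).
  assert (HL2 : 0 <= L ^ 2) by apply pow2_ge_0.
  assert (Y0 : 0 < y).
  { unfold y. repeat apply Rmin_glb_lt; try lra; apply Rdiv_lt_0_compat; try lra. apply pow_lt; auto. }
  assert (Y1 : y <= 1 / 2) by (unfold y; eapply Rle_trans; [apply Rmin_l|apply Rmin_l]).
  assert (Y2 : y <= (1 - rho) / 2) by (unfold y; eapply Rle_trans; [apply Rmin_l|apply Rmin_r]).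
  assert (Y3 : y <= eta ^ 2 / (4 * (L ^ 2 + 1))) by (unfold y; eapply Rle_trans; [apply Rmin_r|apply Rmin_l]).
  assert (Y4 : y <= d / (4 * (r + 1))) by (unfold y; eapply Rle_trans; [apply Rmin_r|apply Rmin_r]).
  set (x := 1 - y).
  assert (Hx : 1 / 2 <= x < 1) by (unfold x; lra).
  assert (Hxr : rho < x) by (unfold x; lra).
  (* The dilation sends the closed disc of radius [r] into the open unit disc, where
     [schwarz_int psi] is differentiable. *)
  set (H0 := fun w => schwarz_int psi (RtoC (x / r) * w)%C).
  set (Phi := fun w => (f w * cexp (- (RtoC (/ (2 * PI)) * H0 w)))%C).
  assert (PhiM : forall q t, 0 <= q <= r -> Cmod (Phi (polar q t)) =
     Cmod (f (polar q t)) * exp (- Pint (x * q / r) psi t)).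
  { intros q t Hq. unfold Phi, H0. rewrite Cmod_mult, cexp_Cmod. f_equal. f_equal.
    rewrite polar_scal. replace (x / r * q) with (x * q / r) by (field; lra).
    assert (Fst : forall c w, fst (- (RtoC c * w))%C = - (c * fst w)) by (intros; simpl; ring).
    rewrite Fst, schwarz_re; auto.
    - field. lra.
    - split; [apply Rdiv_le_0_compat; nra|]. apply Rlt_div_l; nra. }
  (* At [rho / x] the dilated Poisson radius is exactly [rho]; continuity of [f] then brings the
     evaluation point back to [r * rho]. *)
  assert (M : Cmod (Phi (polar (r * (rho / x)) s)) <= exp eta).
  { assert (Hrx : 0 <= rho / x < 1) by (split; [apply Rdiv_le_0_compat; lra|apply Rlt_div_l; lra]).
    apply (max_modulus Phi r).
    - apply exp_pos.
    - intros w Hw. apply cdiff_mult; [auto|].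
      apply (cdiff_comp (fun w => (- (RtoC (/ (2 * PI)) * H0 w))%C) cexp); [apply cdiff_cexp|].
      apply cdiff_opp, cdiff_mult; [apply cdiff_const|].
      apply (cdiff_comp (fun w => (RtoC (x / r) * w)%C) (schwarz_int psi)).
      + apply (schwarz_cdiff psi (Rabs (psi 0) + Rabs L * 2)); auto.
        * intros t. replace (psi t) with (psi 0 + (psi t - psi 0)) by ring.
          eapply Rle_trans; [apply Rabs_triang|]. apply Rplus_le_compat_l.
          eapply Rle_trans; [apply HL|]. pose proof (chord_le_2 t 0). pose proof (chord_pos t 0).
          pose proof (Rle_abs L). pose proof (Rabs_pos L). nra.
        * rewrite Cmod_mult, Cmod_R, Rabs_right by (apply Rle_ge, Rdiv_le_0_compat; lra).
          apply Rle_lt_trans with (x / r * r); [apply Rmult_le_compat_l; auto; apply Rdiv_le_0_compat; lra|].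
          field_simplify; lra.
      + apply cdiff_mult; [apply cdiff_const|apply cdiff_id].
    - rewrite polar_Cmod_pos; nra.
    - intros w Hw. destruct (polar_surj w) as [t [_ ->]]. rewrite Hw, PhiM by lra.
      replace (x * r / r) with x by (field; lra).
      apply Rle_trans with (exp (psi t) * exp (- Pint x psi t)).
      + apply Rmult_le_compat_r; auto. left; apply exp_pos.
      + rewrite <- exp_plus. apply exp_mono.
        assert (U := Pint_chLip_upper x L psi t (eta / 2) ltac:(lra) ltac:(lra) HL).
        pose proof (Rle_abs (- (Pint x psi t - psi t))) as U2. rewrite Rabs_Ropp in U2.
        assert (L ^ 2 / (4 * (eta / 2)) * ((1 - x ^ 2) / x) <= eta / 2); [|lra].
        assert ((1 - x ^ 2) / x <= 4 * y) by (apply Rle_div_l; unfold x in *; nra).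
        apply Rle_trans with (L ^ 2 / (4 * (eta / 2)) * (4 * y)).
        { apply Rmult_le_compat_l; auto. apply Rdiv_le_0_compat; lra. }
        apply Rle_div_r in Y3; [|lra].
        replace (L ^ 2 / (4 * (eta / 2)) * (4 * y)) with (2 * (L ^ 2 * y) / eta) by (field; lra).
        apply Rle_div_l; [auto|]. nra. }
  rewrite PhiM in M by (split; [apply Rmult_le_pos; [lra|apply Rdiv_le_0_compat; lra]|];
    rewrite <- (Rmult_1_r r) at 2; apply Rmult_le_compat_l; [lra|apply Rle_div_l; lra]).
  replace (x * (r * (rho / x)) / r) with rho in M by (field; lra). fold P in M.
  assert (M2 : Cmod (f (polar (r * (rho / x)) s)) <= exp (P + eta)).
  { rewrite exp_plus. apply Rmult_le_reg_r with (exp (- P)); [apply exp_pos|].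
    eapply Rle_trans; [exact M|]. right. rewrite (Rmult_comm (exp P)), Rmult_assoc, <- exp_plus.
    replace (P + - P) with 0 by ring. rewrite exp_0. ring. }
  assert (D : Cmod (polar (r * (rho / x)) s - polar (r * rho) s) < d).
  { replace (polar (r * (rho / x)) s - polar (r * rho) s)%C with (polar (r * rho * (y / x)) s).
    - rewrite polar_Cmod_pos.
      + apply Rle_lt_trans with (r * (2 * y)).
        * rewrite Rmult_assoc. apply Rmult_le_compat_l; [lra|].
          assert (y / x <= 2 * y) by (apply Rle_div_l; nra).
          assert (0 <= y / x) by (apply Rdiv_le_0_compat; lra). nra.
        * apply Rle_div_r in Y4; [|lra]. nra.
      + apply Rmult_le_pos; [nra|]. apply Rdiv_le_0_compat; lra.
    - unfold polar, Cminus, Cplus, Copp; simpl. unfold x. apply injective_projections; simpl; field; lra. }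
  specialize (Hd1 _ D).
  pose proof (Cmod_triangle_minus (f (polar (r * rho) s)) (f (polar (r * (rho / x)) s))) as T.
  rewrite Cmod_minus_sym in T.
  assert (exp (P + eta) < exp (P + 2 * eta)) by (apply exp_increasing; lra). lra.
Qed.

(** * Submean and mean value properties of the logarithm of the modulus *)

Definition analytic_disc (f : C -> C) : Prop := forall w, Cmod w < 1 -> cdiff f w.

Lemma circle_bounded (g : C -> C) r : 0 <= r -> (forall w, Cmod w = r -> ccont g w) ->
  exists M, 0 < M /\ forall w, Cmod w = r -> Cmod (g w) <= M.
Proof.
  intros Hr Hg. pose proof PI_RGT_0.
  assert (K : forall t, continuous (fun t => Cmod (g (polar r t))) t).
  { intros t. apply continuous_eps. intros e He.
    destruct (circle_icont g r t t Hr Hg t ltac:(lra) e He) as [d [Hd H1]].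
    exists d; split; auto. intros y Hy. specialize (H1 y Hy). apply Rabs_def1.
    - pose proof (Cmod_triangle_minus (g (polar r y)) (g (polar r t))). lra.
    - pose proof (Cmod_triangle_minus (g (polar r t)) (g (polar r y))) as T.
      rewrite Cmod_minus_sym in T. lra. }
  destruct (continuity_ab_maj (fun t => Cmod (g (polar r t))) (- PI) PI ltac:(lra)) as [m [Hm _]].
  { intros t _. apply continuity_pt_filterlim, K. }
  exists (Cmod (g (polar r m)) + 1). split; [pose proof (Cmod_ge_0 (g (polar r m))); lra|].
  intros w Hw. destruct (polar_surj w) as [t [Ht ->]]. rewrite Hw. specialize (Hm t Ht). simpl in Hm. lra.
Qed.

Lemma analytic_lipschitz (f : C -> C) r : analytic_disc f -> 0 < r < 1 ->
  exists L, 0 <= L /\ forall s t, Cmod (f (polar r s) - f (polar r t)) <= L * chord s t.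
Proof.
  intros Hf Hr. set (r1 := (r + 1) / 2). assert (H1 : r < r1 < 1) by (unfold r1; lra).
  destruct (circle_bounded f r1) as [M [HM Hb]]; [lra| |].
  { intros w Hw. apply cdiff_ccont, Hf. lra. }
  assert (0 < (r1 - r) ^ 2) by (apply pow_lt; lra).
  exists (2 * M * r1 * r / (r1 - r) ^ 2). split.
  { apply Rdiv_le_0_compat; auto. repeat apply Rmult_le_pos; lra. }
  intros s t. eapply Rle_trans.
  - apply (cauchy_lipschitz f r r1 M); auto; try lra.
    + intros w Hw. apply Hf; lra.
    + rewrite polar_Cmod_pos; lra.
    + rewrite polar_Cmod_pos; lra.
  - right. rewrite (polar_split r s), (polar_split r t).
    replace (RtoC r * polar 1 s - RtoC r * polar 1 t)%C with (RtoC r * (polar 1 s - polar 1 t))%C by ring.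
    rewrite Cmod_mult, Cmod_R, Rabs_right by lra. fold (chord s t). field. lra.
Qed.

(** The floor [e] makes the logarithm Lipschitz on circles in spite of zeros, and subharmonicity
    survives because this is the maximum of log |f| and a constant. *)
Definition lnmax (f : C -> C) (e : R) (z : C) : R := ln (Rmax (Cmod (f z)) e).

Lemma ln_le_minus a b e : 0 < e -> e <= a -> e <= b -> ln a - ln b <= Rabs (a - b) / e.
Proof.
  intros He Ha Hb. rewrite <- ln_div by lra.
  assert (P : ln (a / b) <= a / b - 1).
  { pose proof (exp_ineq1_le (ln (a / b))) as X.
    rewrite exp_ln in X by (apply Rdiv_lt_0_compat; lra). lra. }
  eapply Rle_trans; [exact P|].
  replace (a / b - 1) with ((a - b) / b) by (field; lra).
  apply Rle_trans with (Rabs (a - b) / b).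
  - apply Rmult_le_compat_r; [left; apply Rinv_0_lt_compat; lra|apply Rle_abs].
  - apply Rmult_le_compat_l; [apply Rabs_pos|]. apply Rinv_le_contravar; lra.
Qed.

Lemma Rmax_lip a b e : Rabs (Rmax a e - Rmax b e) <= Rabs (a - b).
Proof.
  unfold Rmax. repeat destruct Rle_dec; unfold Rabs; repeat destruct Rcase_abs; lra.
Qed.

Lemma lnmax_chLip (f : C -> C) e r : analytic_disc f -> 0 < r < 1 -> 0 < e ->
  exists L, chLip L (fun t => lnmax f e (polar r t)).
Proof.
  intros Hf Hr He. destruct (analytic_lipschitz f r Hf Hr) as [L [HL0 HL]].
  exists (L / e).
  assert (K : forall s t, lnmax f e (polar r s) - lnmax f e (polar r t) <= L / e * chord s t).
  { intros s t. unfold lnmax.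
    eapply Rle_trans; [apply (ln_le_minus _ _ e He); apply Rmax_r|].
    replace (L / e * chord s t) with (L * chord s t / e) by (field; lra).
    apply Rmult_le_compat_r; [left; apply Rinv_0_lt_compat; lra|].
    eapply Rle_trans; [apply Rmax_lip|]. eapply Rle_trans; [|apply HL].
    apply Rabs_le. split.
    - pose proof (Cmod_triangle_minus (f (polar r t)) (f (polar r s))) as T.
      rewrite Cmod_minus_sym in T. lra.
    - pose proof (Cmod_triangle_minus (f (polar r s)) (f (polar r t))) as T. lra. }
  intros s t. apply Rabs_le. split; [|apply K].
  specialize (K t s). rewrite chord_sym in K. lra.
Qed.

Lemma lnmax_contR (f : C -> C) e r : analytic_disc f -> 0 < r < 1 -> 0 < e ->
  contR (fun t => lnmax f e (polar r t)).
Proof. intros Hf Hr He t. destruct (lnmax_chLip f e r Hf Hr He) as [L HL]. eapply chLip_cont; eauto. Qed.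

Lemma lnmax_submean (f : C -> C) e r rho s : analytic_disc f -> 0 < r < 1 -> 0 < e -> 0 <= rho < 1 ->
  lnmax f e (polar (r * rho) s) <= Pint rho (fun t => lnmax f e (polar r t)) s.
Proof.
  intros Hf Hr He Hrho. destruct (lnmax_chLip f e r Hf Hr He) as [L HL].
  assert (Hp : forall z, 0 < Rmax (Cmod (f z)) e) by (intros; pose proof (Rmax_r (Cmod (f z)) e); lra).
  unfold lnmax at 1. rewrite <- (ln_exp (Pint _ _ _)). apply ln_le; auto. apply Rmax_lub.
  - apply (poisson_jensen f _ L); auto; try lra.
    + intros w Hw. apply Hf; lra.
    + intros t. unfold lnmax. rewrite exp_ln by auto. apply Rmax_l.
  - rewrite <- (exp_ln e) at 1 by auto. apply exp_mono.
    rewrite <- (Pint_const rho (ln e) s Hrho). apply Pint_le; auto using contR_const.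
    + apply lnmax_contR; auto.
    + intros t. unfold lnmax. apply ln_le; auto. apply Rmax_r.
Qed.

Definition lnmod (f : C -> C) (z : C) : R := ln (Cmod (f z)).

(** By compactness [|f| >= / M] on the circle, so truncation at [/ M] changes nothing there. *)
Lemma lnmod_sub (f : C -> C) r rho s : analytic_disc f -> (forall z, Cmod z < 1 -> f z <> 0%C) ->
  0 < r < 1 -> 0 <= rho < 1 ->
  contR (fun t => lnmod f (polar r t)) /\
  lnmod f (polar (r * rho) s) <= Pint rho (fun t => lnmod f (polar r t)) s.
Proof.
  intros Hf H0 Hr Hrho.
  destruct (circle_bounded (fun w => (/ f w)%C) r) as [M [HM Hb]]; [lra| |].
  { intros w Hw. apply cdiff_ccont, cdiff_inv; [apply Hf|apply H0]; lra. }
  assert (He : 0 < / M) by (apply Rinv_0_lt_compat; auto).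
  assert (E : forall t, lnmax f (/ M) (polar r t) = lnmod f (polar r t)).
  { intros t. unfold lnmax, lnmod. f_equal. apply Rmax_left.
    assert (Hc : Cmod (polar r t) = r) by (apply polar_Cmod_pos; lra).
    specialize (Hb _ Hc). assert (Hn : f (polar r t) <> 0%C) by (apply H0; lra).
    rewrite Cmod_inv in Hb by auto. apply Cmod_gt_0 in Hn.
    rewrite <- (Rinv_inv (Cmod _)). apply Rinv_le_contravar; auto. apply Rinv_0_lt_compat; auto. }
  split.
  - intros t. apply continuous_ext with (fun t => lnmax f (/ M) (polar r t)); auto.
    apply lnmax_contR; auto.
  - apply Rle_trans with (lnmax f (/ M) (polar (r * rho) s)).
    + apply ln_le; [|apply Rmax_l]. apply Cmod_gt_0, H0. rewrite polar_Cmod_pos; nra.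
    + eapply Rle_trans; [apply lnmax_submean; auto|]. right. unfold Pint. f_equal.
      apply RI_ext. intros t. rewrite E. auto.
Qed.

(** The reverse inequality is [lnmod_sub] for [1 / f]. *)
Lemma lnmod_mean (f : C -> C) r rho s : analytic_disc f -> (forall z, Cmod z < 1 -> f z <> 0%C) ->
  0 < r < 1 -> 0 <= rho < 1 ->
  lnmod f (polar (r * rho) s) = Pint rho (fun t => lnmod f (polar r t)) s.
Proof.
  intros Hf H0 Hr Hrho. apply Rle_antisym; [apply lnmod_sub; auto|].
  assert (Hi : analytic_disc (fun w => (/ f w)%C)) by (intros w Hw; apply cdiff_inv; auto).
  assert (Hi0 : forall z, Cmod z < 1 -> (/ f z)%C <> 0%C).
  { intros z Hz. apply Cmod_gt_0. rewrite Cmod_inv by auto. apply Rinv_0_lt_compat, Cmod_gt_0; auto. }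
  assert (E : forall q t, 0 <= q < 1 -> lnmod (fun w => (/ f w)%C) (polar q t) = - 1 * lnmod f (polar q t)).
  { intros q t Hq. unfold lnmod. assert (N : f (polar q t) <> 0%C) by (apply H0; rewrite polar_Cmod_pos; lra).
    rewrite Cmod_inv, ln_Rinv; auto; [ring|]. apply Cmod_gt_0; auto. }
  destruct (lnmod_sub _ r rho s Hi Hi0 Hr Hrho) as [_ H]. rewrite E in H by nra.
  assert (E2 : Pint rho (fun t => lnmod (fun w => (/ f w)%C) (polar r t)) s = - 1 * Pint rho (fun t => lnmod f (polar r t)) s).
  { rewrite <- Pint_scal; auto; [|intros t; apply (lnmod_sub f r rho s); auto].
    unfold Pint. f_equal. apply RI_ext. intros t. rewrite E by lra. auto. }
  rewrite E2 in H. lra.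
Qed.

(** * Neighbourhoods of angular sets and coverings *)

(** For empty [E] the infimum is infinite and [real] returns a default value, whence the
    nonemptiness assumptions below. *)
Definition cdist (E : R -> Prop) (s : R) : R :=
  real (Glb_Rbar (fun y => exists x, E x /\ y = chord s x)).

Lemma cdist_glb E s : (exists x, E x) ->
  is_glb_Rbar (fun y => exists x, E x /\ y = chord s x) (cdist E s).
Proof.
  intros [x0 H0]. unfold cdist. pose proof (Glb_Rbar_correct (fun y => exists x, E x /\ y = chord s x)) as G.
  destruct (Glb_Rbar _) as [g| |]; simpl; auto; destruct G as [G1 G2].
  - destruct (G1 (chord s x0) (ex_intro _ x0 (conj H0 eq_refl))).
  - assert (X : Rbar_le 0 m_infty); [|destruct X].
    apply G2. intros y [x [_ ->]]. apply chord_pos.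
Qed.

Lemma cdist_le E s x : E x -> cdist E s <= chord s x.
Proof. intros H. destruct (cdist_glb E s (ex_intro _ x H)) as [G _]. apply (G (chord s x)). eauto. Qed.

Lemma cdist_approx E s eta : (exists x, E x) -> 0 < eta -> exists x, E x /\ chord s x < cdist E s + eta.
Proof.
  intros He H0. destruct (cdist_glb E s He) as [_ G].
  apply NNPP. intros N. specialize (G (cdist E s + eta)).
  assert (X : Rbar_le (cdist E s + eta) (cdist E s)); [|simpl in X; lra].
  apply G. intros y [x [Hx ->]]. simpl. destruct (Rle_lt_dec (cdist E s + eta) (chord s x)); auto.
  exfalso; apply N; eauto.
Qed.

Lemma cdist_ge0 E s : (exists x, E x) -> 0 <= cdist E s.
Proof.
  intros He. destruct (cdist_glb E s He) as [_ G]. apply (G 0).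
  intros y [x [_ ->]]. apply chord_pos.
Qed.

Lemma cdist_lip E s t : (exists x, E x) -> cdist E s <= cdist E t + chord s t.
Proof.
  intros He. apply le_epsilon. intros eta Heta.
  destruct (cdist_approx E t eta He Heta) as [x [Hx H1]].
  pose proof (cdist_le E s x Hx). pose proof (chord_tri s t x). lra.
Qed.

(** Lipschitz cutoff: 1 up to distance [t] from [E], 0 from distance [2 * t] on. *)
Definition cut (E : R -> Prop) (t s : R) : R := Rmax 0 (Rmin 1 (2 - cdist E s / t)).

Lemma cut_bound E t s : 0 <= cut E t s <= 1.
Proof. unfold cut. split; [apply Rmax_l|]. apply Rmax_lub; [lra|apply Rmin_l]. Qed.

Lemma cut_one E t s : 0 < t -> cdist E s <= t -> cut E t s = 1.
Proof.
  intros Ht H. unfold cut. assert (cdist E s / t <= 1) by (apply Rle_div_l; lra).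
  rewrite Rmin_left, Rmax_right; lra.
Qed.

Lemma cut_supp E t s : 0 < t -> 0 < cut E t s -> cdist E s < 2 * t.
Proof.
  intros Ht H. destruct (Rlt_le_dec (cdist E s) (2 * t)) as [|G]; auto. exfalso.
  unfold cut in H. assert (2 <= cdist E s / t) by (apply Rle_div_r; lra).
  rewrite Rmin_right, Rmax_left in H; lra.
Qed.

Lemma cut_lip_dist E t s1 s2 c : 0 < t -> cdist E s1 <= cdist E s2 + c -> 0 <= c -> cut E t s2 <= cut E t s1 + c / t.
Proof.
  intros Ht H Hc. unfold cut.
  assert (cdist E s1 / t <= cdist E s2 / t + c / t).
  { unfold Rdiv. rewrite <- Rmult_plus_distr_r. apply Rmult_le_compat_r; auto. left; apply Rinv_0_lt_compat; auto. }
  assert (0 <= c / t) by (apply Rdiv_le_0_compat; auto).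
  unfold Rmax, Rmin. repeat destruct Rle_dec; lra.
Qed.

Lemma cut_chLip E t : (exists x, E x) -> 0 < t -> chLip (/ t) (cut E t).
Proof.
  intros He Ht.
  assert (K : forall s1 s2, cut E t s2 - cut E t s1 <= / t * chord s1 s2).
  { intros s1 s2. pose proof (cut_lip_dist E t s1 s2 (chord s1 s2) Ht (cdist_lip E s1 s2 He) (chord_pos _ _)).
    unfold Rdiv in *. lra. }
  intros s1 s2. apply Rabs_le. pose proof (K s1 s2). pose proof (K s2 s1). rewrite (chord_sym s2 s1) in *. lra.
Qed.

Lemma cut_contR E t : (exists x, E x) -> 0 < t -> contR (cut E t).
Proof. intros He Ht s. eapply chLip_cont, cut_chLip; auto. Qed.

Lemma cut_mono E t' t s : (exists x, E x) -> 0 < t' <= t -> cut E t' s <= cut E t s.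
Proof.
  intros He Ht. unfold cut. apply Rle_max_compat_l, Rle_min_compat_l.
  assert (cdist E s / t <= cdist E s / t'); [|lra].
  apply Rmult_le_compat_l; [apply cdist_ge0; auto|]. apply Rinv_le_contravar; lra.
Qed.

(** Substitute for the measure of a neighbourhood of [E], lying between those at distances [t] and
    [2 * t]. *)
Definition bmass (E : R -> Prop) (t : R) : R := RInt (cut E t) 0 (2 * PI).

Lemma bmass_pos E t : (exists x, E x) -> 0 < t -> 0 <= bmass E t.
Proof.
  intros He Ht. pose proof two_PI_pos. apply RI_nonneg; [lra|apply cut_contR; auto|apply cut_bound].
Qed.

Lemma bmass_mono E t' t : (exists x, E x) -> 0 < t' <= t -> bmass E t' <= bmass E t.
Proof.
  intros He Ht. pose proof two_PI_pos. apply RI_le; try lra; try (apply cut_contR; auto; lra).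
  intros; apply cut_mono; auto.
Qed.

Lemma RI_ge_const f c a b : a <= b -> contR f -> (forall x, a < x < b -> c <= f x) -> (b - a) * c <= RInt f a b.
Proof.
  intros Hab Hf H. rewrite <- RI_const.
  apply RInt_le; auto; apply ex_RInt_all; auto; apply contR_const.
Qed.

Lemma bmass_le E t : (exists x, E x) -> 0 < t -> bmass E t <= 2 * PI.
Proof.
  intros He Ht. pose proof two_PI_pos. unfold bmass.
  apply Rle_trans with (RInt (V := R_CompleteNormedModule) (fun _ => 1) 0 (2 * PI)).
  - apply RI_le; [lra|apply cut_contR; auto|apply contR_const|intros; apply cut_bound].
  - rewrite RI_const. lra.
Qed.

(** Fubini and the symmetry of the kernel; this moves the averaging between a cutoff and the
    log-modulus. *)
Lemma Pint_adjoint rho f g : 0 <= rho < 1 -> contR f -> contR g ->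
  RInt (fun s => f s * Pint rho g s) 0 (2 * PI) = RInt (fun t => Pint rho f t * g t) 0 (2 * PI).
Proof.
  intros Hr Hf Hg. pose proof two_PI_pos as HPI.
  assert (K : cont2 (fun s t => f s * (PK rho (s - t) * g t))).
  { apply cont2_mult; [apply cont2_const_l; auto|].
    apply cont2_mult; [apply PK_cont; auto|apply cont2_const_r; auto]. }
  assert (E1 : RInt (fun s => f s * Pint rho g s) 0 (2 * PI) =
     / (2 * PI) * RInt (fun s => RInt (fun t => f s * (PK rho (s - t) * g t)) 0 (2 * PI)) 0 (2 * PI)).
  { rewrite <- RI_scal by (intros s; apply (RInt_param_cont (fun s t => f s * (PK rho (s - t) * g t))); [lra|auto]).
    apply RI_ext. intros s. rewrite RI_scal by (apply contR_mult; auto; apply contR_PK; auto).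
    unfold Pint. field. lra. }
  assert (E2 : RInt (fun t => Pint rho f t * g t) 0 (2 * PI) =
     / (2 * PI) * RInt (fun t => RInt (fun s => f s * (PK rho (s - t) * g t)) 0 (2 * PI)) 0 (2 * PI)).
  { rewrite <- RI_scal by (intros t; apply (RInt_param_cont (fun t s => f s * (PK rho (s - t) * g t))); [lra|apply (cont2_swap _ K)]).
    apply RI_ext. intros t.
    rewrite (RI_ext (fun s => f s * (PK rho (s - t) * g t)) (fun s => g t * (PK rho (t - s) * f s)))
      by (intros s; rewrite (PK_sym rho s t); ring).
    rewrite RI_scal by (apply contR_mult; auto; apply contR_PK; auto).
    unfold Pint. field. lra. }
  rewrite E1, E2. f_equal.
  apply (RInt_fubini (fun s t => f s * (PK rho (s - t) * g t))); auto; lra.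
Qed.

Lemma Pint_contR rho f : 0 <= rho < 1 -> contR f -> contR (Pint rho f).
Proof.
  intros Hr Hf s. unfold Pint, Rdiv. apply cont_mult; [|apply continuous_const].
  pose proof two_PI_pos.
  apply (RInt_param_cont (fun s t => PK rho (s - t) * f t)); [lra|].
  apply cont2_mult; [apply PK_cont; auto|apply cont2_const_r; auto].
Qed.

(** * Finite sums, enumeration of pairs, and series of nonnegative terms *)

Fixpoint psum (f : nat -> R) (n : nat) : R := match n with O => 0 | S n => psum f n + f n end.

Lemma psum_le f g n : (forall i, (i < n)%nat -> f i <= g i) -> psum f n <= psum g n.
Proof. induction n; simpl; intros H; [lra|]. apply Rplus_le_compat; auto. Qed.

Lemma psum_ext f g n : (forall i, (i < n)%nat -> f i = g i) -> psum f n = psum g n.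
Proof. induction n; simpl; intros H; auto. rewrite IHn, H; auto. Qed.

Lemma psum_nonneg f n : (forall i, (i < n)%nat -> 0 <= f i) -> 0 <= psum f n.
Proof. induction n; simpl; intros H; [lra|]. specialize (H n ltac:(lia)) as H1. specialize (IHn ltac:(auto)). lra. Qed.

Lemma psum_single f n j : (forall i, 0 <= f i) -> (j < n)%nat -> f j <= psum f n.
Proof.
  intros H. induction n; simpl; intros Hj; [lia|].
  pose proof (psum_nonneg f n (fun i _ => H i)). pose proof (H n).
  destruct (Nat.eq_dec j n) as [->|]; [lra|]. specialize (IHn ltac:(lia)). lra.
Qed.

Lemma psum_scal c f n : psum (fun i => c * f i) n = c * psum f n.
Proof. induction n; simpl; [ring|]. rewrite IHn. ring. Qed.

Lemma psum_plus f g n : psum (fun i => f i + g i) n = psum f n + psum g n.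
Proof. induction n; simpl; [ring|]. rewrite IHn. ring. Qed.

Lemma psum_swap f n m : psum (fun i => psum (fun j => f i j) m) n = psum (fun j => psum (fun i => f i j) n) m.
Proof.
  induction n; simpl.
  - symmetry. induction m; simpl; [auto|]. rewrite IHm. ring.
  - rewrite IHn, <- psum_plus. auto.
Qed.

Lemma psum_delta j n : psum (fun i => if Nat.eq_dec i j then 1 else 0) n = if lt_dec j n then 1 else 0.
Proof.
  induction n; simpl; [destruct (lt_dec j 0); [lia|auto]|]. rewrite IHn.
  destruct (Nat.eq_dec n j), (lt_dec j n), (lt_dec j (S n)); try lia; lra.
Qed.

Lemma psum_tail_zero f n N : (forall i, (N <= i)%nat -> f i = 0) -> (forall i, 0 <= f i) -> psum f n <= psum f N.
Proof.
  intros H H0. induction n; simpl; [apply psum_nonneg; auto|].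
  destruct (le_lt_dec N n) as [Hn|Hn]; [rewrite (H n Hn); lra|].
  clear IHn. replace N with (S n + (N - S n))%nat by lia. generalize (N - S n)%nat as k.
  induction k; [rewrite Nat.add_0_r; simpl; lra|]. rewrite Nat.add_succ_r. simpl in *. specialize (H0 (S (n + k))). lra.
Qed.

Lemma psum_half (n : nat) : psum (fun m => / 2 ^ (S m)) n <= 1.
Proof.
  assert (psum (fun m => / 2 ^ (S m)) n = 1 - / 2 ^ n).
  { induction n; cbn [psum]; [simpl; field|]. rewrite IHn. assert (0 < 2 ^ n) by (apply pow_lt; lra). simpl; field; lra. }
  rewrite H. assert (0 < / 2 ^ n) by (apply Rinv_0_lt_compat, pow_lt; lra). lra.
Qed.

(** The first [K] pairs lie in a square of side [M]. Each term is dominated by a sum over the square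
    with an indicator of the index; after interchanging the sums, every pair is met at most once. *)
Lemma psum_pairs (g : nat -> nat -> R) B K : (forall m i, 0 <= g m i) ->
  (forall M, psum (fun m => psum (g m) M) M <= B) ->
  psum (fun n => g (fst (Cantor.of_nat n)) (snd (Cantor.of_nat n))) K <= B.
Proof.
  intros H0 HB.
  assert (exists M, forall n, (n < K)%nat -> (fst (Cantor.of_nat n) < M)%nat /\ (snd (Cantor.of_nat n) < M)%nat) as [M HM].
  { induction K; [exists O; intros; lia|]. destruct IHK as [M HM].
    exists (M + S (fst (Cantor.of_nat K) + snd (Cantor.of_nat K)))%nat. intros n Hn.
    destruct (Nat.eq_dec n K) as [->|]; [lia|]. specialize (HM n ltac:(lia)). lia. }
  apply Rle_trans with (psum (fun n => psum (fun m => psum (fun i =>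
     g m i * (if Nat.eq_dec n (Cantor.to_nat (m, i)) then 1 else 0)) M) M) K).
  - apply psum_le. intros n Hn. destruct (HM n Hn) as [H1 H2].
    set (p := Cantor.of_nat n) in *.
    assert (Hp : n = Cantor.to_nat (fst p, snd p)).
    { rewrite <- surjective_pairing. symmetry. apply Cantor.cancel_to_of. }
    assert (P0 : forall m i, 0 <= g m i * (if Nat.eq_dec n (Cantor.to_nat (m, i)) then 1 else 0)).
    { intros. specialize (H0 m i). destruct (Nat.eq_dec n (Cantor.to_nat (m, i))); lra. }
    eapply Rle_trans; [|apply (psum_single (fun m => psum (fun i =>
      g m i * (if Nat.eq_dec n (Cantor.to_nat (m, i)) then 1 else 0)) M) M (fst p)); auto].
    2: intros; apply psum_nonneg; auto.
    eapply Rle_trans; [|apply (psum_single (fun i =>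
      g (fst p) i * (if Nat.eq_dec n (Cantor.to_nat (fst p, i)) then 1 else 0)) M (snd p)); auto].
    cbv beta.
    destruct (Nat.eq_dec n (Cantor.to_nat (fst p, snd p))); [lra|congruence].
  - rewrite psum_swap. eapply Rle_trans; [|apply (HB M)]. apply psum_le. intros m _.
    rewrite psum_swap. apply psum_le. intros i _. rewrite psum_scal, psum_delta.
    specialize (H0 m i). destruct (lt_dec (Cantor.to_nat (m, i)) K); lra.
Qed.

Lemma series_bounded (a : nat -> R) B : (forall n, 0 <= a n) -> (forall n, psum a n <= B) ->
  ex_series a /\ Series a <= B.
Proof.
  intros H0 HB.
  assert (E : forall n, sum_n a n = psum a (S n)).
  { induction n; [rewrite sum_O; simpl; ring|]. rewrite sum_Sn, IHn. reflexivity. }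
  assert (HB' : forall n, sum_n a n <= B) by (intros; rewrite E; auto).
  destruct (ex_finite_lim_seq_incr (sum_n a) B) as [l Hl]; auto.
  { intros n. rewrite sum_Sn. unfold plus; simpl. specialize (H0 (S n)). lra. }
  assert (Hs : is_series a l) by exact Hl.
  split; [exists l; auto|]. rewrite (is_series_unique _ _ Hs).
  apply (is_lim_seq_le (sum_n a) (fun _ => B) l B HB' Hl (is_lim_seq_const B)).
Qed.

Lemma series_nonneg (a : nat -> R) : (forall n, 0 <= a n) -> ex_series a -> 0 <= Series a.
Proof.
  intros H0 Hex. pose proof (Series_correct a Hex) as Hs.
  apply (is_lim_seq_le (fun _ => 0) (sum_n a) 0 (Series a)); [|apply is_lim_seq_const|exact Hs].
  induction n; [rewrite sum_O; auto|]. rewrite sum_Sn. unfold plus; simpl. specialize (H0 (S n)). lra.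
Qed.

(** * Coverings by equal arcs and vanishing Hausdorff measure *)

Definition meets (E : R -> Prop) (a l : R) : Prop := exists s, E s /\ a <= s <= a + l.
Definition meetsR (E : R -> Prop) (a l : R) : R := if excluded_middle_informative (meets E a l) then 1 else 0.
Definition arc_count (E : R -> Prop) (tau : R) (N : nat) : R := psum (fun i => meetsR E (INR i * tau) tau) N.

Lemma meetsR_bound E a l : 0 <= meetsR E a l <= 1.
Proof. unfold meetsR. destruct excluded_middle_informative; lra. Qed.

Lemma find_arc tau s N : 0 < tau -> 0 <= s -> s < INR N * tau ->
  exists i, (i < N)%nat /\ INR i * tau <= s <= INR i * tau + tau.
Proof.
  intros Ht Hs. induction N as [|N IH]; intros H.
  - simpl in H. lra.
  - destruct (Rlt_le_dec s (INR N * tau)) as [L|L].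
    + destruct (IH L) as [i [Hi H1]]. exists i; split; auto.
    + exists N. rewrite S_INR in H. split; [lia|]. lra.
Qed.

Definition small_covers (lam : R -> R) (E : R -> Prop) : Prop :=
  forall eps eta, 0 < eps -> 0 < eta -> exists (N : nat) (tau : R),
    0 < tau < eps /\ tau <= 2 * PI /\ INR N * tau = 2 * PI /\ arc_count E tau N * lam tau <= eta.

(** Countable subadditivity: the [m]-th set receives the budget [eta / 2^(m+1)], and arcs that miss
    it are shrunk to length 0, where [lam] is 0. *)
Lemma hausdorff_zero (lam : R -> R) (S0 : R -> Prop) (E : nat -> R -> Prop) :
  (forall t, 0 <= t < 1 -> 0 <= lam t) -> lam 0 = 0 ->
  (forall s, S0 s -> exists m, E m s) -> (forall m s, E m s -> 0 <= s < 2 * PI) ->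
  (forall m, small_covers lam (E m)) -> Hausdorff lam S0 = Finite 0.
Proof.
  intros Hnn H0 HS HE Hc.
  assert (HC : forall eps, 0 < eps <= 1 -> H_content lam eps S0 = Finite 0).
  { intros eps Heps. unfold H_content. apply is_glb_Rbar_unique. split.
    - intros x (a & l & Hl & _ & Hx). unfold nn_series_Rbar in Hx.
      destruct excluded_middle_informative as [Hex|]; [|discriminate]. rewrite Hx. simpl.
      apply series_nonneg; auto. intros n. apply Hnn. specialize (Hl n). lra.
    - intros b Hb. 
      assert (K : forall eta, 0 < eta -> exists x, x <= eta /\ cover_values lam eps S0 (Finite x)).
      { intros eta Heta.
        assert (Heta' : forall m, 0 < eta * / 2 ^ (S m)).
        { intros m. apply Rmult_lt_0_compat; auto. apply Rinv_0_lt_compat, pow_lt; lra. }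
        assert (Ch : forall m, {p : nat * R | 0 < snd p < eps /\ snd p <= 2 * PI /\ INR (fst p) * snd p = 2 * PI /\
           arc_count (E m) (snd p) (fst p) * lam (snd p) <= eta * / 2 ^ (S m)}).
        { intros m. apply constructive_indefinite_description.
          destruct (Hc m eps (eta * / 2 ^ (S m)) ltac:(lra) (Heta' m)) as (N & tau & H). exists (N, tau). exact H. }
        set (N := fun m => fst (proj1_sig (Ch m))). set (tau := fun m => snd (proj1_sig (Ch m))).
        assert (P : forall m, 0 < tau m < eps /\ tau m <= 2 * PI /\ INR (N m) * tau m = 2 * PI /\
           arc_count (E m) (tau m) (N m) * lam (tau m) <= eta * / 2 ^ (S m)) by (intros m; exact (proj2_sig (Ch m))).
        set (len := fun m i => if lt_dec i (N m) then (if excluded_middle_informative (meets (E m) (INR i * tau m) (tau m)) then tau m else 0) else 0).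
        set (a := fun n => INR (snd (Cantor.of_nat n)) * tau (fst (Cantor.of_nat n))).
        set (l := fun n => len (fst (Cantor.of_nat n)) (snd (Cantor.of_nat n))).
        assert (Hlen : forall m i, 0 <= len m i /\ len m i < eps /\ len m i <= 2 * PI).
        { intros m i. destruct (P m) as (P1 & P2 & _). unfold len.
          destruct lt_dec; [destruct excluded_middle_informative|]; lra. }
        assert (Hg : forall m i, 0 <= lam (len m i)).
        { intros m i. apply Hnn. specialize (Hlen m i). lra. }
        assert (Hsum : forall n, psum (fun n => lam (l n)) n <= eta).
        { intros n. apply (psum_pairs (fun m i => lam (len m i)) eta n Hg). intros M.
          apply Rle_trans with (psum (fun m => eta * / 2 ^ (S m)) M).
          - apply psum_le. intros m _. destruct (P m) as (P1 & P2 & P3 & P4).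
            eapply Rle_trans; [|exact P4].
            eapply Rle_trans; [apply (psum_tail_zero _ M (N m)); auto|].
            + intros i Hi. unfold len. destruct lt_dec; [lia|auto].
            + right. unfold arc_count. rewrite Rmult_comm, <- psum_scal. apply psum_ext. intros i Hi.
              unfold len, meetsR. destruct lt_dec; [|lia]. destruct excluded_middle_informative; rewrite ?H0; ring.
          - rewrite psum_scal. pose proof (psum_half M). nra. }
        destruct (series_bounded (fun n => lam (l n)) eta (fun n => Hg _ _) Hsum) as [Hex Hle].
        exists (Series (fun n => lam (l n))). split; auto.
        exists a, l. split; [intros n; apply Hlen|]. split.
        - intros s Hs. destruct (HS s Hs) as [m Hm]. destruct (P m) as (P1 & P2 & P3 & P4).
          destruct (find_arc (tau m) s (N m)) as [i [Hi H1]]; try (specialize (HE m s Hm); lra).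
          exists (Cantor.to_nat (m, i)). unfold a, l. rewrite Cantor.cancel_of_to. simpl.
          exists 0%Z. unfold len. destruct lt_dec; [|lia].
          destruct excluded_middle_informative as [|Nm]; [lra|]. exfalso. apply Nm. exists s. auto.
        - unfold nn_series_Rbar. destruct excluded_middle_informative; [auto|contradiction]. }
      destruct b as [b| |]; simpl; auto.
      + apply le_epsilon. intros e He. destruct (K e He) as [x [Hx1 Hx2]].
        specialize (Hb x Hx2). simpl in Hb. lra.
      + destruct (K 1 Rlt_0_1) as [x [Hx1 Hx2]]. exact (Hb x Hx2). }
  unfold Hausdorff. apply is_lub_Rbar_unique. split.
  - intros x [eps [He Hx]]. rewrite HC in Hx by auto. rewrite Hx. simpl; lra.
  - intros b Hb. apply Hb. exists 1. split; [lra|]. rewrite HC by lra. auto.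
Qed.

(** An arc of length at most [t] that meets [E] lies where the cutoff equals 1, and the arcs do not
    overlap. *)
Lemma arc_count_bmass E tau t N : (exists x, E x) -> 0 < tau <= t -> INR N * tau = 2 * PI ->
  tau * arc_count E tau N <= bmass E t.
Proof.
  (* The upper limit is expressed through [N], so that the induction can run over partial
     tilings. *)
  intros He Ht HN. unfold bmass. rewrite <- HN. clear HN.
  assert (Hc : contR (cut E t)) by (apply cut_contR; auto; lra).
  induction N as [|N IH].
  - simpl. rewrite Rmult_0_l. unfold arc_count; simpl. rewrite (RInt_point (V := R_CompleteNormedModule)).
    unfold zero; simpl. lra.
  - rewrite S_INR. replace ((INR N + 1) * tau) with (INR N * tau + tau) by ring.
    rewrite <- (RInt_Chasles (V := R_CompleteNormedModule) (cut E t) 0 (INR N * tau)) by (apply ex_RInt_all; auto).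
    unfold arc_count in *. simpl psum. rewrite Rmult_plus_distr_l. unfold plus; simpl.
    apply Rplus_le_compat; auto.
    unfold meetsR. destruct excluded_middle_informative as [[s [Hs H1]]|].
    + apply Rle_trans with ((INR N * tau + tau - INR N * tau) * 1); [lra|].
      apply RI_ge_const; auto; [lra|]. intros x Hx. rewrite cut_one; [lra|lra|].
      apply Rle_trans with (chord x s); [apply cdist_le; auto|].
      eapply Rle_trans; [apply chord_le|]. apply Rabs_le. lra.
    + rewrite Rmult_0_r. apply RI_nonneg; auto; [lra|]. intros; apply cut_bound.
Qed.

Lemma nat_above x : exists N : nat, x < INR N <= Rmax x 0 + 1.
Proof.
  destruct (archimed (Rmax x 0)) as [H1 H2].
  assert (0 <= up (Rmax x 0))%Z by (apply le_IZR; pose proof (Rmax_r x 0); lra).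
  exists (Z.to_nat (up (Rmax x 0))). rewrite INR_IZR_INZ, Z2Nat.id by auto.
  pose proof (Rmax_l x 0). lra.
Qed.

(** At stage [k] the arc count times [tau] is at most [C0 * q ^ k], while [|log tau|] is of order
    [A ^ k]. For omega = - log q / log A these powers cancel and leave a constant times the
    arbitrarily small factor supplied by the hypothesis on [lam]. *)
Lemma small_covers_of_decay (lam : R -> R) (E : R -> Prop) A q C0 tau0 :
  (forall omega, 0 < omega -> forall d, 0 < d -> exists eta, 0 < eta /\
     forall t, 0 < t < eta -> Rabs (lam t) <= d * (t * Rpower (Rabs (ln t)) omega)) ->
  1 < A -> 0 < q < 1 -> 0 < C0 -> 0 < tau0 ->
  ((exists x, E x) -> forall k : nat, bmass E (exp (- (tau0 * A ^ k))) <= C0 * q ^ k) ->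
  small_covers lam E.
Proof.
  intros Hlam HA Hq HC Htau Hb eps eta Heps Heta. pose proof PI_RGT_0 as HPI. pose proof PI2_1 as HPI2.
  (* Rounding [t] down to an exact divisor of [2 * PI] loses at most a factor 2. *)
  assert (Split : forall t, 0 < t <= 1 -> exists (N : nat) tau, INR N * tau = 2 * PI /\ t / 2 <= tau <= t /\ 0 < tau).
  { intros t Ht. destruct (nat_above (2 * PI / t)) as [N HN].
    assert (P : 0 < 2 * PI / t) by (apply Rdiv_lt_0_compat; lra).
    rewrite Rmax_left in HN by lra.
    assert (P1 : 2 * PI < INR N * t) by (apply Rlt_div_l; lra).
    assert (P2 : INR N * t <= 2 * PI + t).
    { replace (2 * PI + t) with ((2 * PI / t + 1) * t) by (field; lra). apply Rmult_le_compat_r; lra. }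
    exists N, (2 * PI / INR N). repeat split.
    - field. lra.
    - apply Rmult_le_reg_r with (INR N); [lra|]. replace (2 * PI / INR N * INR N) with (2 * PI) by (field; lra). lra.
    - apply Rmult_le_reg_r with (INR N); [lra|]. replace (2 * PI / INR N * INR N) with (2 * PI) by (field; lra). lra.
    - apply Rdiv_lt_0_compat; lra. }
  destruct (classic (exists x, E x)) as [He|He].
  - specialize (Hb He).
    set (om := - ln q / ln A).
    assert (LA : 0 < ln A) by (rewrite <- ln_1; apply ln_increasing; lra).
    assert (Lq : ln q < 0) by (rewrite <- ln_1; apply ln_increasing; lra).
    assert (Hom : 0 < om) by (apply Rdiv_lt_0_compat; lra).
    assert (L2 : 0 < ln 2) by (rewrite <- ln_1; apply ln_increasing; lra).
    set (R0 := Rpower (tau0 + ln 2) om).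
    assert (HR0 : 0 < R0) by apply exp_pos.
    assert (CR : 0 < C0 * R0) by (apply Rmult_lt_0_compat; auto).
    destruct (Hlam om Hom (eta / (C0 * R0))) as [e1 [He1 HL]]; [apply Rdiv_lt_0_compat; lra|].
    set (m := Rmin (Rmin 1 (eps / 2)) (e1 / 2)).
    assert (Hm : 0 < m) by (unfold m; repeat apply Rmin_glb_lt; lra).
    assert (Hm1 : m <= 1 /\ m <= eps / 2 /\ m <= e1 / 2).
    { unfold m. repeat split; [eapply Rle_trans; [apply Rmin_l|apply Rmin_l]|eapply Rle_trans; [apply Rmin_l|apply Rmin_r]|apply Rmin_r]. }
    destruct (Pow_x_infinity A ltac:(rewrite Rabs_right; lra) (- ln m / tau0)) as [k Hk].
    specialize (Hk k (Nat.le_refl k)).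
    assert (PA : 1 <= A ^ k) by (apply pow_R1_Rle; lra). rewrite Rabs_right in Hk by lra.
    apply Rge_le, Rle_div_l in Hk; auto.
    set (t := exp (- (tau0 * A ^ k))).
    assert (Ht : 0 < t) by apply exp_pos.
    assert (Htm : t <= m).
    { rewrite <- (exp_ln m) by auto. apply exp_mono. lra. }
    destruct (Split t ltac:(lra)) as (N & tau & HN & Hta & Hta0).
    exists N, tau. repeat split; try lra.
    pose proof (arc_count_bmass E tau t N He ltac:(lra) HN) as B1. specialize (Hb k). fold t in Hb.
    specialize (HL tau ltac:(lra)).
    assert (Cn : 0 <= arc_count E tau N) by (apply psum_nonneg; intros; apply meetsR_bound).
    apply Rle_trans with (arc_count E tau N * (eta / (C0 * R0) * (tau * Rpower (Rabs (ln tau)) om))).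
    { apply Rmult_le_compat_l; auto. eapply Rle_trans; [apply Rle_abs|exact HL]. }
    set (Rp := Rpower (Rabs (ln tau)) om) in *.
    assert (HRp : 0 < Rp) by apply exp_pos.
    assert (HRp2 : Rp * q ^ k <= R0).
    { assert (Ltau : ln t - ln 2 <= ln tau <= ln t).
      { split; [rewrite <- ln_div by lra; apply ln_le; lra|apply ln_le; lra]. }
      unfold t in Ltau. rewrite ln_exp in Ltau.
      assert (T1 : 0 < tau0 * A ^ k) by (apply Rmult_lt_0_compat; lra).
      assert (Lm : ln tau < 0) by lra.
      assert (Hle : Rabs (ln tau) <= (tau0 + ln 2) * A ^ k).
      { rewrite Rabs_left by auto. nra. }
      assert (Rp <= R0 * Rpower (A ^ k) om).
      { unfold R0. rewrite Rpower_mult_distr by lra. apply Rle_Rpower_l; [lra|].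
        split; auto. apply Rabs_pos_lt. lra. }
      assert (EA : Rpower (A ^ k) om * q ^ k = 1).
      { rewrite <- (Rpower_pow k A), <- (Rpower_pow k q), Rpower_mult by lra. unfold Rpower.
        rewrite <- exp_plus. replace (INR k * om * ln A + INR k * ln q) with 0; [apply exp_0|].
        unfold om. field. lra. }
      assert (Qk : 0 < q ^ k) by (apply pow_lt; lra).
      apply Rle_trans with (R0 * Rpower (A ^ k) om * q ^ k); [apply Rmult_le_compat_r; lra|].
      rewrite Rmult_assoc, EA. lra. }
    replace (arc_count E tau N * (eta / (C0 * R0) * (tau * Rp))) with (eta / (C0 * R0) * ((tau * arc_count E tau N) * Rp)) by ring.
    apply Rle_trans with (eta / (C0 * R0) * (C0 * R0)); [|right; field; lra].
    apply Rmult_le_compat_l; [left; apply Rdiv_lt_0_compat; lra|].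
    apply Rle_trans with (C0 * q ^ k * Rp); [apply Rmult_le_compat_r; lra|]. nra.
  - destruct (Split (Rmin 1 (eps / 2))) as (N & tau & HN & Hta & Hta0).
    { split; [apply Rmin_glb_lt; lra|apply Rmin_l]. }
    pose proof (Rmin_l 1 (eps / 2)). pose proof (Rmin_r 1 (eps / 2)).
    exists N, tau. repeat split; try lra.
    replace (arc_count E tau N) with 0; [lra|]. symmetry. unfold arc_count.
    rewrite (psum_ext _ (fun _ => 0 * 0)); [rewrite psum_scal; ring|].
    intros i _. unfold meetsR. destruct excluded_middle_informative as [[s [Hs _]]|]; [|ring].
    exfalso; eauto.
Qed.

(** * Radial decay *)

(** For [r = rad s] the denominator |log (1 - r)| of the growth ratio is [s] itself. *)
Definition rad (s : R) : R := 1 - exp (- s).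

Definition growth_bound (f : C -> C) (K s1 : R) : Prop :=
  analytic_disc f /\ forall s w, s1 <= s -> Cmod w = rad s -> Cmod (f w) <= exp (K * s).

Lemma rad_bound s : 0 < s -> 0 < rad s < 1.
Proof.
  intros H. unfold rad. pose proof (exp_pos (- s)).
  assert (exp (- s) < 1) by (rewrite <- exp_0; apply exp_increasing; lra). lra.
Qed.

Lemma exp_neg_half s : 1 <= s -> exp (- s) <= / 2.
Proof.
  intros H. rewrite exp_Ropp. apply Rinv_le_contravar; [lra|].
  pose proof (exp_ineq1_le s). lra.
Qed.

Lemma rad_half s : 1 <= s -> / 2 <= rad s.
Proof. intros H. unfold rad. pose proof (exp_neg_half s H). lra. Qed.

Lemma ln2_bound : 0 < ln 2 <= 1.
Proof.
  split; [rewrite <- ln_1; apply ln_increasing; lra|].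
  rewrite <- (ln_exp 1). apply ln_le; [lra|]. pose proof (exp_ineq1_le 1). lra.
Qed.

(** The additional 1 in [K] yields a factor [exp s], which absorbs the multiplicative constant once
    [s >= 1 + Rabs C0]. *)
Lemma korenblum_growth (f : C -> C) : Korenblum f -> exists K s1, 1 <= K /\ 1 <= s1 /\ growth_bound f K s1.
Proof.
  intros [Ha [C0 [k Hk]]].
  exists (Rabs k + 1), (1 + Rabs C0). pose proof (Rabs_pos k). pose proof (Rabs_pos C0).
  repeat split; try lra.
  - intros w Hw. apply ex_derive_cdiff, Ha. exact Hw.
  - intros s w Hs Hw. pose proof (rad_bound s ltac:(lra)) as Hr.
    eapply Rle_trans; [apply Hk; unfold in_disc; lra|]. rewrite Hw. unfold rad.
    replace (1 - (1 - exp (- s))) with (exp (- s)) by ring. unfold Rpower. rewrite ln_exp.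
    replace (- k * - s) with (k * s) by ring.
    replace ((Rabs k + 1) * s) with (s + Rabs k * s) by ring. rewrite exp_plus.
    apply Rle_trans with (exp s * exp (k * s)).
    + apply Rmult_le_compat_r; [left; apply exp_pos|].
      pose proof (Rle_abs C0). pose proof (exp_ineq1_le s). lra.
    + apply Rmult_le_compat_l; [left; apply exp_pos|]. apply exp_mono.
      apply Rmult_le_compat_r; [lra|apply Rle_abs].
Qed.

(** Cauchy's estimate on the circle at [s + ln 2] costs [exp (K * (s + ln 2))] and the inverse
    square of the gap [exp (- s) / 2]. In the exponent [K + 3 + c], the [K] and two units pay for
    the growth in [s], the third unit pays for the constant 16 * 2^K because [s >= K + 4], and [c]
    remains. *)
Lemma nearby_values f K s1 c s t x y : growth_bound f K s1 -> 0 <= c -> 1 <= K -> s1 <= s -> K + 4 <= s ->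
  0 < t <= exp (- ((K + 3 + c) * s)) -> chord x y <= 2 * t ->
  Cmod (f (polar (rad s) x) - f (polar (rad s) y)) <= exp (- (c * s)).
Proof.
  intros [Ha Hb] Hc HK Hs1 Hs Ht Hxy. pose proof ln2_bound as L2.
  pose proof (rad_bound s ltac:(lra)) as Hr. pose proof (rad_bound (s + ln 2) ltac:(lra)) as Hr1.
  assert (D : rad (s + ln 2) - rad s = exp (- s) / 2).
  { unfold rad. replace (- (s + ln 2)) with (- s + - ln 2) by ring.
    rewrite exp_plus, (exp_Ropp (ln 2)), exp_ln by lra. field. }
  assert (P := exp_pos (- s)).
  eapply Rle_trans.
  - apply (cauchy_lipschitz f (rad s) (rad (s + ln 2)) (exp (K * (s + ln 2)))).
    + intros w Hw. apply Ha. lra.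
    + lra.
    + intros w Hw. apply Hb; lra.
    + rewrite polar_Cmod_pos; lra.
    + rewrite polar_Cmod_pos; lra.
  - rewrite D. rewrite (polar_split _ x), (polar_split _ y).
    replace (RtoC (rad s) * polar 1 x - RtoC (rad s) * polar 1 y)%C with (RtoC (rad s) * (polar 1 x - polar 1 y))%C by ring.
    rewrite Cmod_mult, Cmod_R, Rabs_right by lra. fold (chord x y). pose proof (chord_pos x y) as Hcp.
    set (M := exp (K * (s + ln 2))). assert (HM : 0 < M) by apply exp_pos.
    assert (Hpp : rad s * chord x y <= 2 * t) by nra.
    assert (Hpp0 : 0 <= rad s * chord x y) by nra.
    apply Rle_trans with (2 * M * 1 * (2 * t) / (exp (- s) / 2) ^ 2).
    + apply Rmult_le_compat_r; [left; apply Rinv_0_lt_compat, pow_lt; lra|].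
      apply Rmult_le_compat; auto; nra.
    + replace (2 * M * 1 * (2 * t) / (exp (- s) / 2) ^ 2) with (16 * M * t * / (exp (- s) * exp (- s))) by (field; lra).
      rewrite <- exp_plus, <- exp_Ropp.
      assert (E16 : 16 = exp (4 * ln 2)).
      { replace (4 * ln 2) with (ln 2 + ln 2 + ln 2 + ln 2) by ring. rewrite !exp_plus, exp_ln by lra. ring. }
      rewrite E16. unfold M.
      apply Rle_trans with (exp (4 * ln 2) * exp (K * (s + ln 2)) * exp (- ((K + 3 + c) * s)) * exp (- (- s + - s))).
      * apply Rmult_le_compat_r; [left; apply exp_pos|]. apply Rmult_le_compat_l; [|lra].
        rewrite <- exp_plus. left; apply exp_pos.
      * rewrite <- !exp_plus. apply exp_mono. nra.
Qed.

Definition decay_set (f : C -> C) (c sigma th : R) : Prop :=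
  0 <= th < 2 * PI /\ forall s, sigma <= s -> Cmod (f (polar (rad s) th)) <= exp (- (c * s)).

Definition growth_set (f : C -> C) (c sigma th : R) : Prop :=
  0 <= th < 2 * PI /\ forall s, sigma <= s -> exp (c * s) <= Cmod (f (polar (rad s) th)).

Lemma cut_supp_point E t s : (exists x, E x) -> 0 < t -> 0 < cut E t s -> exists x, E x /\ chord s x <= 2 * t.
Proof.
  intros He Ht H. apply cut_supp in H; auto.
  destruct (cdist_approx E s (2 * t - cdist E s) He ltac:(lra)) as [x [Hx H1]].
  exists x. split; auto. lra.
Qed.

(** The weight [y] lies strictly between K (1 - 1/A) and (K + c/2)(1 - 1/A). Above the first value,
    the share of [b] shrinks by K / (K + c/4); below the second, the coefficient 1/A + y / (K + c/2)
    of [a] is less than 1. The leakage [kap] is absorbed between [q0] and [q]. *)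
Lemma decay_constants K c A : 0 < K -> 0 < c -> 1 < A -> exists y q kap0, 0 < y /\ 0 < q < 1 /\ 0 < kap0 < 1 /\
  forall kap a b a' b', 0 <= kap <= kap0 -> 0 <= a -> 0 <= b ->
    (1 - kap) * a' <= a / A + K * (1 - / A) * b -> (K + c / 2) * b' <= a ->
    a' + y * b' <= q * (a + y * b).
Proof.
  intros HK Hc HA.
  assert (HiA : 0 < / A < 1).
  { split; [apply Rinv_0_lt_compat; lra|]. rewrite <- Rinv_1. apply Rinv_lt_contravar; lra. }
  set (y := (K + c / 4) * (1 - / A)).
  assert (Hy : 0 < y) by (apply Rmult_lt_0_compat; lra).
  set (q1 := / A + y / (K + c / 2)). set (q2 := K / (K + c / 4)).
  assert (H1 : 0 < q1 < 1).
  { unfold q1, y. split.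
    - assert (0 < (K + c / 4) * (1 - / A) / (K + c / 2)) by (apply Rdiv_lt_0_compat; [exact Hy|lra]). lra.
    - assert ((K + c / 4) * (1 - / A) / (K + c / 2) < 1 - / A); [|lra].
      apply Rlt_div_l; [lra|]. nra. }
  assert (H2 : 0 < q2 < 1) by (unfold q2; split; [apply Rdiv_lt_0_compat; lra|apply Rlt_div_l; lra]).
  set (q0 := Rmax q1 q2).
  assert (H0 : 0 < q0 < 1) by (unfold q0; split; [eapply Rlt_le_trans; [|apply Rmax_l]; lra|apply Rmax_lub_lt; lra]).
  assert (Q1 : q1 <= q0) by apply Rmax_l. assert (Q2 : q2 <= q0) by apply Rmax_r.
  set (q := (1 + q0) / 2). assert (Hq : q0 < q < 1) by (unfold q; lra).
  assert (Hqq : 0 < q0 / q < 1) by (split; [apply Rdiv_lt_0_compat; lra|apply Rlt_div_l; lra]).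
  exists y, q, (1 - q0 / q). repeat split; try lra.
  intros kap a b a' b' Hk Ha Hb E1 E2.
  assert (Hb' : y * b' <= y / (K + c / 2) * a).
  { replace (y * b') with (y / (K + c / 2) * ((K + c / 2) * b')) by (field; lra).
    apply Rmult_le_compat_l; auto. left; apply Rdiv_lt_0_compat; lra. }
  assert (Hbb : K * (1 - / A) * b = q2 * (y * b)) by (unfold q2, y; field; lra).
  assert (S1 : (1 - kap) * (a' + y * b') <= q0 * (a + y * b)).
  { assert (X0 : 0 <= y / (K + c / 2) * a) by (apply Rmult_le_pos; auto; left; apply Rdiv_lt_0_compat; lra).
    assert (X : (1 - kap) * (y * b') <= y / (K + c / 2) * a).
    { destruct (Rle_lt_dec 0 b').
      - assert (0 <= y * b') by (apply Rmult_le_pos; lra). nra.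
      - assert (y * b' < 0) by nra. nra. }
    assert (q1 * a <= q0 * a) by (apply Rmult_le_compat_r; lra).
    assert (q2 * (y * b) <= q0 * (y * b)) by (apply Rmult_le_compat_r; auto; apply Rmult_le_pos; lra).
    unfold q1 in *. unfold Rdiv in *. nra. }
  assert (HD : 0 <= a + y * b) by (assert (0 <= y * b) by (apply Rmult_le_pos; lra); lra).
  assert (Hk2 : q0 / q <= 1 - kap) by lra.
  apply Rmult_le_reg_l with (1 - kap); [lra|]. eapply Rle_trans; [exact S1|].
  rewrite <- Rmult_assoc. apply Rmult_le_compat_r; auto.
  apply Rle_trans with (q0 / q * q); [right; field; lra|]. apply Rmult_le_compat_r; lra.
Qed.

(** The last bound is the effective kernel width occurring in [Pint_quad_bound]: it is set by the
    inner circle, however far out the other one lies. *)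
Lemma rad_ratio s s' : 1 <= s -> s < s' -> exists rho, / 2 <= rho < 1 /\ rad s = rad s' * rho /\
  (1 - rho ^ 2) / rho <= 8 * exp (- s).
Proof.
  intros Hs Hss. pose proof (rad_half s Hs). pose proof (rad_half s' ltac:(lra)).
  pose proof (rad_bound s' ltac:(lra)). pose proof (exp_pos (- s)). pose proof (exp_pos (- s')).
  assert (exp (- s') < exp (- s)) by (apply exp_increasing; lra).
  exists (rad s / rad s').
  assert (R1 : / 2 <= rad s / rad s' < 1).
  { split; [apply Rle_div_r; [lra|]; nra|apply Rlt_div_l; [lra|]; unfold rad; lra]. }
  set (rho := rad s / rad s') in *.
  assert (E : rad s = rad s' * rho) by (unfold rho; field; lra).
  repeat split; try lra.
  assert (D : 1 - rho <= 2 * exp (- s)).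
  { assert (rad s' * (1 - rho) <= exp (- s)) by (rewrite Rmult_minus_distr_l, <- E; unfold rad; lra). nra. }
  apply Rle_div_l; nra.
Qed.

(* Away from the support of the wider cutoff the defect 1 - cut is at most a multiple of chord^2,
   while the Poisson kernel has a much smaller width than the cutoff. *)
Lemma Pint_cut_lower E t t' rho ph : (exists x, E x) -> 0 < t' -> 4 * t' <= t -> 0 < rho < 1 ->
  (1 - 4 / t ^ 2 * ((1 - rho ^ 2) / rho)) * cut E t' ph <= Pint rho (cut E t) ph.
Proof.
  intros He Ht' Ht Hr.
  assert (Hc : contR (cut E t)) by (apply cut_contR; auto; lra).
  pose proof (cut_bound E t' ph) as B.
  assert (P0 : 0 <= Pint rho (cut E t) ph).
  { rewrite <- (Pint_const rho 0 ph) by lra. apply Pint_le; auto using contR_const; [lra|].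
    intros; apply cut_bound. }
  assert (HB : 0 < 4 / t ^ 2) by (apply Rdiv_lt_0_compat; [lra|apply pow_lt; lra]).
  destruct (Req_dec (cut E t' ph) 0) as [E0|E0]; [rewrite E0; lra|].
  assert (Hd := cut_supp E t' ph Ht' ltac:(lra)).
  assert (Q : Pint rho (fun th => 1 - cut E t th) ph <= 0 + 4 / t ^ 2 * ((1 - rho ^ 2) / rho)).
  { apply Pint_quad_bound; auto using contR_minus, contR_const; [lra|]. intros th.
    destruct (Rle_lt_dec (chord ph th) (t / 2)) as [L|L].
    - rewrite cut_one; [|lra|].
      + assert (0 <= 4 / t ^ 2 * chord ph th ^ 2) by (apply Rmult_le_pos; [lra|apply pow2_ge_0]). lra.
      + pose proof (cdist_lip E th ph He). rewrite chord_sym in H. lra.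
    - pose proof (cut_bound E t th).
      assert (1 <= 4 / t ^ 2 * chord ph th ^ 2); [|lra].
      replace 1 with (4 / t ^ 2 * (t / 2) ^ 2) by (field; lra).
      apply Rmult_le_compat_l; [lra|]. apply pow_incr; lra. }
  rewrite Pint_minus, Pint_const in Q; auto using contR_const; try lra.
  assert (0 <= (1 - rho ^ 2) / rho) by (apply Rdiv_le_0_compat; nra).
  assert (0 <= 4 / t ^ 2 * ((1 - rho ^ 2) / rho)) by (apply Rmult_le_pos; lra). nra.
Qed.

Section Minus.
Context (f : C -> C) (K s1 c sigma e : R).
Context (HG : growth_bound f K s1) (HK : 1 <= K) (Hs1 : 1 <= s1) (Hc : 0 < c) (He : 0 < e <= 1).
Context (HE : exists x, decay_set f c sigma x).

Definition deficit (s th : R) : R := K * s - lnmax f e (polar (rad s) th).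
(** Cutoffs of width [exp (- tau)] are paired with the circle at [3 * tau]: leakage is of the order
    of the kernel width over the squared cutoff width, here [exp (- (3 * tau)) / exp (- (2 * tau))],
    which tends to 0. *)
Definition weighted (tau : R) : R :=
  RInt (fun th => cut (decay_set f c sigma) (exp (- tau)) th * deficit (3 * tau) th) 0 (2 * PI) / (3 * tau).

Lemma deficit_nonneg s th : s1 <= s -> 0 <= deficit s th.
Proof.
  intros Hs. unfold deficit. assert (lnmax f e (polar (rad s) th) <= K * s); [|lra].
  rewrite <- (ln_exp (K * s)). unfold lnmax. apply ln_le.
  - pose proof (Rmax_r (Cmod (f (polar (rad s) th))) e). lra.
  - apply Rmax_lub.
    + apply HG; auto. apply polar_Cmod_pos. pose proof (rad_bound s ltac:(lra)). lra.
    + apply Rle_trans with (exp 0); [rewrite exp_0; lra|]. apply exp_mono. apply Rmult_le_pos; lra.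
Qed.

Lemma deficit_contR s : 0 < s -> contR (deficit s).
Proof.
  intros Hs. apply contR_minus; [apply contR_const|]. apply lnmax_contR; [apply HG|apply rad_bound; auto|lra].
Qed.

Lemma weighted_contR tau : 0 < tau -> contR (fun th => cut (decay_set f c sigma) (exp (- tau)) th * deficit (3 * tau) th).
Proof.
  intros Ht. apply contR_mult; [apply cut_contR; auto; apply exp_pos|apply deficit_contR; lra].
Qed.

Lemma weighted_nonneg tau : s1 <= tau -> 0 <= weighted tau.
Proof.
  intros Ht. pose proof two_PI_pos. apply Rdiv_le_0_compat; [|lra].
  apply RI_nonneg; [lra|apply weighted_contR; lra|]. intros th.
  apply Rmult_le_pos; [apply cut_bound|apply deficit_nonneg; lra].
Qed.

(** Up to leakage the next cutoff is dominated by the Poisson average of the present one;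
    [Pint_adjoint] hands that average to the deficit. Dividing by [s' = A * s] produces the weights
    1/A and 1 - 1/A. *)
Lemma weighted_step A tau : 2 <= A -> s1 + 4 <= tau ->
  (1 - 32 * exp (- tau)) * weighted (A * tau) <= weighted tau / A + K * (1 - / A) * bmass (decay_set f c sigma) (exp (- tau)).
Proof.
  intros HA Ht. pose proof two_PI_pos as HPI. set (E := decay_set f c sigma) in *.
  set (s := 3 * tau). set (s' := 3 * (A * tau)).
  assert (Hss : s < s') by (unfold s, s'; nra).
  assert (HAt : tau + 4 <= A * tau) by nra.
  destruct (rad_ratio s s' ltac:(unfold s; lra) Hss) as (rho & Hrho & Hrad & Hwidth).
  set (t := exp (- tau)). set (t' := exp (- (A * tau))).
  assert (T : 0 < t) by apply exp_pos. assert (T' : 0 < t') by apply exp_pos.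
  assert (TT : 4 * t' <= t).
  { unfold t, t'. replace (- tau) with (4 + - (tau + 4)) by ring. rewrite exp_plus.
    apply Rmult_le_compat; [lra|left; apply exp_pos| |apply exp_mono; lra].
    pose proof (exp_ineq1_le 4); lra. }
  assert (Kap : 4 / t ^ 2 * ((1 - rho ^ 2) / rho) <= 32 * exp (- tau)).
  { apply Rle_trans with (4 / t ^ 2 * (8 * exp (- s))).
    - apply Rmult_le_compat_l; auto. apply Rdiv_le_0_compat; [lra|apply pow_lt; auto].
    - right. replace (- s) with (- tau + - tau + - tau) by (unfold s; ring). rewrite !exp_plus. fold t. field. lra. }
  assert (Cs : contR (cut E t)) by (apply cut_contR; auto).
  assert (Cs' : contR (cut E t')) by (apply cut_contR; auto).
  assert (Vs : contR (deficit s)) by (apply deficit_contR; unfold s; lra).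
  assert (Vs' : contR (deficit s')) by (apply deficit_contR; unfold s'; nra).
  assert (I1 : (1 - 32 * exp (- tau)) * RInt (fun th => cut E t' th * deficit s' th) 0 (2 * PI)
     <= RInt (fun th => Pint rho (cut E t) th * deficit s' th) 0 (2 * PI)).
  { rewrite <- RI_scal by (apply contR_mult; auto). apply RI_le; [lra| | |].
    - apply contR_mult; [apply contR_const|apply contR_mult; auto].
    - apply contR_mult; auto. apply Pint_contR; auto; lra.
    - intros th. rewrite <- Rmult_assoc. apply Rmult_le_compat_r; [apply deficit_nonneg; unfold s'; nra|].
      eapply Rle_trans; [|apply (Pint_cut_lower E t t' rho th); auto; lra].
      apply Rmult_le_compat_r; [apply cut_bound|]. lra. }
  rewrite <- Pint_adjoint in I1 by (auto; lra).
  assert (I2 : RInt (fun th => cut E t th * Pint rho (deficit s') th) 0 (2 * PI)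
     <= RInt (fun th => cut E t th * deficit s th + K * (s' - s) * cut E t th) 0 (2 * PI)).
  { apply RI_le; [lra| | |].
    - apply contR_mult; auto. apply Pint_contR; auto; lra.
    - apply contR_plus; apply contR_mult; auto using contR_const.
    - intros th. replace (cut E t th * deficit s th + K * (s' - s) * cut E t th)
        with (cut E t th * (deficit s th + K * (s' - s))) by ring.
      apply Rmult_le_compat_l; [apply cut_bound|]. unfold deficit.
      rewrite Pint_minus, Pint_const; auto using contR_const; try lra.
      + rewrite Hrad. pose proof (lnmax_submean f e (rad s') rho th (proj1 HG)
          (rad_bound s' ltac:(unfold s'; nra)) ltac:(lra) ltac:(lra)). lra.
      + apply lnmax_contR; [apply HG|apply rad_bound; unfold s'; nra|lra]. }
  rewrite RI_plus, RI_scal in I2 by (try apply contR_mult; auto using contR_const).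
  fold (bmass E t) in I2. unfold weighted. fold E s s' t t'.
  set (X := RInt (fun th => cut E t' th * deficit s' th) 0 (2 * PI)) in *.
  set (Y := RInt (fun th => cut E t th * deficit s th) 0 (2 * PI)) in *.
  assert (Hs' : s' = A * s) by (unfold s, s'; ring).
  assert (S0 : 0 < s) by (unfold s; lra).
  apply Rmult_le_reg_r with s'; [lra|].
  replace ((1 - 32 * t) * (X / s') * s') with ((1 - 32 * t) * X) by (field; lra).
  replace ((Y / s / A + K * (1 - / A) * bmass E t) * s') with (Y + K * (s' - s) * bmass E t)
    by (rewrite Hs'; field; lra).
  exact (Rle_trans _ _ _ I1 I2).
Qed.

(** This [A] makes [exp (- (A * tau))] the radius of [nearby_values] at [s = 3 * tau]. The condition
    on [e] keeps the truncation below the decay to be detected. *)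
Lemma weighted_lower A tau : A = 3 * (K + 3 + c) -> s1 + K + 4 + Rabs sigma + 2 / c <= tau ->
  e <= exp (- (c / 2 * (3 * tau))) ->
  (K + c / 2) * bmass (decay_set f c sigma) (exp (- (A * tau))) <= weighted tau.
Proof.
  intros HA Ht Hee. pose proof two_PI_pos as HPI. set (E := decay_set f c sigma) in *.
  set (s := 3 * tau). pose proof (Rle_abs sigma). pose proof (Rabs_pos sigma).
  assert (H2c : 0 < 2 / c) by (apply Rdiv_lt_0_compat; lra).
  assert (Hcs : 2 <= c * s).
  { unfold s. assert (c * (2 / c) = 2) by (field; lra).
    assert (c * (2 / c) <= c * tau) by (apply Rmult_le_compat_l; lra). lra. }
  assert (S0 : 0 < s) by (unfold s; lra).
  unfold weighted. fold s E. apply Rmult_le_reg_r with s; [auto|].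
  unfold Rdiv. rewrite (Rmult_assoc (RInt _ _ _)), Rinv_l, Rmult_1_r by lra.
  rewrite Rmult_comm. unfold bmass.
  rewrite <- RI_scal by (apply cut_contR; auto; apply exp_pos).
  rewrite <- RI_scal by (apply contR_mult; [apply contR_const|apply cut_contR; auto; apply exp_pos]).
  assert (TT : exp (- (A * tau)) <= exp (- tau)) by (apply exp_mono; rewrite HA; nra).
  apply RI_le; [lra| | |].
  - repeat apply contR_mult; try apply contR_const. apply cut_contR; auto; apply exp_pos.
  - apply weighted_contR; lra.
  - intros th. set (d := cut E (exp (- (A * tau))) th).
    pose proof (deficit_nonneg s th ltac:(unfold s; lra)) as D0.
    assert (Hd : 0 <= d <= 1) by apply cut_bound.
    assert (Hd2 : d <= cut E (exp (- tau)) th).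
    { apply cut_mono; auto. split; auto. apply exp_pos. }
    destruct (Req_dec d 0) as [Z|Z].
    { rewrite Z, !Rmult_0_r. apply Rmult_le_pos; [apply cut_bound|auto]. }
    destruct (cut_supp_point E (exp (- (A * tau))) th HE (exp_pos _) ltac:(fold d; lra)) as [x [Hx Hch]].
    assert (N := nearby_values f K s1 c s (exp (- (A * tau))) th x HG ltac:(lra) HK ltac:(unfold s; lra) ltac:(unfold s; lra)).
    specialize (N ltac:(split; [apply exp_pos|right; f_equal; rewrite HA; unfold s; ring]) Hch).
    destruct Hx as [_ Hx]. specialize (Hx s ltac:(unfold s; lra)).
    assert (F : Cmod (f (polar (rad s) th)) <= exp (- (c / 2 * s))).
    { pose proof (Cmod_triangle_minus (f (polar (rad s) th)) (f (polar (rad s) x))).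
      assert (2 * exp (- (c * s)) <= exp (- (c / 2 * s))); [|lra].
      replace (- (c / 2 * s)) with (c / 2 * s + - (c * s)) by field. rewrite exp_plus.
      apply Rmult_le_compat_r; [left; apply exp_pos|].
      pose proof (exp_ineq1_le (c / 2 * s)). lra. }
    assert (U : lnmax f e (polar (rad s) th) <= - (c / 2 * s)).
    { rewrite <- (ln_exp (- (c / 2 * s))). apply ln_le.
      - pose proof (Rmax_r (Cmod (f (polar (rad s) th))) e). lra.
      - apply Rmax_lub; auto. }
    assert (D1 : (K + c / 2) * s <= deficit s th) by (unfold deficit; lra).
    apply Rle_trans with (d * deficit s th).
    + pose proof (Rmult_le_compat_l d _ _ (proj1 Hd) D1). lra.
    + exact (Rmult_le_compat_r _ _ _ D0 Hd2).
Qed.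
End Minus.

(** The point is a bound uniform in [e]: at [z0] truncation only raises the logarithm, so the
    Poisson average of the deficit there is at most [X], and the kernel at [z0] is bounded below by
    [p] on the whole circle. *)
Lemma weighted_initial f K s1 c sigma z0 tau : growth_bound f K s1 -> 1 <= K -> 1 <= s1 ->
  (exists x, decay_set f c sigma x) -> s1 <= tau ->
  Cmod z0 < rad (3 * tau) -> f z0 <> 0%C ->
  exists C0, 0 < C0 /\ forall e, 0 < e <= 1 -> weighted f K c sigma e tau <= C0.
Proof.
  intros HG HK Hs1 HE Ht Hz Hf. pose proof two_PI_pos as HPI.
  set (s := 3 * tau) in *. pose proof (rad_bound s ltac:(unfold s; lra)) as Hr.
  pose proof (Cmod_ge_0 z0) as Hz0.
  set (rho := Cmod z0 / rad s).
  assert (Hrho : 0 <= rho < 1) by (split; [apply Rdiv_le_0_compat; lra|apply Rlt_div_l; lra]).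
  destruct (polar_surj z0) as [th0 [_ Eth]].
  assert (Eth2 : z0 = polar (rad s * rho) th0).
  { rewrite Eth at 1. f_equal. unfold rho. field. lra. }
  set (p := (1 - rho ^ 2) / (1 + rho) ^ 2).
  assert (Hp : 0 < p) by (apply Rdiv_lt_0_compat; [nra|apply pow_lt; lra]).
  set (X := Rabs (K * s - lnmod f z0)).
  exists (2 * PI * X / p / s + 1). split.
  { assert (0 <= 2 * PI * X / p / s); [|lra]. pose proof (Rabs_pos (K * s - lnmod f z0)).
    apply Rdiv_le_0_compat; [apply Rdiv_le_0_compat; auto; unfold X; nra|unfold s; lra]. }
  intros e He.
  assert (V : contR (deficit f K e s)) by (apply (deficit_contR f K s1 e HG He); unfold s; lra).
  assert (V0 : forall th, 0 <= deficit f K e s th) by (intros; apply (deficit_nonneg f K s1 e); auto; unfold s; lra).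
  assert (I1 : RInt (fun th => cut (decay_set f c sigma) (exp (- tau)) th * deficit f K e s th) 0 (2 * PI)
     <= RInt (deficit f K e s) 0 (2 * PI)).
  { apply RI_le; auto; [lra| |].
    - apply contR_mult; auto. apply cut_contR; auto; apply exp_pos.
    - intros th. pose proof (cut_bound (decay_set f c sigma) (exp (- tau)) th). specialize (V0 th). nra. }
  assert (I2 : p / (2 * PI) * RInt (deficit f K e s) 0 (2 * PI) <= Pint rho (deficit f K e s) th0).
  { unfold Pint. apply Rmult_le_reg_r with (2 * PI); [auto|].
    unfold Rdiv at 2. rewrite (Rmult_assoc (RInt _ _ _)), Rinv_l, Rmult_1_r by lra.
    replace (p / (2 * PI) * RInt (deficit f K e s) 0 (2 * PI) * (2 * PI)) with (p * RInt (deficit f K e s) 0 (2 * PI)) by (field; lra).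
    rewrite <- RI_scal by auto. apply RI_le; [lra|apply contR_mult; auto using contR_const| |].
    - apply contR_mult; auto. apply contR_PK; auto.
    - intros th. apply Rmult_le_compat_r; auto. unfold p, PK.
      apply Rmult_le_compat_l; [nra|]. apply Rinv_le_contravar; [apply PK_den_pos; auto|].
      pose proof (COS_bound (th0 - th)). nra. }
  assert (I3 : Pint rho (deficit f K e s) th0 <= X).
  { unfold deficit. rewrite Pint_minus, Pint_const; auto using contR_const.
    - pose proof (lnmax_submean f e (rad s) rho th0 (proj1 HG) Hr ltac:(lra) Hrho) as S. rewrite <- Eth2 in S.
      assert (lnmod f z0 <= lnmax f e z0) by (apply ln_le; [apply Cmod_gt_0; auto|apply Rmax_l]).
      unfold X. pose proof (Rle_abs (K * s - lnmod f z0)). lra.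
    - apply lnmax_contR; auto; [apply HG|lra]. }
  assert (I4 : RInt (deficit f K e s) 0 (2 * PI) <= 2 * PI * X / p).
  { apply Rle_div_r; auto. apply Rmult_le_reg_r with (/ (2 * PI)); [apply Rinv_0_lt_compat; auto|].
    replace (2 * PI * X * / (2 * PI)) with X by (field; lra).
    replace (RInt (deficit f K e s) 0 (2 * PI) * p * / (2 * PI)) with (p / (2 * PI) * RInt (deficit f K e s) 0 (2 * PI)) by (field; lra).
    lra. }
  unfold weighted. fold s. apply Rle_trans with (2 * PI * X / p / s); [|lra].
  apply Rmult_le_compat_r; [left; apply Rinv_0_lt_compat; unfold s; lra|]. lra.
Qed.

Lemma decay_set_bmass f K s1 c sigma z0 : growth_bound f K s1 -> 1 <= K -> 1 <= s1 -> 0 < c ->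
  Cmod z0 < 1 -> f z0 <> 0%C ->
  exists A q C0 tau0, 1 < A /\ 0 < q < 1 /\ 0 < C0 /\ 0 < tau0 /\
  ((exists x, decay_set f c sigma x) -> forall k : nat, bmass (decay_set f c sigma) (exp (- (tau0 * A ^ k))) <= C0 * q ^ k).
Proof.
  intros HG HK Hs1 Hc Hz Hf. pose proof two_PI_pos as HPI.
  set (A := 3 * (K + 3 + c)). assert (HA : 12 <= A) by (unfold A; lra).
  destruct (decay_constants K c A ltac:(lra) Hc ltac:(lra)) as (y & q & kap0 & Hy & Hq & Hk0 & Step).
  set (tau0 := s1 + K + 4 + Rabs sigma + 2 / c + Rabs (ln (kap0 / 32)) + Rabs (ln (1 - Cmod z0)) + 1).
  pose proof (Rabs_pos sigma). pose proof (Rabs_pos (ln (kap0 / 32))). pose proof (Rabs_pos (ln (1 - Cmod z0))).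
  assert (H2c : 0 < 2 / c) by (apply Rdiv_lt_0_compat; lra).
  assert (Hkap : forall tau, tau0 <= tau -> 0 <= 32 * exp (- tau) <= kap0).
  { intros tau Ht. pose proof (exp_pos (- tau)). split; [lra|].
    assert (exp (- tau) <= kap0 / 32); [|lra].
    rewrite <- (exp_ln (kap0 / 32)) by lra. apply exp_mono.
    pose proof (Rle_abs (- ln (kap0 / 32))) as B. rewrite Rabs_Ropp in B. unfold tau0 in Ht. lra. }
  assert (Hz1 : Cmod z0 < rad (3 * tau0)).
  { unfold rad. assert (exp (- (3 * tau0)) < 1 - Cmod z0); [|lra].
    rewrite <- (exp_ln (1 - Cmod z0)) by lra. apply exp_increasing.
    pose proof (Rle_abs (- ln (1 - Cmod z0))) as B. rewrite Rabs_Ropp in B. unfold tau0. lra. }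
  destruct (classic (exists x, decay_set f c sigma x)) as [HE|HE].
  2: { exists A, q, 1, tau0. repeat split; try lra; [unfold tau0; lra|]. intros X; contradiction. }
  destruct (weighted_initial f K s1 c sigma z0 tau0 HG HK Hs1 HE ltac:(unfold tau0; lra) Hz1 Hf) as (Ca & HCa & Hinit).
  exists A, q, ((Ca + y * (2 * PI)) / y), tau0.
  assert (HC0 : 0 < Ca + y * (2 * PI)) by nra.
  repeat split; try lra; [apply Rdiv_lt_0_compat; lra|unfold tau0; lra|].
  intros _ N.
  (* The truncation level depends on the target stage [N], low enough for all stages up to [N];
     since [Ca] does not depend on [e], the final constant does not depend on [N]. *)
  set (e := exp (- (c / 2 * (3 * (tau0 * A ^ N))))).
  assert (PA : forall k, 1 <= A ^ k) by (intros; apply pow_R1_Rle; lra).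
  assert (Ht0 : 0 < tau0) by (unfold tau0; lra).
  assert (He : 0 < e <= 1).
  { split; [apply exp_pos|]. rewrite <- exp_0. apply exp_mono. specialize (PA N).
    assert (0 <= c / 2 * (3 * (tau0 * A ^ N))) by (repeat apply Rmult_le_pos; lra). lra. }
  assert (Ind : forall k, (k <= N)%nat -> weighted f K c sigma e (tau0 * A ^ k)
     + y * bmass (decay_set f c sigma) (exp (- (tau0 * A ^ k))) <= q ^ k * (Ca + y * (2 * PI))).
  { induction k as [|k IH]; intros Hk.
    - simpl. rewrite Rmult_1_r, Rmult_1_l. apply Rplus_le_compat; [apply Hinit; auto|].
      apply Rmult_le_compat_l; [lra|]. apply bmass_le; auto. apply exp_pos.
    - assert (Htk : tau0 <= tau0 * A ^ k) by (specialize (PA k); nra).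
      replace (tau0 * A ^ S k) with (A * (tau0 * A ^ k)) by (simpl; ring).
      set (tau := tau0 * A ^ k) in *.
      eapply Rle_trans.
      + apply (Step (32 * exp (- tau)) (weighted f K c sigma e tau) (bmass (decay_set f c sigma) (exp (- tau)))).
        * apply Hkap; auto.
        * apply (weighted_nonneg f K s1 c sigma e); auto. unfold tau0 in *; lra.
        * apply bmass_pos; auto. apply exp_pos.
        * apply (weighted_step f K s1 c sigma e); auto; [lra|unfold tau0 in *; lra].
        * apply (weighted_lower f K s1 c sigma e); auto; [unfold tau0 in *; lra|].
          unfold e. apply exp_mono. apply Ropp_le_contravar.
          apply Rmult_le_compat_l; [lra|]. apply Rmult_le_compat_l; [lra|].
          apply Rmult_le_compat_l; [lra|]. apply Rle_pow; [lra|lia].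
      + simpl. rewrite Rmult_assoc. apply Rmult_le_compat_l; [lra|]. apply IH. lia. }
  specialize (Ind N (Nat.le_refl N)).
  assert (W : 0 <= weighted f K c sigma e (tau0 * A ^ N)).
  { apply (weighted_nonneg f K s1 c sigma e); auto. specialize (PA N). 
    apply Rle_trans with tau0; [unfold tau0; lra|nra]. }
  apply Rmult_le_reg_l with y; auto.
  replace (y * ((Ca + y * (2 * PI)) / y * q ^ N)) with (q ^ N * (Ca + y * (2 * PI))) by (field; lra). lra.
Qed.

(** * Radial growth *)

Lemma RI_Chasles f a b c : contR f -> RInt f a b + RInt f b c = RInt f a c.
Proof. intros H. exact (RInt_Chasles (V := R_CompleteNormedModule) f a b c (ex_RInt_all _ _ _ H) (ex_RInt_all _ _ _ H)). Qed.

Lemma RI_sub f a p q b : contR f -> (forall x, 0 <= f x) -> a <= p <= q -> q <= b -> RInt f p q <= RInt f a b.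
Proof.
  intros Hf H0 Hp Hq. rewrite <- (RI_Chasles f a p b), <- (RI_Chasles f p q b) by auto.
  pose proof (RI_nonneg f a p ltac:(lra) Hf H0). pose proof (RI_nonneg f q b Hq Hf H0). lra.
Qed.

Lemma RI_period f a : contR f -> (forall x, f (x + 2 * PI) = f x) -> RInt f a (a + 2 * PI) = RInt f 0 (2 * PI).
Proof.
  intros Hf Hp.
  assert (E : RInt f (2 * PI) (a + 2 * PI) = RInt f 0 a).
  { pose proof (RInt_comp_lin (V := R_CompleteNormedModule) f 1 (2 * PI) 0 a (ex_RInt_all _ _ _ Hf)) as L.
    replace (1 * 0 + 2 * PI) with (2 * PI) in L by ring. replace (1 * a + 2 * PI) with (a + 2 * PI) in L by ring.
    rewrite <- L. apply RI_ext. intros x. change (1 * f (1 * x + 2 * PI) = f x). rewrite !Rmult_1_l. apply Hp. }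
  pose proof (RI_Chasles f 0 a (a + 2 * PI) Hf). pose proof (RI_Chasles f 0 (2 * PI) (a + 2 * PI) Hf). lra.
Qed.

Lemma chord_period s : chord (s + 2 * PI) s = 0.
Proof. unfold chord. rewrite polar_periodic. apply chord_refl. Qed.

Lemma cdist_period E s : (exists x, E x) -> cdist E (s + 2 * PI) = cdist E s.
Proof.
  intros He. pose proof (cdist_lip E (s + 2 * PI) s He). pose proof (cdist_lip E s (s + 2 * PI) He).
  rewrite (chord_sym s) in *. rewrite chord_period in *. lra.
Qed.

Lemma cut_period E t s : (exists x, E x) -> cut E t (s + 2 * PI) = cut E t s.
Proof. intros He. unfold cut. rewrite cdist_period; auto. Qed.

(** Taken from the Taylor lower bound of degree 7; it gives the comparison of angle and chord in
    [chord_angle]. *)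
Lemma sin_third u : 0 <= u <= 2 -> u / 3 <= sin u.
Proof.
  intros Hu. pose proof PI2_1. pose proof (SIN u ltac:(lra)) as [S _]; [lra|].
  eapply Rle_trans; [|exact S]. unfold sin_lb, sin_approx, sin_term, sum_f_R0. simpl fact.
  rewrite !INR_IZR_INZ. simpl. 
  assert (u ^ 2 <= 4) by nra. assert (0 <= u ^ 3 <= 4 * u) by nra.
  assert (0 <= u ^ 5) by (apply pow_le; lra). assert (u ^ 7 <= 4 * u ^ 5) by (replace (u ^ 7) with (u ^ 2 * u ^ 5) by ring; nra).
  field_simplify. nra.
Qed.

(** [w] is the signed angle from [s] to [x]; its sign tells [spread_lower] in which direction to
    move. *)
Lemma chord_angle s x : exists w, - PI <= w <= PI /\ (forall y, chord (s + y) x ^ 2 = 2 - 2 * cos (y - w)) /\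
  chord s x <= Rabs w <= 3 * chord s x.
Proof.
  pose proof PI_RGT_0 as HPI. pose proof PI_4 as HPI4.
  destruct (polar_surj (polar 1 (x - s))) as [w [Hw E]]. rewrite polar_Cmod_pos in E by lra.
  unfold polar in E. injection E as E1 E2. rewrite !Rmult_1_l in *.
  assert (F : forall y, chord (s + y) x ^ 2 = 2 - 2 * cos (y - w)).
  { intros y. rewrite chord_sqr. replace (s + y - x) with (y - (x - s)) by ring.
    rewrite (cos_minus y (x - s)), (cos_minus y w), E1, E2. auto. }
  exists w. split; auto. split; auto.
  assert (Q : chord s x ^ 2 = (2 * sin (Rabs w / 2)) ^ 2).
  { replace s with (s + 0) at 1 by ring. rewrite F.
    replace (cos (0 - w)) with (cos (2 * (Rabs w / 2))).
    - rewrite cos_2a_sin. ring.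
    - replace (2 * (Rabs w / 2)) with (Rabs w) by field. replace (0 - w) with (- w) by ring. rewrite cos_neg.
      unfold Rabs. destruct Rcase_abs; auto. apply cos_neg. }
  assert (Hw2 : 0 <= Rabs w / 2 <= 2).
  { split; [pose proof (Rabs_pos w); lra|]. assert (Rabs w <= PI) by (apply Rabs_le; lra). lra. }
  pose proof (sin_third _ Hw2) as S3. pose proof (sin_abs_le (Rabs w / 2)) as Sa.
  rewrite (Rabs_right (Rabs w / 2)) in Sa by lra. pose proof (Rle_abs (sin (Rabs w / 2))).
  pose proof (chord_pos s x).
  assert (chord s x = 2 * sin (Rabs w / 2)).
  { apply Rsqr_inj; try lra. unfold Rsqr. nra. }
  lra.
Qed.

Lemma Rmin_contr a b c : Rabs (Rmin c a - Rmin c b) <= Rabs (a - b).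
Proof. unfold Rmin. repeat destruct Rle_dec; unfold Rabs; repeat destruct Rcase_abs; lra. Qed.

(** A single point contributes an interval of length [T] on the side where [0, 2 pi] has room. This
    later absorbs an error of order [T ^ 2]. *)
Lemma bmass_lower E T : (exists x, E x) -> (forall x, E x -> 0 <= x < 2 * PI) -> 0 < T <= 1 -> T <= bmass E T.
Proof.
  intros He HE HT. pose proof PI2_1. destruct He as [x Hx]. specialize (HE x Hx) as Hb.
  assert (Hc : contR (cut E T)) by (apply cut_contR; [eauto|lra]).
  assert (K : forall p q, 0 <= p <= q -> q <= 2 * PI -> q - p = T -> (forall y, p <= y <= q -> Rabs (y - x) <= T) -> T <= bmass E T).
  { intros p q Hp Hq Hpq Hy. unfold bmass.
    eapply Rle_trans; [|apply (RI_sub _ 0 p q (2 * PI)); auto; try lra; apply cut_bound].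
    apply Rle_trans with ((q - p) * 1); [lra|]. apply RI_ge_const; auto; [lra|].
    intros y Hyy. rewrite cut_one; [lra|lra|]. eapply Rle_trans; [apply cdist_le; eauto|].
    eapply Rle_trans; [apply chord_le|]. apply Hy; lra. }
  destruct (Rle_lt_dec (x + T) (2 * PI)).
  - apply (K x (x + T)); try lra. intros; apply Rabs_le; lra.
  - apply (K (x - T) x); try lra. intros; apply Rabs_le; lra.
Qed.

Section Plus.
Context (f : C -> C) (K s1 c sigma : R).
Context (HG : growth_bound f K s1) (HK : 1 <= K) (Hs1 : 1 <= s1) (Hc : 0 < c).
Context (HZ : forall z, Cmod z < 1 -> f z <> 0%C).
Context (HE : exists x, growth_set f c sigma x).
Let E := growth_set f c sigma.

Definition slack (s th : R) : R := K * s - lnmod f (polar (rad s) th).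

Lemma lnmod_contR s : 0 < s -> contR (fun th => lnmod f (polar (rad s) th)).
Proof.
  intros Hs. apply (lnmod_sub f (rad s) 0 0); auto; [apply HG|apply rad_bound; auto|lra].
Qed.

Lemma slack_contR s : 0 < s -> contR (slack s).
Proof. intros Hs. apply contR_minus; [apply contR_const|]. apply lnmod_contR; auto. Qed.

Lemma slack_nonneg s th : s1 <= s -> 0 <= slack s th.
Proof.
  intros Hs. pose proof (rad_bound s ltac:(lra)). unfold slack.
  assert (lnmod f (polar (rad s) th) <= K * s); [|lra].
  rewrite <- (ln_exp (K * s)). apply ln_le.
  - apply Cmod_gt_0, HZ. rewrite polar_Cmod_pos; lra.
  - apply HG; auto. apply polar_Cmod_pos; lra.
Qed.

Lemma slack_mean s rho th : 0 < s -> 0 <= rho < 1 ->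
  Pint rho (slack s) th = K * s - lnmod f (polar (rad s * rho) th).
Proof.
  intros Hs Hr. unfold slack. rewrite Pint_minus, Pint_const; auto using contR_const, lnmod_contR.
  rewrite lnmod_mean; auto; [apply HG|apply rad_bound; auto].
Qed.

(** Radius of the Poisson kernel attached to [th]: its height above the circle is the distance to
    [E], floored at [t2] and capped at 1/2. *)
Definition reach (t2 th : R) : R := 1 - Rmin (/ 2) (Rmax (cdist E th) t2).

Lemma reach_contR t2 : contR (reach t2).
Proof.
  intros x. apply (chLip_cont 1). intros s t. unfold reach.
  replace (1 - Rmin (/ 2) (Rmax (cdist E s) t2) - (1 - Rmin (/ 2) (Rmax (cdist E t) t2)))
    with (Rmin (/ 2) (Rmax (cdist E t) t2) - Rmin (/ 2) (Rmax (cdist E s) t2)) by ring.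
  eapply Rle_trans; [apply Rmin_contr|]. eapply Rle_trans; [apply Rmax_lip|].
  pose proof (cdist_lip E s t HE). pose proof (cdist_lip E t s HE). rewrite (chord_sym t s) in *.
  apply Rabs_le. lra.
Qed.

Lemma reach_bound t2 th : 0 < t2 -> / 2 <= reach t2 th < 1.
Proof.
  intros Ht. unfold reach. pose proof (Rmin_l (/ 2) (Rmax (cdist E th) t2)).
  assert (0 < Rmin (/ 2) (Rmax (cdist E th) t2)); [|lra].
  apply Rmin_glb_lt; [lra|]. pose proof (Rmax_r (cdist E th) t2). lra.
Qed.

Lemma reach_kernel_cont t2 : 0 < t2 -> cont2 (fun th ph => PK (reach t2 th) (th - ph)).
Proof.
  intros Ht x y. unfold PK, Rdiv.
  assert (Cr : continuity_2d_pt (fun u v => reach t2 u) x y) by (apply (cont2_const_l (reach t2)); apply reach_contR).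
  assert (Cr2 : continuity_2d_pt (fun u v => reach t2 u ^ 2) x y).
  { apply continuity_2d_pt_ext with (fun u v => reach t2 u * reach t2 u); [intros; ring|].
    apply continuity_2d_pt_mult; auto. }
  apply continuity_2d_pt_mult; [apply continuity_2d_pt_minus; auto; apply continuity_2d_pt_const|].
  apply continuity_2d_pt_inv; [|apply Rgt_not_eq, PK_den_pos; pose proof (reach_bound t2 x Ht); lra].
  apply continuity_2d_pt_plus; auto.
  apply continuity_2d_pt_minus; [apply continuity_2d_pt_const|].
  apply continuity_2d_pt_mult; [apply continuity_2d_pt_mult; auto; apply continuity_2d_pt_const|].
  apply (continuity_1d_2d_pt_comp cos (fun u v => u - v)); [apply continuity_cos|].
  apply continuity_2d_pt_minus; [apply continuity_2d_pt_id1|apply continuity_2d_pt_id2].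
Qed.

(* Harnack: at distance comparable to cdist from the circle the slack is controlled by its value
   above a nearby point of E, where |f| >= 1. *)
Lemma slack_harnack s T t2 th : s1 <= s -> exp (- s) <= T -> T <= / 8 -> 3 * T <= exp (- sigma) -> 0 < t2 <= T ->
  cdist E th < 2 * T -> Pint (reach t2 th) (slack s) th <= 9 * (K * s).
Proof.
  intros Hs HsT HT HTs Ht Hd. pose proof two_PI_pos.
  pose proof (reach_bound t2 th ltac:(lra)) as Hr. pose proof (rad_bound s ltac:(lra)) as Hrs.
  set (rho := reach t2 th) in *.
  assert (D : 1 - rho = Rmax (cdist E th) t2).
  { unfold rho, reach. rewrite Rmin_right; [ring|]. apply Rmax_lub; lra. }
  set (del := Rmax (cdist E th) t2) in *.
  assert (D1 : cdist E th <= del) by apply Rmax_l. assert (D2 : t2 <= del) by apply Rmax_r.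
  assert (D3 : del <= 2 * T) by (apply Rmax_lub; lra).
  destruct (cdist_approx E th del HE ltac:(lra)) as [x [Hx Hch]].
  (* Both kernels have height [del], and [th] and [x] are less than [2 * del] apart; the factor 9
     compares their denominators. *)
  assert (Comp : forall ph, PK rho (th - ph) <= 9 * PK rho (x - ph)).
  { intros ph. unfold PK.
    pose proof (PK_den_pos rho (th - ph) ltac:(lra)) as P1. pose proof (PK_den_pos rho (x - ph) ltac:(lra)) as P2.
    rewrite !PK_den_chord in *.
    pose proof (chord_tri x th ph) as Tr. rewrite (chord_sym x th) in Tr.
    pose proof (chord_pos th ph). pose proof (chord_pos x ph).
    set (a := chord th ph) in *. set (b := chord x ph) in *.
    assert (Hb : b ^ 2 <= 2 * a ^ 2 + 8 * del ^ 2).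
    { assert (b <= a + 2 * del) by lra.
      assert (b ^ 2 <= (a + 2 * del) ^ 2) by (apply pow_incr; lra).
      assert (0 <= (a - 2 * del) ^ 2) by apply pow2_ge_0. nra. }
    rewrite D in *.
    assert (Hden : del ^ 2 + rho * b ^ 2 <= 9 * (del ^ 2 + rho * a ^ 2)).
    { assert (rho * b ^ 2 <= rho * (2 * a ^ 2 + 8 * del ^ 2)) by (apply Rmult_le_compat_l; lra).
      assert (0 <= rho * a ^ 2) by (apply Rmult_le_pos; [lra|apply pow2_ge_0]).
      assert (rho * del ^ 2 <= 1 * del ^ 2) by (apply Rmult_le_compat_r; [apply pow2_ge_0|lra]). lra. }
    set (d1 := del ^ 2 + rho * a ^ 2) in *. set (d2 := del ^ 2 + rho * b ^ 2) in *.
    unfold Rdiv. rewrite <- Rmult_assoc, (Rmult_comm 9), Rmult_assoc.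
    apply Rmult_le_compat_l; [nra|].
    apply Rmult_le_reg_r with (d1 * d2); [apply Rmult_lt_0_compat; auto|].
    replace (/ d1 * (d1 * d2)) with d2 by (field; lra).
    replace (9 * / d2 * (d1 * d2)) with (9 * d1) by (field; lra). lra. }
  assert (S0 : contR (slack s)) by (apply slack_contR; lra).
  assert (L : Pint rho (slack s) th <= 9 * Pint rho (slack s) x).
  { unfold Pint. replace (9 * (RInt (fun t => PK rho (x - t) * slack s t) 0 (2 * PI) / (2 * PI)))
      with ((9 * RInt (fun t => PK rho (x - t) * slack s t) 0 (2 * PI)) / (2 * PI)) by (field; lra).
    apply Rmult_le_compat_r; [left; apply Rinv_0_lt_compat; lra|].
    assert (CP : forall q, contR (fun t => PK rho (q - t) * slack s t)).
    { intros q. apply contR_mult; auto. apply contR_PK; lra. }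
    rewrite <- RI_scal by auto. apply RI_le; [lra|auto|apply contR_mult; auto using contR_const|].
    intros ph. rewrite <- Rmult_assoc. apply Rmult_le_compat_r; [apply slack_nonneg; auto|apply Comp]. }
  eapply Rle_trans; [exact L|]. apply Rmult_le_compat_l; [lra|].
  rewrite slack_mean by lra.
  assert (U : 0 <= lnmod f (polar (rad s * rho) x)); [|lra].
  destruct Hx as [_ Hx].
  (* [1 - rho <= 2 * T] and [1 - rad s <= T] add up to [3 * T <= exp (- sigma)], which puts this
     radius in the range where membership in [E] gives [|f| >= 1]. *)
  assert (Q : 0 < 1 - rad s * rho <= 3 * T).
  { split; [nra|]. assert (rad s = 1 - exp (- s)) by reflexivity. pose proof (exp_pos (- s)). nra. }
  set (ss := - ln (1 - rad s * rho)).
  assert (Hss : rad ss = rad s * rho).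
  { unfold rad at 1, ss. rewrite Ropp_involutive, exp_ln; lra. }
  assert (Hss2 : sigma <= ss).
  { unfold ss. rewrite <- (Ropp_involutive sigma). apply Ropp_le_contravar.
    rewrite <- (ln_exp (- sigma)). apply ln_le; lra. }
  assert (Hss3 : 0 <= ss).
  { unfold ss. assert (ln (1 - rad s * rho) <= ln 1); [|rewrite ln_1 in *; lra]. apply ln_le; [lra|]. nra. }
  specialize (Hx ss Hss2). rewrite Hss in Hx.
  assert (1 <= exp (c * ss)).
  { rewrite <- exp_0. apply exp_mono. apply Rmult_le_pos; lra. }
  unfold lnmod. rewrite <- ln_1. apply ln_le; lra.
Qed.

(** If [ph] is at distance [d] from [E], an interval of length at least [d / 12] beside it carries
    kernels of height comparable to [d], each at least [1 / (4 * d)] at [ph], with at least half of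
    the cutoff left. The product of these is the cutoff over 96. *)
Lemma spread_lower T t1 t2 ph : T <= / 8 -> 0 < t2 -> 8 * t2 <= t1 -> t1 <= T ->
  (cut E T ph - cut E t1 ph) / 96 <=
  RInt (fun th => cut E T th * (1 - cut E t2 th) * PK (reach t2 th) (th - ph)) 0 (2 * PI).
Proof.
  intros HT Ht2 Ht1 HtT. pose proof two_PI_pos as HPI.
  set (h := fun th => cut E T th * (1 - cut E t2 th) * PK (reach t2 th) (th - ph)).
  assert (CE : forall t, 0 < t -> contR (cut E t)) by (intros; apply cut_contR; auto).
  assert (Hh : contR h).
  { apply contR_mult.
    - apply contR_mult; [apply CE; lra|]. apply contR_minus; [apply contR_const|apply CE; lra].
    - intros th. apply (cont2_l (fun th ph => PK (reach t2 th) (th - ph))). apply reach_kernel_cont; auto. }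
  assert (Hh0 : forall th, 0 <= h th).
  { intros th. pose proof (cut_bound E T th). pose proof (cut_bound E t2 th).
    pose proof (reach_bound t2 th Ht2). pose proof (PK_pos (reach t2 th) (th - ph) ltac:(lra)).
    apply Rmult_le_pos; [apply Rmult_le_pos; lra|lra]. }
  assert (Hper : forall th, h (th + 2 * PI) = h th).
  { intros th. unfold h. rewrite !cut_period by auto. f_equal. unfold reach. rewrite cdist_period by auto.
    unfold PK. replace (th + 2 * PI - ph) with ((th - ph) + 2 * INR 1 * PI) by (simpl; ring).
    rewrite cos_period. auto. }
  pose proof (cut_bound E T ph) as B1. pose proof (cut_bound E t1 ph) as B2.
  pose proof (RI_nonneg h 0 (2 * PI) ltac:(lra) Hh Hh0) as G0.
  destruct (Rle_lt_dec (cut E T ph - cut E t1 ph) 0) as [|Hpos]; [fold h; lra|].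
  assert (D2 : cdist E ph < 2 * T) by (apply cut_supp; lra).
  assert (D1 : t1 < cdist E ph).
  { destruct (Rlt_le_dec t1 (cdist E ph)) as [|L]; auto. rewrite (cut_one E t1 ph) in Hpos; lra. }
  set (d := cdist E ph) in *.
  (* Slack in choosing an almost nearest [x]: the first bound keeps its distance comparable to [d],
     the second costs at most half of the cutoff value. *)
  set (eta := Rmin (d / 8) (T * cut E T ph / 2)).
  assert (Heta : 0 < eta) by (apply Rmin_glb_lt; [lra|]; assert (0 < T * cut E T ph) by (apply Rmult_lt_0_compat; lra); lra).
  assert (Heta1 : eta <= d / 8) by apply Rmin_l. assert (Heta2 : eta <= T * cut E T ph / 2) by apply Rmin_r.
  destruct (cdist_approx E ph eta HE Heta) as [x [Hx Hch]]. fold d in Hch.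
  pose proof (cdist_le E ph x Hx) as Hdx. fold d in Hdx.
  destruct (chord_angle ph x) as (w & Hw & Fw & Lw).
  (* Moving towards [x] does not increase the distance to [x], which preserves the outer cutoff; the
     step is short enough to stay at distance [d / 2] from [E], beyond [2 * t2], where the inner
     cutoff vanishes. *)
  assert (Pt : forall y, Rabs y <= Rabs w / 12 -> 0 <= y * w -> cut E T ph / 2 * (/ (4 * d)) <= h (ph + y)).
  { intros y Hy Hyw. set (th := ph + y).
    assert (C1 : chord th x <= chord ph x).
    { pose proof (chord_pos th x). pose proof (chord_pos ph x).
      pose proof (Fw y) as F1. fold th in F1. pose proof (Fw 0) as F0. rewrite Rplus_0_r in F0.
      assert (cos (0 - w) <= cos (y - w)).
      { replace (0 - w) with (- w) by ring. rewrite cos_neg.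
        assert (Ab : Rabs (y - w) <= Rabs w).
        { unfold Rabs in *. repeat destruct Rcase_abs; nra. }
        assert (Ca : forall z, cos z = cos (Rabs z)).
        { intros z. unfold Rabs. destruct Rcase_abs; auto. symmetry; apply cos_neg. }
        rewrite (Ca w), (Ca (y - w)). pose proof (Rabs_pos (y - w)).
        assert (Rabs w <= PI) by (apply Rabs_le; lra).
        apply cos_decr_1; lra. }
      nra. }
    pose proof (cdist_le E th x Hx) as Hd1. set (d' := cdist E th) in *.
    assert (Hd2 : d' <= d + eta) by lra.
    assert (Hchy : chord th ph <= Rabs y).
    { eapply Rle_trans; [apply chord_le|]. unfold th. replace (ph + y - ph) with y by ring. lra. }
    pose proof (cdist_lip E ph th HE) as Hd3. rewrite chord_sym in Hd3. fold d d' in Hd3.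
    assert (Hy2 : Rabs y <= 9 / 32 * d) by lra.
    assert (Hd4 : d / 2 <= d') by lra.
    assert (Z2 : cut E t2 th = 0).
    { pose proof (cut_bound E t2 th). destruct (Req_dec (cut E t2 th) 0); auto.
      assert (cdist E th < 2 * t2) by (apply cut_supp; lra). fold d' in H1. lra. }
    assert (Re : reach t2 th = 1 - d').
    { unfold reach. fold d'. rewrite Rmax_left, Rmin_right; lra. }
    assert (Cu : cut E T ph / 2 <= cut E T th).
    { pose proof (cut_lip_dist E T th ph eta ltac:(lra) Hd2 ltac:(lra)).
      assert (eta / T <= cut E T ph / 2); [|lra]. apply Rle_div_l; lra. }
    unfold h. rewrite Z2, Rminus_0_r, Rmult_1_r, Re.
    assert (PKl : / (4 * d) <= PK (1 - d') (th - ph)).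
    { unfold PK. rewrite PK_den_chord. replace (1 - (1 - d')) with d' by ring.
      pose proof (chord_pos th ph). set (q := chord th ph) in *.
      assert (Hq : q ^ 2 <= d ^ 2 / 4).
      { replace (d ^ 2 / 4) with ((d / 2) ^ 2) by field. apply pow_incr. lra. }
      assert (Hd5 : d' ^ 2 <= 3 / 2 * d ^ 2).
      { apply Rle_trans with ((9 / 8 * d) ^ 2); [apply pow_incr; lra|]. nra. }
      assert (Dn : 0 < d' ^ 2 + (1 - d') * q ^ 2).
      { assert (0 < d' ^ 2) by (apply pow_lt; lra). assert (0 <= q ^ 2) by apply pow2_ge_0. nra. }
      assert (Dn2 : d' ^ 2 + (1 - d') * q ^ 2 <= 2 * d ^ 2).
      { assert (0 <= q ^ 2) by apply pow2_ge_0. nra. }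
      apply Rmult_le_reg_r with (d' ^ 2 + (1 - d') * q ^ 2); auto.
      replace ((1 - (1 - d') ^ 2) / (d' ^ 2 + (1 - d') * q ^ 2) * (d' ^ 2 + (1 - d') * q ^ 2))
        with (1 - (1 - d') ^ 2) by (field; lra).
      apply Rle_trans with (/ (4 * d) * (2 * d ^ 2)).
      - apply Rmult_le_compat_l; auto. left; apply Rinv_0_lt_compat; lra.
      - replace (/ (4 * d) * (2 * d ^ 2)) with (d / 2) by (field; lra). nra. }
    apply Rmult_le_compat; try lra. left; apply Rinv_0_lt_compat; lra. }
  assert (Hw12 : Rabs w <= PI) by (apply Rabs_le; lra).
  assert (Wd : d / 12 <= Rabs w / 12) by lra.
  (* Recentring at [ph] keeps the interval on either side of it within one period. *)
  rewrite <- (RI_period h (ph - PI)) by auto.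
  assert (Int : forall p q, ph - PI <= p <= q -> q <= ph - PI + 2 * PI -> q - p = Rabs w / 12 ->
     (forall z, p <= z <= q -> cut E T ph / 2 * (/ (4 * d)) <= h z) ->
     (cut E T ph - cut E t1 ph) / 96 <= RInt h (ph - PI) (ph - PI + 2 * PI)).
  { intros p q Hp Hq Hpq Hz. eapply Rle_trans; [|apply (RI_sub h _ p q _); auto].
    apply Rle_trans with ((q - p) * (cut E T ph / 2 * (/ (4 * d)))).
    - rewrite Hpq. apply Rle_trans with (d / 12 * (cut E T ph / 2 * / (4 * d))).
      + replace (d / 12 * (cut E T ph / 2 * / (4 * d))) with (cut E T ph / 96) by (field; lra). lra.
      + apply Rmult_le_compat_r; auto. apply Rmult_le_pos; [lra|]. left; apply Rinv_0_lt_compat; lra.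
    - apply RI_ge_const; auto; [lra|]. intros z Hzz. apply Hz; lra. }
  destruct (Rle_lt_dec 0 w) as [W|W].
  - rewrite (Rabs_right w) in * by lra. apply (Int ph (ph + w / 12)); try lra.
    intros z Hz. replace z with (ph + (z - ph)) by ring. apply Pt.
    + apply Rabs_le; lra.
    + apply Rmult_le_pos; lra.
  - rewrite (Rabs_left w) in * by lra. apply (Int (ph + w / 12) ph); try lra.
    intros z Hz. replace z with (ph + (z - ph)) by ring. apply Pt.
    + apply Rabs_le; lra.
    + replace ((z - ph) * w) with ((- (z - ph)) * (- w)) by ring. apply Rmult_le_pos; lra.
Qed.

(* The mass of the slack between two neighbourhoods of E, by Fubini against the Poisson kernels
   centred at height cdist above each point. *)
Lemma slack_shell s T t1 t2 : s1 <= s -> exp (- s) <= T -> T <= / 8 -> 3 * T <= exp (- sigma) ->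
  0 < t2 -> 8 * t2 <= t1 -> t1 <= T ->
  RInt (fun th => (cut E T th - cut E t1 th) * slack s th) 0 (2 * PI)
  <= 1728 * PI * K * s * (bmass E T - bmass E t2).
Proof.
  intros Hs HsT HT HTs Ht2 Ht1 HtT. pose proof two_PI_pos as HPI. pose proof PI_RGT_0.
  assert (CE : forall t, 0 < t -> contR (cut E t)) by (intros; apply cut_contR; auto).
  assert (V : contR (slack s)) by (apply slack_contR; lra).
  set (g := fun th => cut E T th * (1 - cut E t2 th)).
  assert (Cg : contR g).
  { apply contR_mult; [apply CE; lra|]. apply contR_minus; [apply contR_const|apply CE; lra]. }
  assert (Kc : cont2 (fun th ph => PK (reach t2 th) (th - ph))) by (apply reach_kernel_cont; auto).
  assert (K2 : cont2 (fun th ph => g th * (PK (reach t2 th) (th - ph) * slack s ph))).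
  { apply cont2_mult; [apply cont2_const_l; auto|]. apply cont2_mult; auto. apply cont2_const_r; auto. }
  set (J := RInt (fun th => RInt (fun ph => g th * (PK (reach t2 th) (th - ph) * slack s ph)) 0 (2 * PI)) 0 (2 * PI)).
  (* Where the inner cutoff is nonzero the outer one is 1, because [2 * t2 <= T]; so the product [g]
     is the difference of the cutoffs. *)
  assert (Ig : RInt g 0 (2 * PI) = bmass E T - bmass E t2).
  { unfold bmass. rewrite <- RI_minus by (apply CE; lra). apply RI_ext. intros th. unfold g.
    pose proof (cut_bound E t2 th).
    destruct (Req_dec (cut E t2 th) 0) as [->|N]; [ring|].
    assert (cdist E th < 2 * t2) by (apply cut_supp; lra).
    rewrite (cut_one E T th); lra. }
  (* 18 pi is Harnack's 9 times the normalisation 2 pi; with the 96 of [spread_lower] it gives 1728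
     pi. *)
  assert (U : J <= 18 * PI * K * s * (bmass E T - bmass E t2)).
  { rewrite <- Ig, <- RI_scal by auto. apply RI_le; [lra| | |].
    - intros th. apply (RInt_param_cont (fun th ph => g th * (PK (reach t2 th) (th - ph) * slack s ph))); auto; lra.
    - apply contR_mult; auto using contR_const.
    - intros th. pose proof (reach_bound t2 th Ht2) as Hr.
      rewrite RI_scal by (apply contR_mult; auto; apply contR_PK; lra).
      pose proof (cut_bound E T th) as B1. pose proof (cut_bound E t2 th) as B2.
      assert (G0 : 0 <= g th) by (apply Rmult_le_pos; lra).
      destruct (Req_dec (cut E T th) 0) as [Z|Z]; [unfold g; rewrite Z; lra|].
      rewrite Rmult_comm. apply Rmult_le_compat_r; auto.
      assert (Hd : cdist E th < 2 * T) by (apply cut_supp; lra).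
      pose proof (slack_harnack s T t2 th Hs HsT HT HTs ltac:(lra) Hd) as H9. unfold Pint in H9.
      set (I := RInt (fun t => PK (reach t2 th) (th - t) * slack s t) 0 (2 * PI)) in *.
      replace I with (I / (2 * PI) * (2 * PI)) by (field; lra).
      apply Rle_trans with (9 * (K * s) * (2 * PI)); [apply Rmult_le_compat_r; lra|right; ring]. }
  assert (L : RInt (fun th => (cut E T th - cut E t1 th) * slack s th) 0 (2 * PI) <= 96 * J).
  { unfold J. rewrite (RInt_fubini _ 0 (2 * PI) 0 (2 * PI)) by (auto; lra).
    assert (CJ : contR (fun y => RInt (fun x => g x * (PK (reach t2 x) (x - y) * slack s y)) 0 (2 * PI))).
    { intros y. apply (RInt_param_cont (fun y x => g x * (PK (reach t2 x) (x - y) * slack s y))); [lra|].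
      apply (cont2_swap _ K2). }
    rewrite <- RI_scal by auto. apply RI_le; [lra| | |].
    - apply contR_mult; auto. apply contR_minus; apply CE; lra.
    - apply contR_mult; auto using contR_const.
    - intros ph.
      rewrite (RI_ext _ (fun x => slack s ph * (cut E T x * (1 - cut E t2 x) * PK (reach t2 x) (x - ph))))
        by (intros; unfold g; ring).
      rewrite RI_scal.
      + pose proof (spread_lower T t1 t2 ph HT Ht2 Ht1 HtT) as Sp.
        pose proof (slack_nonneg s ph Hs).
        set (Gp := RInt (fun th => cut E T th * (1 - cut E t2 th) * PK (reach t2 th) (th - ph)) 0 (2 * PI)) in *.
        replace (96 * (slack s ph * Gp)) with (96 * Gp * slack s ph) by ring.
        apply Rmult_le_compat_r; auto. lra.
      + apply contR_mult; auto. intros th. apply (cont2_l (fun th ph => PK (reach t2 th) (th - ph))); auto. }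
  eapply Rle_trans; [exact L|]. lra.
Qed.

(** Averaging to the circle at [6 * tau] has kernel width of order [T ^ 6], so a cutoff with
    Lipschitz constant [/ T] changes by at most [3 * T ^ 2]. Tested against u = log |f| this is
    controlled by |u| <= 2 K s - u, whose integral is known from the mean value at 0. *)
Lemma log_mass_upper T tau s : T = exp (- tau) -> s1 <= tau -> 6 * tau < s -> Rabs (lnmod f 0) <= s ->
  RInt (fun th => cut E T th * lnmod f (polar (rad s) th)) 0 (2 * PI)
  <= 6 * K * tau * bmass E T + 3 * T ^ 2 * (2 * PI * (2 * K + 1) * s).
Proof.
  intros HT Ht Hs H0. pose proof two_PI_pos as HPI.
  assert (T0 : 0 < T) by (rewrite HT; apply exp_pos).
  destruct (rad_ratio (6 * tau) s ltac:(lra) Hs) as (rho & Hrho & Hrad & Hwidth).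
  set (u := fun th => lnmod f (polar (rad s) th)).
  assert (Cu : contR u) by (apply lnmod_contR; lra).
  assert (Cc : contR (cut E T)) by (apply cut_contR; auto).
  assert (Cp : contR (Pint rho (cut E T))) by (apply Pint_contR; auto; lra).
  assert (I1 : RInt (fun th => cut E T th * Pint rho u th) 0 (2 * PI) <= 6 * K * tau * bmass E T).
  { unfold bmass. rewrite <- RI_scal by auto. apply RI_le; [lra| | |].
    - apply contR_mult; auto. apply Pint_contR; auto; lra.
    - apply contR_mult; auto using contR_const.
    - intros th. rewrite Rmult_comm. apply Rmult_le_compat_r; [apply cut_bound|].
      unfold u. rewrite <- lnmod_mean; auto; try lra; [|apply HG|apply rad_bound; lra].
      rewrite <- Hrad. pose proof (slack_nonneg (6 * tau) th ltac:(lra)) as S. unfold slack in S. lra. }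
  assert (Kap : forall th, Rabs (Pint rho (cut E T) th - cut E T th) <= 3 * T ^ 2).
  { intros th. assert (T2 : 0 < T ^ 2) by (apply pow_lt; auto).
    eapply Rle_trans; [apply (Pint_chLip_upper rho (/ T) (cut E T) th (T ^ 2)); auto; try lra; apply cut_chLip; auto|].
    assert ((/ T) ^ 2 / (4 * T ^ 2) * ((1 - rho ^ 2) / rho) <= 2 * T ^ 2); [|lra].
    apply Rle_trans with ((/ T) ^ 2 / (4 * T ^ 2) * (8 * exp (- (6 * tau)))).
    - apply Rmult_le_compat_l; auto. apply Rdiv_le_0_compat; [apply pow2_ge_0|lra].
    - right. replace (- (6 * tau)) with (- tau + - tau + - tau + - tau + - tau + - tau) by ring.
      rewrite !exp_plus, <- HT. field. lra. }
  assert (Mean : RInt u 0 (2 * PI) = 2 * PI * lnmod f 0).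
  { pose proof (lnmod_mean f (rad s) 0 0 (proj1 HG) HZ (rad_bound s ltac:(lra)) ltac:(lra)) as M.
    rewrite Rmult_0_r in M. replace (polar 0 0) with (RtoC 0) in M by (unfold polar; rewrite !Rmult_0_l; auto).
    rewrite M. unfold Pint. fold u.
    rewrite (RI_ext (fun t => PK 0 (0 - t) * lnmod f (polar (rad s) t)) u).
    - assert (X : forall x : R, x = 2 * PI * (x / (2 * PI))) by (intros; field; lra). apply X.
    - intros t. unfold PK, u. field. }
  assert (I2 : RInt (fun th => (cut E T th - Pint rho (cut E T) th) * u th) 0 (2 * PI)
     <= 3 * T ^ 2 * (2 * PI * (2 * K + 1) * s)).
  { apply Rle_trans with (RInt (fun th => 3 * T ^ 2 * (2 * K * s - u th)) 0 (2 * PI)).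
    - apply RI_le; [lra| | |].
      + apply contR_mult; auto. apply contR_minus; auto.
      + apply contR_mult; auto using contR_const. apply contR_minus; auto using contR_const.
      + intros th. pose proof (slack_nonneg s th ltac:(lra)) as S. unfold slack in S. fold (u th) in S.
        specialize (Kap th). set (k := Pint rho (cut E T) th - cut E T th) in *.
        replace ((cut E T th - Pint rho (cut E T) th) * u th) with (- k * u th) by (unfold k; ring).
        assert (Ks : 0 <= K * s) by (apply Rmult_le_pos; lra).
        apply Rle_trans with (Rabs k * Rabs (u th)).
        * rewrite <- (Rabs_Ropp k), <- Rabs_mult. apply Rle_abs.
        * apply Rmult_le_compat; auto using Rabs_pos. apply Rabs_le. lra.
    - rewrite RI_scal, RI_minus, RI_const, Mean by (auto using contR_const, contR_minus).
      apply Rmult_le_compat_l; [assert (0 <= T ^ 2) by apply pow2_ge_0; lra|].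
      apply Rabs_le_between in H0. nra. }
  rewrite Pint_adjoint in I1 by (auto; lra).
  assert (Sum : RInt (fun th => cut E T th * lnmod f (polar (rad s) th)) 0 (2 * PI) =
    RInt (fun th => Pint rho (cut E T) th * u th) 0 (2 * PI) + RInt (fun th => (cut E T th - Pint rho (cut E T) th) * u th) 0 (2 * PI)).
  { rewrite <- RI_plus; try (apply contR_mult; auto; apply contR_minus; auto); try (apply contR_mult; auto).
    apply RI_ext. intros th. unfold u. ring. }
  rewrite Sum. lra.
Qed.

Lemma log_mass_lower s t1 : s1 + K + 4 + Rabs sigma + 2 / c <= s -> t1 = exp (- ((K + 3 + c) * s)) ->
  c / 2 * s * bmass E t1 <= RInt (fun th => cut E t1 th * lnmod f (polar (rad s) th)) 0 (2 * PI).
Proof.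
  intros Hs Ht1. pose proof two_PI_pos as HPI. pose proof (Rle_abs sigma). pose proof (Rabs_pos sigma).
  assert (T1 : 0 < t1) by (rewrite Ht1; apply exp_pos).
  assert (H2c : 0 < 2 / c) by (apply Rdiv_lt_0_compat; lra).
  assert (Hcs : 2 <= c * s).
  { assert (c * (2 / c) = 2) by (field; lra). assert (c * (2 / c) <= c * s) by (apply Rmult_le_compat_l; lra). lra. }
  assert (Cc : contR (cut E t1)) by (apply cut_contR; auto).
  unfold bmass. rewrite <- RI_scal by auto.
  apply RI_le; [lra|apply contR_mult; auto using contR_const| |].
  - apply contR_mult; auto. apply lnmod_contR; lra.
  - intros th. pose proof (cut_bound E t1 th) as B.
    destruct (Req_dec (cut E t1 th) 0) as [->|Z]; [lra|].
    rewrite Rmult_comm. apply Rmult_le_compat_l; [lra|].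
    destruct (cut_supp_point E t1 th HE T1 ltac:(lra)) as [x [Hx Hch]].
    pose proof (nearby_values f K s1 c s t1 th x HG ltac:(lra) HK ltac:(lra) ltac:(lra) ltac:(lra) Hch) as N.
    destruct Hx as [_ Hx]. specialize (Hx s ltac:(lra)).
    rewrite <- (ln_exp (c / 2 * s)). apply ln_le; [apply exp_pos|].
    pose proof (Cmod_triangle_minus (f (polar (rad s) x)) (f (polar (rad s) th))) as Tr.
    rewrite Cmod_minus_sym in Tr.
    assert (exp (- (c * s)) <= 1) by (rewrite <- exp_0; apply exp_mono; lra).
    replace (c * s) with (c / 2 * s + c / 2 * s) in Hx by field. rewrite exp_plus in Hx.
    pose proof (exp_ineq1_le (c / 2 * s)). nra.
Qed.
End Plus.

(** With b the mass function, the three estimates combine, after division by [s], to (c/2) b(t2) <=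
    (c/4) b(T) + Cc (b(T) - b(t2)); moving b(t2) to the left gives the ratio [q]. *)
Lemma growth_set_bmass f K s1 c sigma : growth_bound f K s1 -> 1 <= K -> 1 <= s1 -> 0 < c ->
  (forall z, Cmod z < 1 -> f z <> 0%C) ->
  exists A q C0 tau0, 1 < A /\ 0 < q < 1 /\ 0 < C0 /\ 0 < tau0 /\
  ((exists x, growth_set f c sigma x) -> forall k : nat, bmass (growth_set f c sigma) (exp (- (tau0 * A ^ k))) <= C0 * q ^ k).
Proof.
  intros HG HK Hs1 Hc HZ. pose proof PI_RGT_0 as HPI. set (E := growth_set f c sigma).
  (* [48 * K / c] makes [6 * K * tau <= c / 8 * s], and 7 puts [s] beyond [6 * tau]. In [A], the
     excess of [K + 4 + c] over [K + 3 + c] yields [8 * t2 <= t1]; [m] makes the [T ^ 2] error cost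
     another [c / 8]. *)
  set (A1 := 48 * K / c + 7). assert (HA1 : 7 < A1) by (unfold A1; assert (0 < 48 * K / c) by (apply Rdiv_lt_0_compat; lra); lra).
  set (A := (K + 4 + c) * A1). assert (HA : 7 < A) by (unfold A; nra).
  set (Cc := 1728 * PI * K). assert (HCc : 0 < Cc) by (unfold Cc; nra).
  set (q := (Cc + c / 4) / (Cc + c / 2)).
  assert (Hq : 0 < q < 1) by (unfold q; split; [apply Rdiv_lt_0_compat; lra|apply Rlt_div_l; lra]).
  set (m := c / (48 * PI * (2 * K + 1))). assert (Hm : 0 < m) by (unfold m; apply Rdiv_lt_0_compat; nra).
  set (tau0 := s1 + K + 4 + Rabs sigma + 2 / c + Rabs (ln m) + Rabs (lnmod f 0)).
  pose proof (Rabs_pos sigma). pose proof (Rabs_pos (ln m)). pose proof (Rabs_pos (lnmod f 0)).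
  assert (H2c : 0 < 2 / c) by (apply Rdiv_lt_0_compat; lra).
  assert (Ht0 : 6 <= tau0) by (unfold tau0; lra).
  exists A, q, (2 * PI), tau0. repeat split; try lra. intros HE.
  assert (Step : forall tau, tau0 <= tau -> bmass E (exp (- (A * tau))) <= q * bmass E (exp (- tau))).
  { intros tau Ht. set (T := exp (- tau)). set (s := A1 * tau).
    assert (Hs : 7 * tau <= s) by (unfold s; nra).
    set (t1 := exp (- ((K + 3 + c) * s))). set (t2 := exp (- (A * tau))).
    assert (T0 : 0 < T) by apply exp_pos. assert (T10 : 0 < t1) by apply exp_pos. assert (T20 : 0 < t2) by apply exp_pos.
    assert (E3 : 8 <= exp 3).
    { replace 3 with (1 + 1 + 1) by ring. rewrite !exp_plus. pose proof (exp_ineq1_le 1). nra. }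
    assert (HTs : forall r, r <= tau - 3 -> 8 * T <= exp (- r)).
    { intros r Hr. apply Rle_trans with (exp 3 * T); [apply Rmult_le_compat_r; lra|].
      unfold T. rewrite <- exp_plus. apply exp_mono. lra. }
    assert (T8 : T <= / 8) by (pose proof (HTs 0 ltac:(lra)) as X; rewrite Ropp_0, exp_0 in X; lra).
    assert (Tsig : 3 * T <= exp (- sigma)).
    { pose proof (Rle_abs sigma). pose proof (HTs sigma ltac:(unfold tau0 in Ht; lra)). lra. }
    assert (T12 : 8 * t2 <= t1).
    { apply Rle_trans with (exp 3 * t2); [apply Rmult_le_compat_r; lra|].
      unfold t1, t2. rewrite <- exp_plus. apply exp_mono. unfold A, s in *. nra. }
    assert (T1T : t1 <= T) by (unfold t1, T; apply exp_mono; nra).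
    assert (sT : exp (- s) <= T) by (unfold T; apply exp_mono; lra).
    assert (Tm : T <= m).
    { rewrite <- (exp_ln m) by auto. apply exp_mono.
      pose proof (Rle_abs (- ln m)) as X. rewrite Rabs_Ropp in X. unfold tau0 in Ht. lra. }
    assert (L1 := log_mass_lower f K s1 c sigma HG HK Hs1 Hc HZ HE s t1 ltac:(unfold tau0 in Ht; lra) eq_refl).
    assert (U1 := log_mass_upper f K s1 c sigma HG HK Hs1 HZ HE T tau s eq_refl
        ltac:(unfold tau0 in Ht; lra) ltac:(lra) ltac:(unfold tau0 in Ht; lra)).
    assert (S1 := slack_shell f K s1 c sigma HG Hs1 Hc HZ HE s T t1 t2 ltac:(unfold tau0 in Ht; lra) sT T8 Tsig T20 T12 T1T).
    assert (BT := bmass_lower E T HE (fun x Hx => proj1 Hx) ltac:(lra)).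
    assert (B2 : bmass E t2 <= bmass E t1) by (apply bmass_mono; auto; lra).
    fold E in L1, U1, S1.
    assert (CE : forall t, 0 < t -> contR (cut E t)) by (intros; apply cut_contR; auto).
    assert (Cu : contR (fun th => lnmod f (polar (rad s) th))) by (apply (lnmod_contR f K s1 HG HZ); lra).
    assert (Split : RInt (fun th => (cut E T th - cut E t1 th) * slack f K s th) 0 (2 * PI) =
      K * s * (bmass E T - bmass E t1) - (RInt (fun th => cut E T th * lnmod f (polar (rad s) th)) 0 (2 * PI)
        - RInt (fun th => cut E t1 th * lnmod f (polar (rad s) th)) 0 (2 * PI))).
    { unfold bmass. rewrite <- !RI_minus by (try apply CE; try apply contR_mult; auto).
      rewrite <- RI_scal by (apply contR_minus; auto).
      rewrite <- RI_minus by (repeat first [apply contR_mult | apply contR_minus | apply contR_const]; auto).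
      apply RI_ext. intros th. unfold slack. ring. }
    assert (B1 : bmass E t1 <= bmass E T) by (apply bmass_mono; auto; lra).
    assert (Hsp : 0 < s) by lra.
    assert (P1 : 6 * K * tau <= c / 8 * s).
    { unfold s, A1. replace (c / 8 * ((48 * K / c + 7) * tau)) with (6 * K * tau + 7 * c / 8 * tau) by (field; lra). nra. }
    assert (P2 : 3 * T ^ 2 * (2 * PI * (2 * K + 1) * s) <= c / 8 * s * bmass E T).
    { assert (X : 6 * PI * (2 * K + 1) * T <= c / 8).
      { apply Rle_trans with (6 * PI * (2 * K + 1) * m); [apply Rmult_le_compat_l; [nra|auto]|].
        right. unfold m. field. nra. }
      replace (3 * T ^ 2 * (2 * PI * (2 * K + 1) * s)) with ((6 * PI * (2 * K + 1) * T) * s * T) by ring.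
      apply Rmult_le_compat; try lra.
      - apply Rmult_le_pos; [apply Rmult_le_pos; [nra|lra]|lra].
      - apply Rmult_le_compat_r; lra. }
    assert (P3 : 6 * K * tau * bmass E T <= c / 8 * s * bmass E T) by (apply Rmult_le_compat_r; lra).
    assert (P4 : 0 <= K * s * (bmass E T - bmass E t1)) by (repeat apply Rmult_le_pos; lra).
    assert (P5 : c / 2 * s * bmass E t2 <= c / 2 * s * bmass E t1).
    { apply Rmult_le_compat_l; [|auto]. repeat apply Rmult_le_pos; lra. }
    fold Cc in S1.
    assert (F : s * ((Cc + c / 2) * bmass E t2) <= s * ((Cc + c / 4) * bmass E T)) by lra.
    apply Rmult_le_reg_l in F; auto.
    apply Rmult_le_reg_l with (Cc + c / 2); [lra|].
    replace ((Cc + c / 2) * (q * bmass E T)) with ((Cc + c / 4) * bmass E T) by (unfold q; field; lra). exact F. }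
  induction k as [|k IH].
  - simpl. rewrite !Rmult_1_r. apply bmass_le; auto. apply exp_pos.
  - replace (tau0 * A ^ S k) with (A * (tau0 * A ^ k)) by (simpl; ring).
    assert (PA : 1 <= A ^ k) by (apply pow_R1_Rle; lra).
    eapply Rle_trans; [apply Step; nra|]. simpl.
    replace (2 * PI * (q * q ^ k)) with (q * (2 * PI * q ^ k)) by ring.
    apply Rmult_le_compat_l; [lra|exact IH].
Qed.

(** * The theorem *)

Lemma exp_neg_small s d : 0 < d -> / d <= s -> exp (- s) < d.
Proof.
  intros Hd Hs. assert (0 < / d) by (apply Rinv_0_lt_compat; auto).
  rewrite exp_Ropp, <- (Rinv_inv d). apply Rinv_lt_contravar.
  - apply Rmult_lt_0_compat; auto. apply exp_pos.
  - pose proof (exp_ineq1_le s). lra.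
Qed.

Lemma growth_ratio_rad f th s : 0 < s -> growth_ratio f th (rad s) = ln (Cmod (f (polar (rad s) th))) / s.
Proof.
  intros Hs. unfold growth_ratio. unfold rad at 2.
  replace (1 - (1 - exp (- s))) with (exp (- s)) by ring.
  rewrite ln_exp, Rabs_Ropp, Rabs_right by lra. auto.
Qed.

(** One integer supplies both the rate [/ INR (S m)] and the starting height [INR (S m)], so a
    single index enumerates the covering sets. *)
Lemma eventually_index c d : 0 < c -> 0 < d -> exists m : nat, / INR (S m) <= c /\
  forall s, INR (S m) <= s -> 1 - d < rad s < 1.
Proof.
  intros Hc Hd. destruct (nat_above (/ c + / d)) as [m [Hm _]].
  assert (0 < / c) by (apply Rinv_0_lt_compat; auto). assert (0 < / d) by (apply Rinv_0_lt_compat; auto).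
  exists m. rewrite S_INR. split.
  - rewrite <- (Rinv_inv c). apply Rinv_le_contravar; lra.
  - intros s Hs. pose proof (exp_neg_small s d Hd ltac:(lra)). pose proof (exp_pos (- s)).
    unfold rad. lra.
Qed.

Lemma D_plus_growth f th : D_plus f th -> exists m : nat, growth_set f (/ INR (S m)) (INR (S m)) th.
Proof.
  intros [Hth [c [Hc [d [Hd H]]]]].
  destruct (eventually_index c d Hc Hd) as [m [Hm Hr]]. exists m. split; auto.
  assert (P : 1 <= INR (S m)) by (rewrite S_INR; pose proof (pos_INR m); lra).
  intros s Hs. destruct (H (rad s) (Hr s Hs)) as [Hf Hg].
  rewrite growth_ratio_rad in Hg by lra. apply Rlt_div_r in Hg; [|lra].
  rewrite <- (exp_ln (Cmod (f (polar (rad s) th)))) by (apply Cmod_gt_0; auto).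
  apply exp_mono. apply Rle_trans with (c * s); [|lra]. apply Rmult_le_compat_r; lra.
Qed.

Lemma D_minus_decay f th : D_minus f th -> exists m : nat, decay_set f (/ INR (S m)) (INR (S m)) th.
Proof.
  intros [Hth [c [Hc [d [Hd H]]]]].
  destruct (eventually_index c d Hc Hd) as [m [Hm Hr]]. exists m. split; auto.
  assert (P : 1 <= INR (S m)) by (rewrite S_INR; pose proof (pos_INR m); lra).
  intros s Hs. destruct (classic (f (polar (rad s) th) = 0%C)) as [E|E].
  { rewrite E, Cmod_0. left; apply exp_pos. }
  destruct (H (rad s) (Hr s Hs)) as [|Hg]; [contradiction|].
  rewrite growth_ratio_rad in Hg by lra. apply Rlt_div_l in Hg; [|lra].
  rewrite <- (exp_ln (Cmod (f (polar (rad s) th)))) by (apply Cmod_gt_0; auto).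
  apply exp_mono. apply Rle_trans with (- (c * s)); [lra|]. apply Ropp_le_contravar, Rmult_le_compat_r; lra.
Qed.

Theorem theorem1 (lam : R -> R)
  (lam_incr : forall s t : R, 0 <= s -> s <= t -> t < 1 -> lam s <= lam t)
  (lam_nonneg : forall t : R, 0 <= t < 1 -> 0 <= lam t)
  (lam0 : lam 0 = 0)
  (lam_small : forall omega : R, 0 < omega ->
     forall d : R, 0 < d -> exists eta : R, 0 < eta /\
       forall t : R, 0 < t < eta -> Rabs (lam t) <= d * (t * Rpower (Rabs (ln t)) omega)) :
  (forall f : C -> C, Korenblum f -> zero_free f ->
      Hausdorff lam (D_plus f) = Finite 0) /\
  (forall f : C -> C, Korenblum f -> (exists z : C, in_disc z /\ f z <> 0%C) ->
      Hausdorff lam (D_minus f) = Finite 0).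
Proof.
  assert (Hpos : forall m, 0 < / INR (S m)) by (intros m; apply Rinv_0_lt_compat, lt_0_INR; lia).
  split.
  - intros f Hf HZ. destruct (korenblum_growth f Hf) as (K & s1 & HK & Hs1 & HG).
    apply (hausdorff_zero lam _ (fun m => growth_set f (/ INR (S m)) (INR (S m)))); auto.
    + intros th. apply D_plus_growth.
    + intros m th [H _]. exact H.
    + intros m. destruct (growth_set_bmass f K s1 _ (INR (S m)) HG HK Hs1 (Hpos m) HZ)
        as (A & q & C0 & tau0 & H1 & H2 & H3 & H4 & H5).
      exact (small_covers_of_decay lam _ A q C0 tau0 lam_small H1 H2 H3 H4 H5).
  - intros f Hf [z0 [Hz0 Hfz0]]. destruct (korenblum_growth f Hf) as (K & s1 & HK & Hs1 & HG).
    apply (hausdorff_zero lam _ (fun m => decay_set f (/ INR (S m)) (INR (S m)))); auto.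
    + intros th. apply D_minus_decay.
    + intros m th [H _]. exact H.
    + intros m. destruct (decay_set_bmass f K s1 _ (INR (S m)) z0 HG HK Hs1 (Hpos m) Hz0 Hfz0)
        as (A & q & C0 & tau0 & H1 & H2 & H3 & H4 & H5).
      exact (small_covers_of_decay lam _ A q C0 tau0 lam_small H1 H2 H3 H4 H5).
Qed.
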